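(* Let $s,r\ge0$ be integers with $s\ge r-2$. All connections on $J^1E$ (i.e. on $\pi^1_0:J^1E\to E$) naturally given by a classical connection $\Lambda$ on $M$ (in order $s$) and by a general linear connection $K$ on $E$ (in order $r$) are of maximal order one (i.e. depend only on the $1$-jets of $\Lambda$ and $K$) and are of the form $$\widetilde\Gamma(\Lambda,K)=\Gamma(\Lambda,K)+\theta\circ h^K\big(S(\Lambda)\big)+L\otimes G(\Lambda,K)+e_2\,R[K](L)+h_1\,\nu_K\otimes\hat T,$$ where $\Gamma(\Lambda,K)=\chi(D(\Lambda,K))$, $L$ is the Liouville vertical vector field on $E$, $e_2,h_1\in\mathbb R$, $$S(\Lambda)=a_1T+a_2\,I_{TM}\otimes\hat T+a_3\,\hat T\otimes I_{TM},$$ $$\begin{aligned}G(\Lambda,K)={}&b_1C^{12}_{13}(T\otimes T)+b_2C^{12}_{31}(T\otimes T)+b_3C^{12}_{12}(T\otimes T)+c_1C^1_1\widetilde\nabla T+c_2\overline{C^1_1\widetilde\nabla T}+c_3C^1_3\widetilde\nabla T\\&+d_1C^1_1R[\widetilde\Lambda]+d_2C^1_2R[\widetilde\Lambda]+e_1C^1_1R[K],\end{aligned}$$ with real coefficients $a_1,a_2,a_3,b_1,b_2,b_3,c_1,c_2,c_3,d_1,d_2,e_1$. (All objects are defined in the context.)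
   Context: All manifolds and maps are smooth; the summation convention is used. $p:E\to M$ is a vector bundle with $m$-dimensional base and $n$-dimensional fibres, with local linear fibre coordinates $(x^A)=(x^\lambda,y^i)$; Greek indices run over $1,\dots,m$, small Latin indices over $1,\dots,n$, capital indices over both kinds. $(\partial_\lambda,\partial_i)$ and $(d^\lambda,d^i)$ are the induced local bases of $TE$ and $T^*E$. $\pi^1_0:J^1E\to E$ is the first jet prolongation with induced coordinates $(x^\lambda,y^i;y^i_\lambda)$, and $\partial^\lambda_i=\partial/\partial y^i_\lambda$. A general linear connection $K$ on $E$ is a linear section $K:E\to J^1E$, equivalently $K=d^\lambda\otimes(\partial_\lambda+K_j{}^i{}_\lambda y^j\partial_i)$ with $K_j{}^i{}_\lambda$ local functions on $M$. A classical connection $\Lambda$ on $M$ (not necessarily symmetric) is a linear connection on $TM\to M$, $\Lambda=d^\lambda\otimes(\partial_\lambda+\Lambda_\nu{}^\mu{}_\lambda\dot x^\nu\dot\partial_\mu)$. Thus covariant derivatives are $\nabla_\lambda s^i=\partial_\lambda s^i-K_j{}^i{}_\lambda s^j$ and $\nabla_\lambda X^\mu=\partial_\lambda X^\mu-\Lambda_\nu{}^\mu{}_\lambda X^\nu$. A connection on $J^1E\to E$ is $\Gamma:J^1E\to T^*E\otimes TJ^1E$ over the identity of $TE$, $\Gamma=d^A\otimes(\partial_A+\Gamma_A{}^i{}_\lambda\partial_i^\lambda)$ with $\Gamma_A{}^i{}_\lambda$ local functions on $J^1E$. Using $VJ^1E=J^1E\times_E(T^*M\otimes VE)$ (vertical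 bundle of $\pi^1_0$), the difference of two connections on $J^1E$ is a map $J^1E\to T^*E\otimes VE\otimes T^*M$ over $E$, $\phi_A{}^i{}_\mu\,d^A\otimes\partial_i\otimes d^\mu$. For a classical connection $D=d^C\otimes(\partial_C+D_B{}^A{}_C\dot x^B\dot\partial_A)$ on $E$, $\chi(D)$ is the connection on $J^1E\to E$ given by $\Gamma_A{}^i{}_\lambda=D_A{}^i{}_jy^j_\lambda+D_A{}^i{}_\lambda-y^i_\mu(D_A{}^\mu{}_jy^j_\lambda+D_A{}^\mu{}_\lambda)$. $D(\Lambda,K)$ is the unique classical connection $D$ on $E$ with $\nabla^D_{h^K(X)}h^K(Y)=h^K(\nabla^\Lambda_XY)$, $\nabla^D_{h^K(X)}s^V=(\nabla^K_Xs)^V$, $\nabla^D_{s^V}h^K(X)=0$, $\nabla^D_{s^V}\sigma^V=0$ for all vector fields $X,Y$ on $M$ and sections $s,\sigma$ of $E$ ($s^V$ is the vertical lift); in coordinates $D_\mu{}^\lambda{}_\nu=\Lambda_\mu{}^\lambda{}_\nu$, $D_\mu{}^i{}_\nu=(\partial_\nu K_p{}^i{}_\mu-K_r{}^i{}_\nu K_p{}^r{}_\mu+K_p{}^i{}_\rho\Lambda_\mu{}^\rho{}_\nu)y^p$, $D_\mu{}^i{}_k=K_k{}^i{}_\mu$, $D_j{}^i{}_\nu=K_j{}^i{}_\nu$, other components zero. Symmetrization and torsion: $\widetilde\Lambda_\mu{}^\lambda{}_\nu=\frac12(\Lambda_\mu{}^\lambda{}_\nu+\Lambda_\nu{}^\lambda{}_\mu)$,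 $T_\mu{}^\lambda{}_\nu=\frac12(\Lambda_\mu{}^\lambda{}_\nu-\Lambda_\nu{}^\lambda{}_\mu)$; $\hat T_\mu=T_\rho{}^\rho{}_\mu$; $I_{TM}$ is the identity $(1,1)$-tensor. $\widetilde\nabla$ (also a semicolon, derivative index last) is the covariant differential with respect to $\widetilde\Lambda$. The curvature of $K$ is $R[K]=R_j{}^i{}_{\lambda\mu}\,d^j\otimes\partial_i\otimes d^\lambda\wedge d^\mu=-2(\partial_\lambda K_j{}^i{}_\mu+K_j{}^p{}_\lambda K_p{}^i{}_\mu)\,d^j\otimes\partial_i\otimes d^\lambda\wedge d^\mu$, with $R_j{}^i{}_{\lambda\mu}$ antisymmetric in $\lambda,\mu$; $\widetilde R_\nu{}^\rho{}_{\lambda\mu}$ are the components of $R[\widetilde\Lambda]$, defined by the same formula with $E=TM$. In components $S_\mu{}^\lambda{}_\nu=a_1T_\mu{}^\lambda{}_\nu+a_2\delta^\lambda_\mu\hat T_\nu+a_3\hat T_\mu\delta^\lambda_\nu$. $C^{ij}_{kl}$, $C^i_k$ denote contraction of the $i$-th (and $j$-th) upper index with the $k$-th (and $l$-th) lower index, the bar denotes exchange of the two subscripts, so $G_{\mu\nu}=b_1T_\rho{}^\rho{}_\mu T_\sigma{}^\sigma{}_\nu+b_2T_\sigma{}^\rho{}_\mu T_\rho{}^\sigma{}_\nu+b_3T_\rho{}^\rho{}_\sigma T_\mu{}^\sigma{}_\nu+c_1T_\rho{}^\rho{}_{\mu;\nu}+c_2T_\rho{}^\rho{}_{\nu;\mu}+c_3T_\mu{}^\rho{}_{\nu;\rho}+d_1\widetilde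 R_\rho{}^\rho{}_{\mu\nu}+d_2\widetilde R_\mu{}^\rho{}_{\rho\nu}+e_1R_p{}^p{}_{\mu\nu}$. $h^K:TM\to TE$ is the horizontal lift, $h^K(\partial_\lambda)=\partial_\lambda+K_j{}^i{}_\lambda y^j\partial_i$; $\theta=(d^i-y^i_\lambda d^\lambda)\otimes\partial_i:J^1E\times_ETE\to VE$ is the complementary contact map; $\nu_K=(d^i-K_j{}^i{}_\lambda y^jd^\lambda)\otimes\partial_i$ is the vertical projection; $L=y^i\partial_i$. Forms on $M$ are pulled back. As maps $J^1E\to T^*E\otimes VE\otimes T^*M$: $\theta\circ h^K(S(\Lambda))=S_\lambda{}^\rho{}_\mu(K_j{}^i{}_\rho y^j-y^i_\rho)\,d^\lambda\otimes\partial_i\otimes d^\mu$, $L\otimes G=y^iG_{\lambda\mu}\,d^\lambda\otimes\partial_i\otimes d^\mu$, $R[K](L)=R_j{}^i{}_{\lambda\mu}y^j\,d^\lambda\otimes\partial_i\otimes d^\mu$, $\nu_K\otimes\hat T=\hat T_\mu(d^i-K_j{}^i{}_\lambda y^jd^\lambda)\otimes\partial_i\otimes d^\mu$. Naturality: a connection on $J^1E$ naturally given by $\Lambda$ in order $s$ and $K$ in order $r$ is a rule assigning to every vector bundle $E\to M$ with the given $m,n$ and every pair $(\Lambda,K)$ a connection on $J^1E\to E$ whose value at $w\in J^1E$ is a smooth function of $w$ and of the jets $j^s\Lambda,j^rK$ at the base point of $w$, and which commutes with all local fibre-linear diffeomorphisms of vector bundles covering embeddings of bases (acting on $J^1E$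 by their jet prolongations). *)

(* Defs.v *)
From HB Require Import structures.
From mathcomp Require Import all_boot all_order all_algebra.
From mathcomp Require Import all_classical all_reals all_analysis.

Set Implicit Arguments.
Unset Strict Implicit.
Unset Printing Implicit Defensive.
Import Order.TTheory GRing.Theory Num.Theory.
Import numFieldNormedType.Exports.
Local Open Scope classical_set_scope.
Local Open Scope ring_scope.

(* C^oo on the open set D: all iterated directional derivatives exist and are
   differentiable at the points of D. *)
Definition smooth_on (R : realType) (V W : normedModType R) (D : set V)
    (f : V -> W) : Prop :=
  forall (vs : seq V) (x : V), D x ->
    differentiable (foldr (fun v g => 'D_v g) f vs) x.

(* Vectors are rows and matrices act on the right, as in the library's 'J. *)

Section VectorBundles.
Variables (R : realType) (m n : nat).

(* Local linear fibre coordinates (x^lambda, y^i) over the open set cdom, with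
   their inverse parametrizations.  The values of xco, yco outside cdom and of
   xinv outside the image of cdom are irrelevant. *)
Record chart (M : topologicalType) (F : M -> lmodType R) := Chart {
  cdom : set M;
  xco : M -> 'rV[R]_m;
  xinv : 'rV[R]_m -> M;
  yco : forall p : M, F p -> 'rV[R]_n;
  yinv : forall p : M, 'rV[R]_n -> F p }.

Definition cimg (M : topologicalType) (F : M -> lmodType R) (c : chart F) :
  set 'rV[R]_m := xco c @` cdom c.

Definition is_chart (M : topologicalType) (F : M -> lmodType R) (c : chart F) :
    Prop :=
  [/\ open (cdom c), open (cimg c),
      forall p, cdom c p -> xinv c (xco c p) = p,
      (forall p, cdom c p -> {for p, continuous (xco c)}) /\
      (forall x, cimg c x -> {for x, continuous (xinv c)})
    & forall p, cdom c p ->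
        [/\ linear (yco c (p := p)), cancel (yco c (p := p)) (yinv c p)
          & cancel (yinv c p) (yco c (p := p))]].

Section Morphisms.
Variables (M M' : topologicalType) (F : M -> lmodType R) (F' : M' -> lmodType R).
Variables (U : set M) (f : M -> M') (phi : forall p, F p -> F' (f p)).

Definition overlap (c : chart F) (c' : chart F') : set 'rV[R]_m :=
  xco c @` (U `&` cdom c `&` f @^-1` cdom c').

Definition base_rep (c : chart F) (c' : chart F') (x : 'rV[R]_m) : 'rV[R]_m :=
  xco c' (f (xinv c x)).

Definition fibre_rep (c : chart F) (c' : chart F') (x : 'rV[R]_m) : 'M[R]_n :=
  lin1_mx (fun y => yco c' (phi (yinv c (xinv c x) y))).

Definition smooth_rep (c : chart F) (c' : chart F') : Prop :=
  smooth_on (overlap c c') (base_rep c c') /\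
  smooth_on (overlap c c') (fibre_rep c c').

End Morphisms.

Record vbundle := VBundle {
  base : topologicalType;
  fibre : base -> lmodType R;
  cidx : Type;
  atlas : cidx -> chart fibre;
  base_hausdorff : hausdorff_space base;
  base_second_countable : @second_countable base;
  atlas_chart : forall a, is_chart (atlas a);
  atlas_cover : forall p : base, exists a, cdom (atlas a) p;
  atlas_smooth : forall a b,
    smooth_rep setT (f := id) (fun p (e : fibre p) => e) (atlas a) (atlas b) }.

(* Fibre-linear diffeomorphism from the restriction of E to the open set U into
   E', covering an embedding U -> base E'.  As both bases have dimension m, an
   embedding is the same thing as an injective immersion. *)
Definition local_iso (E E' : vbundle) (U : set (base E)) (f : base E -> base E')
    (phi : forall p, fibre p -> fibre (f p)) : Prop :=
  [/\ open U, (forall p, U p -> {for p, continuous f}),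
      (forall p q, U p -> U q -> f p = f q -> p = q),
      (forall p, U p -> linear (phi p) /\ bijective (phi p))
    & forall a b,
        smooth_rep U phi (atlas a) (atlas b) /\
        forall x, overlap U f (atlas a) (atlas b) x ->
          'J (base_rep f (atlas a) (atlas b)) x \in unitmx].

End VectorBundles.

(* Coordinates ((x, y), v) on the first jet prolongation, v l i being y^i_l. *)
Notation jco R m n := ('rV[R]_m * 'rV[R]_n * 'M[R]_(m, n))%type.

Section Connections.
Variable R : realType.

(* Coordinate form of the fibre-linear map (x, y) |-> (f x, y A(x)). *)
Definition bmap (m n : nat) (f : 'rV[R]_m -> 'rV[R]_m) (A : 'rV[R]_m -> 'M[R]_n)
    (z : 'rV[R]_m * 'rV[R]_n) : 'rV[R]_m * 'rV[R]_n :=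
  (f z.1, z.2 *m A z.1).

(* Jet prolongation of bmap f A.  The jet (x, y, v) is represented by the
   section s(x') = y + (x' - x) v, whose image s' satisfies s' (f x') =
   s(x') A(x'), hence 'J f *m 'J s' = 'J (s A). *)
Definition jmap (m n : nat) (f : 'rV[R]_m -> 'rV[R]_m) (A : 'rV[R]_m -> 'M[R]_n)
    (w : jco R m n) : jco R m n :=
  let x := w.1.1 in let y := w.1.2 in let v := w.2 in
  (bmap f A w.1,
   invmx ('J f x) *m 'J (fun x' => (y + (x' - x) *m v) *m A x') x).

(* Components of a linear connection, i.e. of a linear section
   y^i_l = K_j^i_l y^j of the jet bundle: K x j i l is K_j^i_l at x. *)
Definition lcomp (m n : nat) : Type := 'rV[R]_m -> 'I_n -> 'I_n -> 'I_m -> R.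

Definition lsection (m n : nat) (K : lcomp m n) (z : 'rV[R]_m * 'rV[R]_n) : jco R m n :=
  (z, \matrix_(l, i) \sum_j K z.1 j i l * z.2 0 j).

Definition lrelated (m n : nat) (f : 'rV[R]_m -> 'rV[R]_m)
    (A : 'rV[R]_m -> 'M[R]_n) (K K' : lcomp m n) (x : 'rV[R]_m) : Prop :=
  forall y : 'rV[R]_n,
    jmap f A (lsection K (x, y)) = lsection K' (bmap f A (x, y)).

(* Geometric objects on E are families of components in the charts of the atlas
   that are related by the coordinate changes; components outside the images of
   the charts are irrelevant. *)

(* Components of a connection on J^1E: Gam w A i l is Gamma_A^i_l at w, where
   A = inl lambda or inr j. *)
Definition jcomp (m n : nat) : Type :=
  jco R m n -> 'I_m + 'I_n -> 'I_n -> 'I_m -> R.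

Definition hlift (m n : nat) (Gam : jcomp m n)
    (w : jco R m n) (xi : 'rV[R]_m * 'rV[R]_n) : jco R m n :=
  (xi, \matrix_(l, i) (\sum_k xi.1 0 k * Gam w (inl k) i l +
                       \sum_j xi.2 0 j * Gam w (inr j) i l)).

Definition jrelated (m n : nat) (f : 'rV[R]_m -> 'rV[R]_m)
    (A : 'rV[R]_m -> 'M[R]_n) (Gam Gam' : jcomp m n) (w : jco R m n) : Prop :=
  forall xi : 'rV[R]_m * 'rV[R]_n,
    let z := w.1 in
    'd (jmap f A) w (hlift Gam w xi) =
    hlift Gam' (jmap f A w) ('d (bmap f A) z xi).

Variables m n : nat.

Section Related.
Variables (E E' : vbundle R m n) (U : set (base E)) (f : base E -> base E').
Variable phi : forall p, fibre p -> fibre (f p).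

Definition lconn_related (K : cidx E -> lcomp m n) (K' : cidx E' -> lcomp m n) :
    Prop :=
  forall a b x, overlap U f (atlas a) (atlas b) x ->
    lrelated (base_rep f (atlas a) (atlas b))
      (fibre_rep phi (atlas a) (atlas b)) (K a) (K' b) x.

(* The transition functions of TM are those of M together with their
   Jacobian matrices. *)
Definition cconn_related (L : cidx E -> lcomp m m) (L' : cidx E' -> lcomp m m) :
    Prop :=
  forall a b x, overlap U f (atlas a) (atlas b) x ->
    lrelated (base_rep f (atlas a) (atlas b))
      (fun x => 'J (base_rep f (atlas a) (atlas b)) x) (L a) (L' b) x.

Definition jconn_related (G : cidx E -> jcomp m n) (G' : cidx E' -> jcomp m n) :
    Prop :=
  forall a b w, overlap U f (atlas a) (atlas b) w.1.1 ->
    jrelated (base_rep f (atlas a) (atlas b))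
      (fibre_rep phi (atlas a) (atlas b)) (G a) (G' b) w.

End Related.

Variable E : vbundle R m n.

Record linear_connection := LinearConnection {
  lc :> cidx E -> lcomp m n;
  lc_smooth : forall a j i l,
    smooth_on (cimg (atlas a)) (fun x => lc a x j i l : R^o);
  lc_compat : lconn_related setT (f := id) (fun p (e : fibre p) => e) lc lc }.

Record classical_connection := ClassicalConnection {
  cc :> cidx E -> lcomp m m;
  cc_smooth : forall a k l p,
    smooth_on (cimg (atlas a)) (fun x => cc a x k l p : R^o);
  cc_compat : cconn_related setT id cc cc }.

Record jet_connection := JetConnection {
  jc :> cidx E -> jcomp m n;
  jc_smooth : forall a A i l,
    smooth_on [set w | cimg (atlas a) w.1.1] (fun w => jc a w A i l : R^o);
  jc_compat : jconn_related setT (f := id) (fun p (e : fibre p) => e) jc jc }.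

End Connections.

Section Naturality.
Variables (R : realType) (m n : nat).

Definition pd (l : 'I_m) (f : 'rV[R]_m -> R^o) : 'rV[R]_m -> R^o :=
  'D_(delta_mx 0 l) f.

Definition midx (s : nat) : Type :=
  {al : {ffun 'I_m -> 'I_s.+1} | (\sum_l al l <= s)%N}.
HB.instance Definition _ (s : nat) := Finite.on (midx s).

Definition mpd (s : nat) (al : midx s) (f : 'rV[R]_m -> R^o) :
    'rV[R]_m -> R^o :=
  foldr (fun l g => iter (val al l) (pd l) g) f (enum 'I_m).

Definition jet_idx (k s : nat) : finType := (midx s * ('I_k * 'I_k * 'I_m))%type.

Definition jet (k s : nat) (K : lcomp R m k) (x : 'rV[R]_m) :
    'rV[R]_#|jet_idx k s| :=
  \row_t let q := enum_val t in
         mpd q.1 (fun x' => K x' q.2.1.1 q.2.1.2 q.2.2) x.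

Definition rule : Type := forall E : vbundle R m n,
  classical_connection E -> linear_connection E -> jet_connection E.

Definition of_order (s r : nat) (Gam : rule) : Prop :=
  forall (E : vbundle R m n) (a : cidx E) A i l,
  exists F : jco R m n *
             ('rV[R]_#|jet_idx m s| * 'rV[R]_#|jet_idx n r|) -> R^o,
    smooth_on [set z | cimg (atlas a) z.1.1.1] F /\
    forall (L : classical_connection E) (K : linear_connection E) w,
      cimg (atlas a) w.1.1 ->
      Gam E L K a w A i l = F (w, (jet s (L a) w.1.1, jet r (K a) w.1.1)).

Definition commutes_with_local_isos (Gam : rule) : Prop :=
  forall (E E' : vbundle R m n) (U : set (base E)) (f : base E -> base E')
    (phi : forall p, fibre p -> fibre (f p)),
  local_iso U phi ->
  forall (L : classical_connection E) (L' : classical_connection E')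
    (K : linear_connection E) (K' : linear_connection E'),
  cconn_related U f L L' -> lconn_related U phi K K' ->
  jconn_related U phi (Gam E L K) (Gam E' L' K').

Definition natural (s r : nat) (Gam : rule) : Prop :=
  of_order s r Gam /\ commutes_with_local_isos Gam.

End Naturality.

(* Index order of all components is that of the subscripts and superscripts
   read from left to right. *)
Section Components.
Variables (R : realType) (m n : nat) (L : lcomp R m m) (K : lcomp R m n).

Definition delta (T : eqType) (i j : T) : R := (i == j)%:R.

Definition symc : lcomp R m m :=
  fun x mu la nu => 2^-1 * (L x mu la nu + L x nu la mu).

Definition tor (x : 'rV[R]_m) (mu la nu : 'I_m) : R :=
  2^-1 * (L x mu la nu - L x nu la mu).

Definition htor (x : 'rV[R]_m) (mu : 'I_m) : R := \sum_rho tor x rho rho mu.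

(* T_mu^la_{nu;rho}; lower indices get a plus sign since nabla_la X^mu =
   d_la X^mu - L_nu^mu_la X^nu. *)
Definition nabla_tor (x : 'rV[R]_m) (mu la nu rho : 'I_m) : R :=
  pd rho (fun x' => tor x' mu la nu) x
  - \sum_sg symc x sg la rho * tor x mu sg nu
  + \sum_sg symc x mu sg rho * tor x sg la nu
  + \sum_sg symc x nu sg rho * tor x mu la sg.

(* The antisymmetric components of -2 (d_la K_j^i_mu + K_j^p_la K_p^i_mu)
   d^la /\ d^mu. *)
Definition curv (k : nat) (C : lcomp R m k) (x : 'rV[R]_m) (j i : 'I_k)
    (la mu : 'I_m) : R :=
  let X a b := pd a (fun x' => C x' j i b) x + \sum_p C x j p a * C x p i b in
  - (X la mu - X mu la).

(* Components D_B^A_C of the classical connection D(L, K) on E, determined by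
   nabla_{h X} h Y = h (nabla_X Y), nabla_{h X} s^V = (nabla_X s)^V,
   nabla_{s^V} h X = 0 and nabla_{s^V} t^V = 0, where h is the K-horizontal
   lift and ^V the vertical lift. *)
Definition DLK (z : 'rV[R]_m * 'rV[R]_n) (B A C : 'I_m + 'I_n) : R :=
  let x := z.1 in let y := z.2 in
  match B, A, C with
  | inl mu, inl la, inl nu => L x mu la nu
  | inl mu, inr i, inl nu =>
      \sum_p (pd nu (fun x' => K x' p i mu) x
              - \sum_q K x q i nu * K x p q mu
              + \sum_rho K x p i rho * L x mu rho nu) * y 0 p
  | inl mu, inr i, inr k => K x k i mu
  | inr j, inr i, inl nu => K x j i nu
  | _, _, _ => 0
  end.

Definition chi (D : 'rV[R]_m * 'rV[R]_n ->
    'I_m + 'I_n -> 'I_m + 'I_n -> 'I_m + 'I_n -> R) : jcomp R m n :=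
  fun w A i l =>
  let z := w.1 in let v := w.2 in
  \sum_j D z A (inr i) (inr j) * v l j + D z A (inr i) (inl l)
  - \sum_mu v mu i * (\sum_j D z A (inl mu) (inr j) * v l j
                      + D z A (inl mu) (inl l)).

Definition S_tensor (a1 a2 a3 : R) (x : 'rV[R]_m) (mu la nu : 'I_m) : R :=
  a1 * tor x mu la nu + a2 * (delta la mu * htor x nu)
  + a3 * (htor x mu * delta la nu).

Definition G_tensor (b1 b2 b3 c1 c2 c3 d1 d2 e1 : R) (x : 'rV[R]_m)
    (mu nu : 'I_m) : R :=
  b1 * (\sum_rho \sum_sg tor x rho rho mu * tor x sg sg nu)
  + b2 * (\sum_rho \sum_sg tor x sg rho mu * tor x rho sg nu)
  + b3 * (\sum_rho \sum_sg tor x rho rho sg * tor x mu sg nu)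
  + c1 * (\sum_rho nabla_tor x rho rho mu nu)
  + c2 * (\sum_rho nabla_tor x rho rho nu mu)
  + c3 * (\sum_rho nabla_tor x mu rho nu rho)
  + d1 * (\sum_rho curv symc x rho rho mu nu)
  + d2 * (\sum_rho curv symc x mu rho rho nu)
  + e1 * (\sum_p curv K x p p mu nu).

(* Maps J^1E -> T^*E (x) VE (x) T^*M, in the same component convention as
   connections on J^1E. *)

Definition theta_hK (S : 'rV[R]_m -> 'I_m -> 'I_m -> 'I_m -> R) : jcomp R m n :=
  fun w A i mu =>
  match A with
  | inl la => \sum_rho S w.1.1 la rho mu *
                (\sum_j K w.1.1 j i rho * w.1.2 0 j - w.2 rho i)
  | inr _ => 0
  end.

Definition liouville_tensor (G : 'rV[R]_m -> 'I_m -> 'I_m -> R) : jcomp R m n :=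
  fun w A i mu =>
  match A with
  | inl la => w.1.2 0 i * G w.1.1 la mu
  | inr _ => 0
  end.

Definition curv_liouville : jcomp R m n :=
  fun w A i mu =>
  match A with
  | inl la => \sum_j curv K w.1.1 j i la mu * w.1.2 0 j
  | inr _ => 0
  end.

Definition nuK_htor : jcomp R m n :=
  fun w A i mu =>
  match A with
  | inl la => - (htor w.1.1 mu * \sum_j K w.1.1 j i la * w.1.2 0 j)
  | inr j => htor w.1.1 mu * delta i j
  end.

End Components.

(* Main.v *)
Require Import Defs.
From mathcomp Require Import all_boot all_order all_algebra.
From mathcomp Require Import all_classical all_reals all_analysis.
From HB Require Import structures.
From mathcomp Require Import all_fingroup ring lra.
Set Implicit Arguments.
Unset Strict Implicit.
Unset Printing Implicit Defensive.
Import Order.TTheory GRing.Theory Num.Theory.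
Import numFieldNormedType.Exports.
Local Open Scope classical_set_scope.
Local Open Scope ring_scope.

(** Invariance under local isomorphisms determines the rule from its values on
the trivial bundle at the origin, and there it is so symmetric that only finitely
many parameters remain.

Let E be any bundle, a a chart of it and x a point of the image of a.  A smooth
embedding f of the whole coordinate space into the image of a with f 0 = x,
together with a frame A, is a local isomorphism from the trivial bundle, so the
value of the rule on (L, K) at x is expressed by its value at 0 on the pulled back
pair ([transport]).  The 3-jet of f and the 2-jet of A at 0 can be prescribed
([normal_chart]).  They are chosen so that the pulled back K vanishes at 0 with
derivative minus half its curvature, while the pulled back L has at 0 the torsion
as its value and, as its derivative, the covariant derivative of the torsion minus
a third of a symmetrized curvature ([normal_form]).  This is the usual passage to
normal coordinates, stopped at first order; higher jets are excluded by homogeneity.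

Indeed the rule commutes with the homotheties of the base and of the fibre.  The
component of order j of the jet of a connection scales with weight j + 1, so the
value of the rule at the origin of the trivial bundle, a smooth function of finitely
many such variables, is a polynomial of weighted degree at most two: it is linear in
(y, v) and involves the values of the connections at most quadratically and their
first derivatives linearly ([hor_polynomial], [ver_polynomial]).  With the chart
that osculates the identity this already gives the order one ([order_one]).

The coefficients of these polynomials are tensors invariant under the linear groups
of the base and of the fibre.  By the first fundamental theorem, proved through
a double commutant argument ([first_fundamental_theorem]), each of them is a linear
combination of permutations of indices.  On the values that occur in normal
coordinates every permutation contributes, by the antisymmetry of the torsion and of
the curvature and by the first Bianchi identity, a multiple of one of the
contractions listed in the statement ([origin_value_form]).  Carrying the value at
the origin back along the chart adds chi (DLK L K), adds fixed multiples of
theta(h(T)) and R[K](L), which are absorbed in the parameters, and completes the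
fibre components to a multiple of nu_K times the trace of T ([classification]). *)

Section Kronecker.
Variable R : pzRingType.

Lemma sum_pick (T : finType) (q : T) (F : T -> R) : \sum_i (i == q)%:R * F i = F q.
Proof. by rewrite (bigD1 q) //= eqxx mul1r big1 ?addr0 // => i /negPf ->; rewrite mul0r. Qed.

Lemma sum_pickl (T : finType) (q : T) (F : T -> R) : \sum_i (q == i)%:R * F i = F q.
Proof. by under eq_bigr do rewrite eq_sym; exact: sum_pick. Qed.

Lemma sum_pickr (T : finType) (q : T) (F : T -> R) : \sum_i F i * (i == q)%:R = F q.
Proof. by rewrite (bigD1 q) //= eqxx mulr1 big1 ?addr0 // => i /negPf ->; rewrite mulr0. Qed.

End Kronecker.

(** * Calculus of smooth functions *)

Section Smooth.
Variable R : realType.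

Lemma differentiable_near (V W : normedModType R) (f g : V -> W) (x : V) :
  (\near x, f x = g x) -> differentiable f x -> differentiable g x.
Proof.
move=> fg /diff_locallyP [cdf dfx].
have fgx : f x = g x := nbhs_singleton fg.
have gE : g \o shift x = cst (g x) + 'd f x +o_ 0 id.
  apply/eqaddoP => e e0; move/eqaddoP: dfx => /(_ e e0) H.
  have fg0 : \forall h \near 0, f (h + x) = g (h + x).
    by move: fg; rewrite (near_shift 0 x) subr0.
  near=> h.
  have -> : (g \o shift x - (cst (g x) + 'd f x)) h = (f \o shift x - (cst (f x) + 'd f x)) h.
    by rewrite /= !fctE /= fgx; congr (_ - _); symmetry; near: h.
  by near: h.
by apply/diff_locallyP; rewrite (diff_unique cdf gE).
Unshelve. all: by end_near. Qed.

(** Finite order version of [smooth_on], on which closure properties are proved by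
induction: the Leibniz rule involves the function itself besides its derivatives,
so it cannot be iterated on the list of directions in [smooth_on]. *)
Fixpoint Ck (V W : normedModType R) (D : set V) (k : nat) (f : V -> W) : Prop :=
  (forall x, D x -> differentiable f x) /\
  (if k is k'.+1 then forall v, Ck D k' ('D_v f) else True).

Section Ck.
Variables (V : normedModType R) (D : set V).
Hypothesis oD : open D.

Lemma smooth_onP (W : normedModType R) (f : V -> W) :
  smooth_on D f <-> forall k, Ck D k f.
Proof.
split=> [sf k|cf vs].
  elim: k f sf => [|k IH] f sf; split=> //; try exact: (sf [::]).
  by move=> v; apply: IH => vs; have := sf (rcons vs v); rewrite foldr_rcons.
have {cf} := cf (size vs).
elim/last_ind: vs f => [|vs v IH] f /=; first by case.
by rewrite size_rcons foldr_rcons => -[_ /(_ v)]; apply: IH.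
Qed.

Lemma Ck_diff (W : normedModType R) k (f : V -> W) x : Ck D k f -> D x -> differentiable f x.
Proof. by case: k => [|k] [H _] /H. Qed.

Lemma CkW (W : normedModType R) k (f : V -> W) : Ck D k.+1 f -> Ck D k f.
Proof.
elim: k f => [|k IH] f [df dkf]; split=> // v; exact/IH/dkf.
Qed.

Lemma Ck_eq (W : normedModType R) k (f g : V -> W) :
  (forall x, D x -> f x = g x) -> Ck D k f -> Ck D k g.
Proof.
elim: k f g => [|k IH] f g fg [df dkf];
  have nfg x : D x -> \near x, f x = g x
    by move=> Dx; apply: filterS (open_nbhs_nbhs (conj oD Dx)) => y /fg.
  by split=> // x Dx; exact: differentiable_near (nfg x Dx) (df _ Dx).
split=> [x Dx|v]; first exact: differentiable_near (nfg x Dx) (df _ Dx).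
apply: IH (dkf v) => x Dx.
by apply: near_eq_derive; exact: nfg.
Qed.

Implicit Types f g : V -> R^o.

Lemma Ck_cst (W : normedModType R) k (c : W) : Ck D k (fun _ => c).
Proof.
elim: k c => [|k IH] c; split=> // v.
by apply: Ck_eq (IH 0) => x Dx; rewrite (derive_cst c).
Qed.

Lemma CkD k f g : Ck D k f -> Ck D k g -> Ck D k (fun x => f x + g x).
Proof.
elim: k f g => [|k IH] f g [df dkf] [dg dkg].
  by split=> // x Dx; apply: differentiableD; auto.
split=> [x Dx|v]; first by apply: differentiableD; auto.
apply: Ck_eq (IH _ _ (dkf v) (dkg v)) => x Dx.
by rewrite -deriveD //; apply: diff_derivable; auto.
Qed.

Lemma CkM k f g : Ck D k f -> Ck D k g -> Ck D k (fun x => f x * g x).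
Proof.
elim: k f g => [|k IH] f g Cf Cg; have [df dkf] := Cf; have [dg dkg] := Cg.
  by split=> // x Dx; apply: differentiableM; auto.
split=> [x Dx|v]; first by apply: differentiableM; auto.
apply: Ck_eq (CkD (IH _ _ (CkW Cf) (dkg v)) (IH _ _ (CkW Cg) (dkf v))) => x Dx.
by rewrite [RHS]deriveM //; apply: diff_derivable; auto.
Qed.

Lemma Ck_inv k f : (forall x, D x -> f x != 0) -> Ck D k f ->
  Ck D k (fun x => (f x)^-1).
Proof.
move=> f0; elim: k => [|k IH] Cf; have [df dkf] := Cf.
  by split=> // x Dx; apply: differentiableV; auto.
split=> [x Dx|v]; first by apply: differentiableV; auto.
have Ci := IH (CkW Cf).
apply: Ck_eq (CkM (CkM (Ck_cst k (-1 : R^o)) (CkM Ci Ci)) (dkf v)) => x Dx.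
rewrite [RHS]deriveV ?f0 //; last by apply: diff_derivable; auto.
by rewrite expr2 invfM mulN1r.
Qed.

Lemma Ck_lin (W : normedModType R) k (l : {linear V -> W}) : continuous l -> Ck D k l.
Proof.
move=> cl; have dl x : differentiable l x := linear_differentiable _ cl.
case: k => [|k]; split=> // v.
apply: Ck_eq (Ck_cst k (l v)) => x Dx.
by rewrite deriveE // diff_lin.
Qed.


Lemma Ck_sum (T : Type) (r : seq T) (P : pred T) k (F : T -> V -> R^o) :
  (forall t, Ck D k (F t)) -> Ck D k (fun x => \sum_(t <- r | P t) F t x).
Proof.
move=> CF; elim: r => [|t r IH].
  by apply: Ck_eq (Ck_cst k (0 : R^o)) => x _; rewrite big_nil.
case Pt: (P t); last by apply: Ck_eq IH => x _; rewrite big_cons Pt.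
by apply: Ck_eq (CkD (CF t) IH) => x _; rewrite big_cons Pt.
Qed.

Lemma Ck_prod (T : Type) (r : seq T) (P : pred T) k (F : T -> V -> R^o) :
  (forall t, Ck D k (F t)) -> Ck D k (fun x => \prod_(t <- r | P t) F t x).
Proof.
move=> CF; elim: r => [|t r IH].
  by apply: Ck_eq (Ck_cst k (1 : R^o)) => x _; rewrite big_nil.
case Pt: (P t); last by apply: Ck_eq IH => x _; rewrite big_cons Pt.
by apply: Ck_eq (CkM (CF t) IH) => x _; rewrite big_cons Pt.
Qed.

End Ck.

(** Maps into W of this shape stand for maps with finitely many coordinate functions;
the chain rule is only needed for them. *)
Lemma differentiable_lincomb (V W : normedModType R) (T : finType) (e0 : W) (e : T -> W)
    (g : T -> V -> R^o) x :
  (forall t, differentiable (g t) x) ->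
  differentiable (fun x => e0 + \sum_t g t x *: e t) x.
Proof.
move=> dg; apply: differentiableD => //; elim: (index_enum T) => [|t r IH].
  apply: differentiable_near (differentiable_cst (0 : W) x).
  by apply: nearW => y; rewrite big_nil.
have dz : differentiable (fun x => g t x *: e t) x by apply: differentiableZl.
apply: differentiable_near (differentiableD dz IH).
by apply: nearW => y; rewrite big_cons.
Qed.

Lemma derive_lincomb (V W : normedModType R) (T : finType) (e0 : W) (e : T -> W)
    (g : T -> V -> R^o) x v :
  (forall t, differentiable (g t) x) ->
  'D_v (fun x => e0 + \sum_t g t x *: e t) x = \sum_t 'D_v (g t) x *: e t.
Proof.
move=> dg.
have dr r : differentiable (fun x => \sum_(t <- r) g t x *: e t) x /\
   'D_v (fun x => \sum_(t <- r) g t x *: e t) x = \sum_(t <- r) 'D_v (g t) x *: e t.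
  elim: r => [|t r [IHd IHe]].
    rewrite big_nil (_ : (fun _ => _) = cst 0); first by rewrite derive_cst.
    by apply/funext => y; rewrite big_nil.
  have dz : differentiable (fun x => g t x *: e t) x by apply: differentiableZl.
  rewrite (_ : (fun _ => _) = (fun x => g t x *: e t) + (fun x => \sum_(t <- r) g t x *: e t)).
    split; first exact: differentiableD.
    rewrite deriveD ?big_cons; try exact: diff_derivable.
    by rewrite IHe; congr (_ + _); rewrite deriveE // diffZl // deriveE.
  by apply/funext => y; rewrite big_cons.
have [d1 d2] := dr (index_enum T).
transitivity ('D_v (cst e0) x + 'D_v (fun x => \sum_t g t x *: e t) x).
  by rewrite -deriveD //; apply: diff_derivable.
by rewrite derive_cst add0r.
Qed.

Lemma derive_comp_lincomb (V W : normedModType R) (T : finType) (e0 : W) (e : T -> W)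
    (g : T -> V -> R^o) (f : W -> R^o) x v :
  (forall t, differentiable (g t) x) ->
  differentiable f (e0 + \sum_t g t x *: e t) ->
  'D_v (fun x => f (e0 + \sum_t g t x *: e t)) x
    = \sum_t 'D_v (g t) x * 'D_(e t) f (e0 + \sum_t g t x *: e t).
Proof.
move=> dg df; have dG := differentiable_lincomb e0 e dg.
rewrite deriveE; last exact: (differentiable_comp dG df).
rewrite (diff_comp dG df) /= -[X in 'd f _ X]deriveE // derive_lincomb //.
rewrite linear_sum; apply: eq_bigr => t _.
by rewrite linearZ /= (deriveE _ df).
Qed.

(** The derivative of the composite is a finite sum of products of derivatives of the
factors, so the order of differentiability goes up by induction on k. *)
Lemma Ck_comp (V W : normedModType R) (D : set V) (D' : set W) (T : finType) (e0 : W) (e : T -> W)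
    (g : T -> V -> R^o) k (f : W -> R^o) :
  open D -> open D' ->
  (forall x, D x -> D' (e0 + \sum_t g t x *: e t)) ->
  (forall t, Ck D k (g t)) -> Ck D' k f ->
  Ck D k (fun x => f (e0 + \sum_t g t x *: e t)).
Proof.
move=> oD oD' DD'; elim: k f => [|k IH] f Cg Cf;
  have dfg x : D x -> differentiable (fun x => f (e0 + \sum_t g t x *: e t)) x
    by (move=> Dx; have dG : differentiable (fun x => e0 + \sum_t g t x *: e t) x;
      [by apply: differentiable_lincomb => t; exact: Ck_diff (Cg t) Dx
      |exact: differentiable_comp dG (Ck_diff Cf (DD' _ Dx))]).
  by [].
split=> // v.
have H t : Ck D k (fun x => 'D_v (g t) x * 'D_(e t) f (e0 + \sum_t g t x *: e t)).
  apply: CkM => //; first exact: (Cg t).2.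
  by apply: (IH ('D_(e t) f)) => [t'|]; [exact: CkW (Cg t')|exact: Cf.2].
apply: Ck_eq (Ck_sum oD (index_enum T) predT H) => // x Dx.
rewrite derive_comp_lincomb // => [t|]; first exact: Ck_diff (Cg t) Dx.
by apply: Ck_diff Cf _; exact: DD'.
Qed.

Section SmoothOn.
Variables (V : normedModType R) (D : set V).
Hypothesis oD : open D.
Implicit Types f g : V -> R^o.

Lemma smooth_differentiable (W : normedModType R) (f : V -> W) x :
  smooth_on D f -> D x -> differentiable f x.
Proof. by move=> sf; exact: (sf [::]). Qed.

Lemma smooth_derive (W : normedModType R) (f : V -> W) v : smooth_on D f -> smooth_on D ('D_v f).
Proof. by move=> sf vs x Dx; have := sf (rcons vs v) x Dx; rewrite foldr_rcons. Qed.

Lemma smooth_eq (W : normedModType R) (f g : V -> W) :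
  (forall x, D x -> f x = g x) -> smooth_on D f -> smooth_on D g.
Proof. by move=> fg /smooth_onP sf; apply/smooth_onP => k; exact: Ck_eq fg (sf k). Qed.

Lemma smooth_cst (W : normedModType R) (c : W) : smooth_on D (fun _ => c).
Proof. by apply/smooth_onP => k; exact: Ck_cst. Qed.

Lemma smoothD f g : smooth_on D f -> smooth_on D g -> smooth_on D (fun x => f x + g x : R^o).
Proof. by move=> /smooth_onP sf /smooth_onP sg; apply/smooth_onP => k; exact: CkD. Qed.

Lemma smoothM f g : smooth_on D f -> smooth_on D g -> smooth_on D (fun x => f x * g x : R^o).
Proof. by move=> /smooth_onP sf /smooth_onP sg; apply/smooth_onP => k; exact: CkM. Qed.

Lemma smoothN f : smooth_on D f -> smooth_on D (fun x => - f x : R^o).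
Proof.
move=> sf; apply: smooth_eq (smoothM (@smooth_cst R^o (-1)) sf) => x _.
exact: mulN1r.
Qed.

Lemma smoothB f g : smooth_on D f -> smooth_on D g -> smooth_on D (fun x => f x - g x : R^o).
Proof. by move=> sf sg; apply: smoothD sf (smoothN sg). Qed.

Lemma smoothV f : (forall x, D x -> f x != 0) -> smooth_on D f ->
  smooth_on D (fun x => (f x)^-1 : R^o).
Proof. by move=> f0 /smooth_onP sf; apply/smooth_onP => k; exact: Ck_inv. Qed.

Lemma smooth_lin (W : normedModType R) (l : {linear V -> W}) : continuous l -> smooth_on D l.
Proof. by move=> cl; apply/smooth_onP => k; exact: Ck_lin. Qed.

Lemma smooth_sum (T : Type) (r : seq T) (P : pred T) (F : T -> V -> R^o) :
  (forall t, smooth_on D (F t)) -> smooth_on D (fun x => \sum_(t <- r | P t) F t x : R^o).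
Proof. by move=> sF; apply/smooth_onP => k; apply: Ck_sum => // t; move/smooth_onP: (sF t); apply. Qed.

Lemma smooth_prod (T : Type) (r : seq T) (P : pred T) (F : T -> V -> R^o) :
  (forall t, smooth_on D (F t)) -> smooth_on D (fun x => \prod_(t <- r | P t) F t x : R^o).
Proof. by move=> sF; apply/smooth_onP => k; apply: Ck_prod => // t; move/smooth_onP: (sF t); apply. Qed.

Lemma smooth_comp_lincomb (W : normedModType R) (D' : set W) (T : finType) (e0 : W) (e : T -> W)
    (g : T -> V -> R^o) (f : W -> R^o) :
  open D' -> (forall x, D x -> D' (e0 + \sum_t g t x *: e t)) ->
  (forall t, smooth_on D (g t)) -> smooth_on D' f ->
  smooth_on D (fun x => f (e0 + \sum_t g t x *: e t)).
Proof.
move=> oD' DD' sg sf; apply/smooth_onP => k.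
by apply: (Ck_comp oD oD') => // [t|]; [move/smooth_onP: (sg t)|move/smooth_onP: sf]; apply.
Qed.

Lemma mx_lincomb p q (M : 'M[R]_(p, q)) :
  M = 0 + \sum_(t : 'I_p * 'I_q) (M t.1 t.2 *: delta_mx t.1 t.2).
Proof.
rewrite add0r {1}[M]matrix_sum_delta pair_big.
by apply: eq_bigr => -[i j].
Qed.

Lemma smooth_entry p q (M : V -> 'M[R]_(p, q)) i j :
  smooth_on D M -> smooth_on D (fun x => M x i j : R^o).
Proof.
move=> /smooth_onP sM; apply/smooth_onP => k; have {sM} := sM k.
elim: k M => [|k IH] M [dM dkM]; (split=> [x Dx|//]).
- exact: (differentiable_comp (dM _ Dx) (differentiable_coord (M x) i j)).
- exact: (differentiable_comp (dM _ Dx) (differentiable_coord (M x) i j)).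
move=> v; apply: Ck_eq (IH _ (dkM v)) => // x Dx.
by rewrite derive_mx ?mxE //; apply: diff_derivable; exact: dM.
Qed.

Lemma smooth_mx p q (M : V -> 'M[R]_(p, q)) :
  (forall i j, smooth_on D (fun x => M x i j : R^o)) -> smooth_on D M.
Proof.
move=> sM; apply/smooth_onP => k.
have {sM} : forall i j, Ck D k (fun x => M x i j : R^o) by move=> i j; move/smooth_onP: (sM i j); apply.
elim: k M => [|k IH] M CM.
all: have dM x : D x -> differentiable M x
  by move=> Dx; rewrite (_ : M = fun x => 0 + \sum_(t : 'I_p * 'I_q) (M x t.1 t.2 *: delta_mx t.1 t.2));
     [apply: differentiable_lincomb => t; apply: Ck_diff (CM _ _) Dx
     |apply/funext => y; exact: mx_lincomb].
  by [].
split=> // v; apply: IH => i j; have [_ /(_ v)] := CM i j.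
apply: Ck_eq => // x Dx.
by rewrite derive_mx ?mxE //; apply: diff_derivable; exact: dM.
Qed.

Lemma smooth_comp p (D' : set 'rV[R]_p) (g : V -> 'rV[R]_p) (f : 'rV[R]_p -> R^o) :
  open D' -> (forall x, D x -> D' (g x)) -> smooth_on D g -> smooth_on D' f ->
  smooth_on D (fun x => f (g x)).
Proof.
move=> oD' DD' sg sf.
pose e (t : 'I_1 * 'I_p) : 'rV[R]_p := delta_mx t.1 t.2.
pose gt (t : 'I_1 * 'I_p) x : R^o := g x t.1 t.2.
have gE x : g x = 0 + \sum_t gt t x *: e t by exact: mx_lincomb.
have := @smooth_comp_lincomb _ D' _ 0 e gt f oD'.
under eq_fun do rewrite -gE.
apply=> // [x|t]; first by rewrite -gE; exact: DD'.
exact: smooth_entry.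
Qed.

End SmoothOn.
End Smooth.

(** * The trivial bundle over a coordinate space *)

Section Flat.
Variables (R : realType) (m n : nat).

(** The balls with rational centre and rational radius form a countable basis. *)
Lemma rV_second_countable : @second_countable 'rV[R]_m.
Proof.
pose b (q : 'rV[rat]_m * rat) : set 'rV[R]_m := ball (map_mx ratr q.1 : 'rV[R]_m) (ratr q.2 : R).
exists (b @` [set q | 0 < q.2]).
  apply: card_le_trans (card_image_le _ _) _; exact: countableP.
split=> [_ [q q0 <-]|x].
  by apply: ball_open; rewrite ltr0q.
move=> U /nbhs_ballP [e /= e0 xeU].
have he : 0 < e / 4 by rewrite divr_gt0.
have /cid2 [d] : exists2 d : rat, 0 < d & (ratr d : R) < e / 4.
  by have [d] := rat_in_itvoo he; rewrite in_itv /= => /andP[d0 d1]; exists d => //; rewrite -(@ltr0q R).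
move=> d0 de.
have Hq j : exists q : rat, `|x 0 j - ratr q| < ratr d.
  have : x 0 j - ratr d < x 0 j + ratr d by have : 0 < ratr d :> R; [rewrite ltr0q|lra].
  move=> /rat_in_itvoo [q]; rewrite in_itv /= => /andP[q1 q2]; exists q.
  by rewrite ltr_distl; apply/andP; split; lra.
have [q qP] := choice Hq.
have d0' : 0 < ratr d :> R by rewrite ltr0q.
exists (b (\row_j q j, d)).
  split; first by exists (\row_j q j, d).
  split=> //= i j; rewrite !mxE ord1 -ball_normE /= distrC; exact: qP.
move=> y [_ /= yP]; apply: xeU; split=> // i j; rewrite ord1.
have := yP 0 j; rewrite !mxE -!ball_normE /= => yj.
rewrite -(subrKA (ratr (q j))); apply: le_lt_trans (ler_normD _ _) _.
by have := qP j; lra.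
Qed.

Definition flat_chart : chart (R:=R) m n (M := 'rV[R]_m) (fun _ => 'rV[R]_n) :=
  Chart setT id id (fun _ y => y) (fun _ y => y).

Lemma flat_img : cimg flat_chart = setT.
Proof. by rewrite /cimg image_id. Qed.

Lemma flat_is_chart : is_chart flat_chart.
Proof.
split=> //; first exact: openT.
- by rewrite flat_img; exact: openT.
- by split=> x _; exact: cvg_id.
Qed.

Lemma flat_smooth (a b : unit) :
  smooth_rep setT (f := id) (fun p (e : 'rV[R]_n) => e) flat_chart flat_chart.
Proof.
have oT : open [set: 'rV[R]_m] := openT.
have ovT : overlap setT id flat_chart flat_chart = setT.
  by rewrite /overlap /= !setTI preimage_id image_id.
rewrite /smooth_rep ovT; split; first by apply: (smooth_lin oT (l := idfun)) => x; exact: cvg_id.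
exact: (smooth_cst oT (lin1_mx id : 'M[R]_n)).
Qed.

Definition flat : vbundle R m n :=
  @VBundle R m n 'rV[R]_m (fun _ => 'rV[R]_n) unit (fun _ => flat_chart)
    (@norm_hausdorff _ _) rV_second_countable (fun _ => flat_is_chart)
    (fun _ => ex_intro _ tt I) flat_smooth.
End Flat.

(** * Partial derivatives and Jacobian matrices *)

Section Calculus.
Variable R : realType.

Lemma derive_scaler_eq (V : normedModType R) (f g : V -> R^o) x v :
  f =1 g -> 'D_v f x = 'D_v g x.
Proof. by move=> /funext ->. Qed.

Lemma differentiable_ext (V W : normedModType R) (f g : V -> W) x :
  f =1 g -> differentiable f x -> differentiable g x.
Proof. by move=> /funext ->. Qed.

Lemma derive_scalarM (V : normedModType R) (f g : V -> R^o) x v :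
  differentiable f x -> differentiable g x ->
  'D_v (fun x => f x * g x : R^o) x = 'D_v f x * g x + f x * 'D_v g x.
Proof.
move=> df dg; have e : 'D_v (f * g) x = f x *: 'D_v g x + g x *: 'D_v f x.
  by apply: deriveM; apply: diff_derivable.
by rewrite [LHS]e addrC; congr (_ + _); rewrite /GRing.scale /= mulrC.
Qed.

Lemma derive_scalarD (V : normedModType R) (f g : V -> R^o) x v :
  differentiable f x -> differentiable g x ->
  'D_v (fun x => f x + g x : R^o) x = 'D_v f x + 'D_v g x.
Proof. by move=> df dg; apply: deriveD; apply: diff_derivable. Qed.

Lemma differentiable_bigsum (V : normedModType R) (T : Type) (r : seq T) (P : pred T)
    (F : T -> V -> R^o) x :
  (forall t, differentiable (F t) x) -> differentiable (fun x => \sum_(t <- r | P t) F t x : R^o) x.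
Proof.
move=> dF; elim: r => [|t r IH].
  by apply: differentiable_near (differentiable_cst (0 : R^o) x); apply: nearW => y; rewrite big_nil.
case Pt: (P t); last by apply: differentiable_near IH; apply: nearW => y; rewrite big_cons Pt.
by apply: differentiable_near (differentiableD (dF t) IH); apply: nearW => y; rewrite big_cons Pt.
Qed.

Lemma derive_bigsum (V : normedModType R) (T : Type) (r : seq T) (P : pred T)
    (F : T -> V -> R^o) x v :
  (forall t, differentiable (F t) x) ->
  'D_v (fun x => \sum_(t <- r | P t) F t x : R^o) x = \sum_(t <- r | P t) 'D_v (F t) x.
Proof.
move=> dF; elim: r => [|t r IH].
  rewrite big_nil -[RHS](derive_cst (0 : R^o) x v); apply: derive_scaler_eq => y.
  by rewrite big_nil.
rewrite big_cons -IH; case Pt: (P t); last first.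
  by apply: derive_scaler_eq => y; rewrite big_cons Pt.
rewrite -derive_scalarD //; last exact: differentiable_bigsum.
by apply: derive_scaler_eq => y; rewrite big_cons Pt.
Qed.

Lemma differentiable_linear_comp (V W : normedModType R) (l : {linear V -> W}) (g : W -> R^o) x :
  continuous l -> differentiable g (l x) -> differentiable (fun w => g (l w)) x.
Proof. by move=> cl dg; apply: differentiable_comp (linear_differentiable x cl) dg. Qed.

Lemma derive_linear_comp (V W : normedModType R) (l : {linear V -> W}) (g : W -> R^o) x v :
  continuous l -> differentiable g (l x) ->
  'D_v (fun w => g (l w)) x = 'D_(l v) g (l x).
Proof.
move=> cl dg; have dl := linear_differentiable x cl.
rewrite deriveE; last exact: differentiable_linear_comp.
by rewrite (diff_comp dl dg) /= diff_lin // deriveE.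
Qed.

Lemma derive_linear (V : normedModType R) (l : {linear V -> R^o}) x v :
  continuous l -> 'D_v l x = l v.
Proof.
by move=> cl; rewrite deriveE ?diff_lin //; exact: linear_differentiable.
Qed.

Lemma derive_entry p q (V : normedModType R) (M : V -> 'M[R]_(p, q)) x v i j :
  differentiable M x -> 'D_v M x i j = 'D_v (fun y => M y i j : R^o) x.
Proof. by move=> dM; rewrite derive_mx ?mxE //; exact: diff_derivable. Qed.

Lemma differentiable_entry p q (V : normedModType R) (M : V -> 'M[R]_(p, q)) x i j :
  differentiable M x -> differentiable (fun y => M y i j : R^o) x.
Proof. by move=> dM; exact: (differentiable_comp dM (differentiable_coord (M x) i j)). Qed.

Lemma differentiable_mx p q (V : normedModType R) (M : V -> 'M[R]_(p, q)) x :
  (forall i j, differentiable (fun y => M y i j : R^o) x) -> differentiable M x.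
Proof.
move=> dM; rewrite (_ : M = fun x => 0 + \sum_(t : 'I_p * 'I_q) (M x t.1 t.2 *: delta_mx t.1 t.2)).
  exact: differentiable_lincomb.
by apply/funext => y; exact: mx_lincomb.
Qed.

Lemma jacobianE p q (f : 'rV[R]_p -> 'rV[R]_q) (x : 'rV[R]_p) i j :
  differentiable f x -> 'J f x i j = pd i (fun y => f y 0 j : R^o) x.
Proof.
by move=> df; rewrite /jacobian /lin1_mx mxE -deriveE // /pd derive_entry.
Qed.

Lemma derive_sumM (V : normedModType R) (T : finType) (F G : T -> V -> R^o) x v :
  (forall t, differentiable (F t) x) -> (forall t, differentiable (G t) x) ->
  'D_v (fun x => \sum_t F t x * G t x : R^o) x
  = \sum_t ('D_v (F t) x * G t x + F t x * 'D_v (G t) x).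
Proof.
move=> dF dG; rewrite derive_bigsum; last by move=> t; apply: differentiableM.
by apply: eq_bigr => t _; rewrite derive_scalarM.
Qed.

Lemma derive_rv p (f : 'rV[R]_p -> R^o) (x v : 'rV[R]_p) : differentiable f x ->
  'D_v f x = \sum_k v 0 k * pd k f x.
Proof.
move=> df; rewrite deriveE // {1}[v]row_sum_delta linear_sum.
by apply: eq_bigr => k _; rewrite linearZ /= /pd deriveE.
Qed.

Lemma pd_coord p k j x : pd k (fun y : 'rV[R]_p => y 0 j : R^o) x = (k == j)%:R.
Proof.
pose l : 'rV[R]_p -> R^o := fun y => y 0 j.
have ll : linear l by move=> a u v; rewrite /l !mxE.
pose lm := GRing.isLinear.Build _ _ _ _ l ll.
pose ln : {linear 'rV[R]_p -> R^o} := HB.pack l lm.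
rewrite /pd -[LHS]/('D_(delta_mx 0 k) ln x) derive_linear /=; last exact: coord_continuous.
by rewrite /l mxE eqxx eq_sym.
Qed.

Lemma jacobian_comp p q r (f : 'rV[R]_p -> 'rV[R]_q) (g : 'rV[R]_q -> 'rV[R]_r) (x : 'rV[R]_p) :
  differentiable f x -> differentiable g (f x) ->
  'J (fun x => g (f x)) x = 'J f x *m 'J g (f x).
Proof.
move=> df dg; rewrite /jacobian; apply/row_matrixP => i.
rewrite row_mul !rowE !mul_rV_lin1.
by rewrite (diff_comp df dg).
Qed.

Lemma pd_comp p q (f : 'rV[R]_p -> 'rV[R]_q) (g : 'rV[R]_q -> R^o) (x : 'rV[R]_p) k :
  differentiable f x -> differentiable g (f x) ->
  pd k (fun x => g (f x)) x = \sum_j 'J f x k j * pd j g (f x).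
Proof.
move=> df dg; rewrite /pd deriveE; last exact: differentiable_comp df dg.
rewrite (diff_comp df dg) /= -[X in 'd g _ X]deriveE // -deriveE // derive_rv //.
by apply: eq_bigr => j _; rewrite jacobianE // /pd derive_entry.
Qed.

Lemma near_jacobian p q (f g : 'rV[R]_p -> 'rV[R]_q) (x : 'rV[R]_p) :
  (\near x, f x = g x) -> differentiable f x -> 'J f x = 'J g x.
Proof.
move=> fg df; have dg := differentiable_near fg df.
apply/matrixP => i j.
transitivity (pd i (fun y => f y 0 j : R^o) x); first exact: jacobianE.
transitivity (pd i (fun y => g y 0 j : R^o) x); last by rewrite (jacobianE i j dg).
by apply: near_eq_derive; apply: filterS fg => y ->.
Qed.

End Calculus.

(** * Prolongation of fibre-linear maps to jets *)

Section Jmap.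
Variables (R : realType) (m : nat).

(** Derivative of x |-> y A(x) with y fixed, one row per coordinate of the base. *)
Definition dmx n (A : 'rV[R]_m -> 'M[R]_n) (y : 'rV[R]_n) (x : 'rV[R]_m) : 'M[R]_(m, n) :=
  \matrix_(l, i) \sum_p y 0 p * pd l (fun x' => A x' p i) x.

Lemma dmx_linear n (A : 'rV[R]_m -> 'M[R]_n) y x :
  dmx A y x = \sum_p y 0 p *: dmx A (delta_mx 0 p) x.
Proof.
apply/matrixP => l i; rewrite mxE summxE; apply: eq_bigr => p _.
rewrite !mxE; congr (_ * _); rewrite (bigD1 p) //= mxE !eqxx mul1r big1 ?addr0 // => q qp.
by rewrite mxE eqxx (negPf qp) mul0r.
Qed.

(** The representative x |-> y + (x - x0) v of the jet is affine, so the derivative of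
its image at x0 follows from the Leibniz rule. *)
Lemma jmapE n (f : 'rV[R]_m -> 'rV[R]_m) (A : 'rV[R]_m -> 'M[R]_n) (x : 'rV[R]_m) (y : 'rV[R]_n) (v : 'M[R]_(m, n)) :
  differentiable A x ->
  jmap f A (x, y, v) = (f x, y *m A x, invmx ('J f x) *m (v *m A x + dmx A y x)).
Proof.
move=> dA; rewrite /jmap /bmap /=; congr (_, _ *m _).
have dAe p i : differentiable (fun x' => A x' p i : R^o) x by exact: differentiable_entry.
have dl p : differentiable (fun x' : 'rV[R]_m => (y + (x' - x) *m v) 0 p : R^o) x.
  apply: (differentiable_ext (f := fun x' : 'rV[R]_m => y 0 p + \sum_k (x' 0 k - x 0 k) * v k p : R^o)).
    by move=> x'; rewrite !mxE; congr (_ + _); apply: eq_bigr => k _; rewrite !mxE.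
  apply: differentiableD => //; apply: differentiable_bigsum => k.
  by apply: differentiableM => //; apply: differentiableB => //; exact: differentiable_coord.
have dlE p l : pd l (fun x' : 'rV[R]_m => (y + (x' - x) *m v) 0 p : R^o) x = v l p.
  rewrite /pd (derive_scaler_eq (g := fun x' : 'rV[R]_m => y 0 p + \sum_k (x' 0 k - x 0 k) * v k p)); last first.
    by move=> x'; rewrite !mxE; congr (_ + _); apply: eq_bigr => k _; rewrite !mxE.
  have dk k : differentiable (fun x' : 'rV[R]_m => x' 0 k - x 0 k : R^o) x.
    by apply: differentiableB => //; exact: differentiable_coord.
  rewrite derive_scalarD //; last by apply: differentiable_bigsum => k; apply: differentiableM.
  rewrite derive_cst add0r derive_sumM // (bigD1 l) //= big1 => [|k kl].
    rewrite derive_cst mulr0 !addr0 derive_scalarD //; last exact: differentiable_coord.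
    by rewrite derive_cst addr0 [X in X * _](pd_coord l l x) eqxx mul1r.
  rewrite derive_cst mulr0 addr0 derive_scalarD //; last exact: differentiable_coord.
  by rewrite derive_cst addr0 [X in X * _](pd_coord l k x) eq_sym (negPf kl) mul0r.
have dM : differentiable (fun x' => (y + (x' - x) *m v) *m A x') x.
  apply: differentiable_mx => i j.
  apply: (differentiable_ext (f := fun x' => \sum_p (y + (x' - x) *m v) 0 p * A x' p j : R^o)).
    by move=> x'; rewrite ord1 [RHS]mxE.
  by apply: differentiable_bigsum => p; apply: differentiableM.
apply/matrixP => l i; rewrite jacobianE // /pd.
rewrite (derive_scaler_eq (g := fun x' => \sum_p (y + (x' - x) *m v) 0 p * A x' p i)); last first.
  by move=> x'; rewrite [LHS]mxE.
rewrite derive_sumM // big_split /=; rewrite !mxE; congr (_ + _); apply: eq_bigr => p _.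
  by rewrite [X in X * _](dlE p l).
by rewrite subrr mul0mx addr0.
Qed.

Lemma differentiable_mulmx n (A B : 'rV[R]_m -> 'M[R]_n) (x : 'rV[R]_m) :
  differentiable A x -> differentiable B x -> differentiable (fun x => A x *m B x) x.
Proof.
move=> dA dB; apply: differentiable_mx => i j.
apply: (differentiable_ext (f := fun x => \sum_p A x i p * B x p j : R^o)).
  by move=> x'; rewrite mxE.
apply: differentiable_bigsum => p.
by apply: differentiableM; exact: differentiable_entry.
Qed.

Lemma differentiable_mxcomp n (f : 'rV[R]_m -> 'rV[R]_m) (B : 'rV[R]_m -> 'M[R]_n) (x : 'rV[R]_m) :
  differentiable f x -> differentiable B (f x) -> differentiable (fun x => B (f x)) x.
Proof. by move=> df dB; exact: differentiable_comp df dB. Qed.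

Lemma dmx_comp n (f : 'rV[R]_m -> 'rV[R]_m) (A B : 'rV[R]_m -> 'M[R]_n) (x : 'rV[R]_m) (y : 'rV[R]_n) :
  differentiable f x -> differentiable A x -> differentiable B (f x) ->
  dmx (fun x => A x *m B (f x)) y x
  = dmx A y x *m B (f x) + 'J f x *m dmx B (y *m A x) (f x).
Proof.
move=> df dA dB; have dBf := differentiable_mxcomp df dB.
apply/matrixP => l i; rewrite !mxE.
have -> : \sum_p y 0 p * pd l (fun x' => (A x' *m B (f x')) p i) x =
  \sum_p y 0 p * (\sum_q pd l (fun x' => A x' p q) x * B (f x) q i +
                  \sum_q A x p q * pd l (fun x' => B (f x') q i) x).
  apply: eq_bigr => p _; congr (_ * _); rewrite -big_split /= /pd -derive_sumM //; last 2 first.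
  - by move=> q; exact: differentiable_entry.
  - by move=> q; apply: (differentiable_entry (M := fun x => B (f x))).
  by apply: derive_scaler_eq => x'; rewrite mxE.
under eq_bigr do rewrite mulrDr.
rewrite big_split /=; congr (_ + _).
  under eq_bigr do rewrite mulr_sumr.
  rewrite exchange_big; apply: eq_bigr => q _; rewrite mxE mulr_suml.
  by apply: eq_bigr => p _; rewrite mulrA.
have dBe q : differentiable (fun x' => B x' q i : R^o) (f x) by exact: differentiable_entry.
have pdB q : pd l (fun x' => B (f x') q i) x = \sum_k 'J f x l k * pd k (fun z => B z q i) (f x).
  exact: (pd_comp l df (dBe q)).
under eq_bigr do (rewrite mulr_sumr; under eq_bigr do rewrite pdB mulr_sumr mulr_sumr).
under [RHS]eq_bigr do (rewrite [dmx _ _ _ _ _]mxE mulr_sumr; under eq_bigr do rewrite [(y *m _) _ _]mxE mulr_suml mulr_sumr).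
rewrite exchange_big /=.
under eq_bigr do rewrite exchange_big.
rewrite exchange_big; apply: eq_bigr => k _; apply: eq_bigr => q _; apply: eq_bigr => p _.
by ring.
Qed.

Lemma invmxM n (A B : 'M[R]_n) : A \in unitmx -> B \in unitmx ->
  invmx (A *m B) = invmx B *m invmx A.
Proof.
move=> uA uB; have uAB : A *m B \in unitmx by rewrite unitmx_mul uA.
by apply: (can_inj (mulKmx uAB)); rewrite mulmxV // mulmxA mulmxK // mulmxV.
Qed.

Lemma jmap_comp_alg n (J G : 'M[R]_m) (A B : 'M[R]_n) (v D1 D2 : 'M[R]_(m, n)) :
  J \in unitmx -> G \in unitmx ->
  invmx G *m (invmx J *m (v *m A + D1) *m B + D2)
  = invmx (J *m G) *m (v *m (A *m B) + (D1 *m B + J *m D2)).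
Proof.
move=> uJ uG; rewrite invmxM // -!mulmxA; congr (_ *m _).
by rewrite addrA !mulmxDr (mulKmx uJ) mulmxDl mulmxDr -!mulmxA.
Qed.

(** Functoriality of the jet prolongation; it makes relatedness of connections
transitive, as needed to pass between the charts of a bundle. *)
Lemma jmap_comp n (f g : 'rV[R]_m -> 'rV[R]_m) (A B : 'rV[R]_m -> 'M[R]_n) (w : jco R m n) :
  differentiable f w.1.1 -> differentiable g (f w.1.1) ->
  differentiable A w.1.1 -> differentiable B (f w.1.1) ->
  'J f w.1.1 \in unitmx -> 'J g (f w.1.1) \in unitmx ->
  jmap g B (jmap f A w) = jmap (fun x => g (f x)) (fun x => A x *m B (f x)) w.
Proof.
case: w => [[x y] v] /= df dg dA dB uf ug.
have dAB := differentiable_mulmx dA (differentiable_mxcomp df dB).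
apply: etrans (f_equal (jmap g B) (jmapE f y v dA)) _.
apply: etrans (jmapE g (y *m A x) _ dB) _.
apply: etrans (esym (jmapE (fun x => g (f x)) y v dAB)).
congr ((_, _), _); first exact: esym (mulmxA _ _ _).
apply: etrans (jmap_comp_alg _ _ _ _ _ uf ug) _.
by congr (invmx _ *m (_ + _)); [exact/esym/jacobian_comp|exact/esym/dmx_comp].
Qed.

Lemma jmap_near n (f g : 'rV[R]_m -> 'rV[R]_m) (A B : 'rV[R]_m -> 'M[R]_n) (w : jco R m n) :
  (\forall x \near w.1.1, f x = g x) -> (\forall x \near w.1.1, A x = B x) ->
  differentiable f w.1.1 -> differentiable A w.1.1 ->
  jmap f A w = jmap g B w.
Proof.
case: w => [[x y] v] /= fg AB df dA.
apply: etrans (jmapE f y v dA) _.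
apply: etrans (esym (jmapE g y v (differentiable_near AB dA))).
rewrite (nbhs_singleton fg) (nbhs_singleton AB) -(near_jacobian fg df).
congr (_, _ *m (_ + _)); apply/matrixP => l i; rewrite !mxE; apply: eq_bigr => p _.
by congr (_ * _); apply: near_eq_derive; apply: filterS AB => z ->.
Qed.

End Jmap.

(** * Pullback of linear connections *)

Section Pullback.
Variables (R : realType) (m k : nat).
Implicit Types (f : 'rV[R]_m -> 'rV[R]_m) (A : 'rV[R]_m -> 'M[R]_k) (K : lcomp R m k).

Lemma lsection_linear K z y :
  (lsection K (z, y)).2 = \sum_j y 0 j *: (lsection K (z, delta_mx 0 j)).2.
Proof.
apply/matrixP => l i; rewrite /lsection /= !mxE summxE; apply: eq_bigr => j _.
rewrite !mxE mulrC; congr (_ * _).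
rewrite (bigD1 j) //= mxE !eqxx mulr1 big1 ?addr0 // => q qj.
by rewrite mxE eqxx (negPf qj) mulr0.
Qed.

(** The transformation law of a linear connection solved for the connection on the
source side, which is possible because f is a local diffeomorphism. *)
Definition pullback f A K : lcomp R m k := fun z j i l =>
  (('J f z *m (lsection K (f z, delta_mx 0 j *m A z)).2 - dmx A (delta_mx 0 j) z)
   *m invmx (A z)) l i.

Lemma pullback_section f A K z y :
  (lsection (pullback f A K) (z, y)).2
  = ('J f z *m (lsection K (f z, y *m A z)).2 - dmx A y z) *m invmx (A z).
Proof.
have sumE : (lsection K (f z, y *m A z)).2 =
    \sum_j y 0 j *: (lsection K (f z, delta_mx 0 j *m A z)).2.
  rewrite lsection_linear.
  under [RHS]eq_bigr do rewrite lsection_linear scaler_sumr.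
  rewrite exchange_big /=; apply: eq_bigr => q _.
  rewrite mxE scaler_suml; apply: eq_bigr => j _.
  by rewrite scalerA -rowE mxE.
rewrite sumE dmx_linear mulmx_sumr -sumrB mulmx_suml.
apply/matrixP => l i; rewrite !mxE summxE; apply: eq_bigr => j _.
by rewrite /pullback -scalemxAr -scalerBr -scalemxAl mulrC [RHS]mxE.
Qed.

Lemma lrelated_pullback f A K z : differentiable A z ->
  'J f z \in unitmx -> A z \in unitmx -> lrelated f A (pullback f A K) K z.
Proof.
move=> dA uf uA y.
apply: etrans (jmapE f y _ dA) _.
rewrite [\matrix_(l, i) _](pullback_section f A K z y).
by rewrite mulmxKV // subrK mulKmx.
Qed.

Lemma lrelated_comp f g A B K K' K'' z :
  differentiable f z -> differentiable g (f z) ->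
  differentiable A z -> differentiable B (f z) ->
  'J f z \in unitmx -> 'J g (f z) \in unitmx ->
  lrelated f A K K' z -> lrelated g B K' K'' (f z) ->
  lrelated (fun x => g (f x)) (fun x => A x *m B (f x)) K K'' z.
Proof.
move=> df dg dA dB uf ug H1 H2 y.
apply: etrans (esym (jmap_comp (w := lsection K (z, y)) df dg dA dB uf ug)) _.
apply: etrans (f_equal (jmap g B) (H1 y)) _.
apply: etrans (H2 (y *m A z)) _.
by rewrite /bmap /= mulmxA.
Qed.

Lemma lrelated_near f g A B K K' z :
  (\forall x \near z, f x = g x) -> (\forall x \near z, A x = B x) ->
  differentiable f z -> differentiable A z ->
  lrelated f A K K' z -> lrelated g B K K' z.
Proof.
move=> fg AB df dA H y.
apply: etrans (esym (jmap_near (w := lsection K (z, y)) fg AB df dA)) _.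
by rewrite H /bmap /= (nbhs_singleton fg) (nbhs_singleton AB).
Qed.

(** Relatedness states an identity between inverse Jacobian matrices and sections;
multiplying by the Jacobian matrix and evaluating on a basis vector of the fibre
turns it into the classical transformation law, which can be differentiated. *)
Lemma lrelated_components f A K K' z j i l : differentiable A z ->
  'J f z \in unitmx -> lrelated f A K K' z ->
  \sum_p K z j p l * A z p i + pd l (fun x => A x j i) z
  = \sum_l' 'J f z l l' * \sum_q A z j q * K' (f z) q i l'.
Proof.
move=> dA uf H.
have /(f_equal (fun w => w.2)) := etrans (esym (jmapE f (delta_mx 0 j) _ dA)) (H (delta_mx 0 j)).
move=> /(f_equal (mulmx ('J f z))); rewrite /= mulKVmx //.
move=> /(f_equal (fun M : 'M[R]_(m, k) => M l i)).
have sE p : \sum_q K z q p l * (delta_mx 0 j : 'rV[R]_k) 0 q = K z j p l.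
  rewrite (bigD1 j) //= mxE !eqxx mulr1 big1 ?addr0 // => q qj.
  by rewrite mxE eqxx (negPf qj) mulr0.
rewrite mxE [X in X + _]mxE [X in _ + X]mxE [RHS]mxE => E.
have dE : \sum_p (delta_mx 0 j : 'rV[R]_k) 0 p * pd l (fun x => A x p i) z = pd l (fun x => A x j i) z.
  rewrite (bigD1 j) //= mxE !eqxx mul1r big1 ?addr0 // => q qj.
  by rewrite mxE eqxx (negPf qj) mul0r.
rewrite -dE; apply: etrans (etrans _ E) _.
  by congr (_ + _); apply: eq_bigr => p _; rewrite mxE sE.
apply: eq_bigr => l' _; congr (_ * _); rewrite mxE; apply: eq_bigr => q _.
by rewrite -rowE mxE mulrC.
Qed.

End Pullback.

(** * Smoothness of pullbacks *)

Section SmoothMx.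
Variables (R : realType) (V : normedModType R) (D : set V).
Hypothesis oD : open D.

Lemma smooth_mulmx p q r (A : V -> 'M[R]_(p, q)) (B : V -> 'M[R]_(q, r)) :
  smooth_on D A -> smooth_on D B -> smooth_on D (fun x => A x *m B x).
Proof.
move=> sA sB; apply: smooth_mx => // i j.
apply: (smooth_eq oD (f := fun x => \sum_k A x i k * B x k j : R^o)).
  by move=> x _; rewrite mxE.
by apply: smooth_sum => // k; apply: smoothM => //; exact: smooth_entry.
Qed.

Lemma smooth_det p (A : V -> 'M[R]_p) : smooth_on D A -> smooth_on D (fun x => \det (A x) : R^o).
Proof.
move=> sA; apply: smooth_sum => // s; apply: smoothM => //; first exact: smooth_cst.
by apply: smooth_prod => // i; exact: smooth_entry.
Qed.

(** By the cofactor formula the inverse is a quotient of polynomials in the entries. *)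
Lemma smooth_invmx p (A : V -> 'M[R]_p) :
  (forall x, D x -> A x \in unitmx) -> smooth_on D A -> smooth_on D (fun x => invmx (A x)).
Proof.
move=> uA sA; apply: smooth_mx => // i j.
have sM : smooth_on D (fun x => \det (row' j (col' i (A x))) : R^o).
  by apply: smooth_det; apply: smooth_mx => // k l; apply: (smooth_eq oD _ (smooth_entry oD (lift j k) (lift i l) sA)) => x _; rewrite !mxE.
apply: (smooth_eq oD (f := fun x => (\det (A x))^-1 * ((-1) ^+ (j + i) * \det (row' j (col' i (A x)))) : R^o)).
  by move=> x Dx; rewrite /invmx uA // !mxE /cofactor.
apply: smoothM => //; first by apply: smoothV => // [x Dx|]; [have := uA x Dx; rewrite unitmxE unitfE|exact: smooth_det].
by apply: smoothM => //; exact: smooth_cst.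
Qed.

End SmoothMx.

Section SmoothBase.
Variables (R : realType) (m : nat) (D : set 'rV[R]_m).
Hypothesis oD : open D.

Lemma smooth_pd l (f : 'rV[R]_m -> R^o) : smooth_on D f -> smooth_on D (pd l f).
Proof. exact: smooth_derive. Qed.

Lemma smooth_jacobian p (f : 'rV[R]_m -> 'rV[R]_p) :
  smooth_on D f -> smooth_on D (fun x => 'J f x).
Proof.
move=> sf; apply: smooth_mx => // i j.
apply: (smooth_eq oD _ (smooth_pd i (smooth_entry oD 0 j sf))) => x Dx.
by rewrite (jacobianE i j (smooth_differentiable sf Dx)).
Qed.

Lemma smooth_dmx k (A : 'rV[R]_m -> 'M[R]_k) y : smooth_on D A -> smooth_on D (dmx A y).
Proof.
move=> sA; apply: smooth_mx => // l i.
apply: (smooth_eq oD (f := fun x => \sum_p y 0 p * pd l (fun x' => A x' p i) x : R^o)).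
  by move=> x _; rewrite mxE.
apply: smooth_sum => // p; apply: smoothM => //; first exact: smooth_cst.
by apply: smooth_pd; exact: smooth_entry.
Qed.

Lemma smooth_pullback k (D' : set 'rV[R]_m) f (A : 'rV[R]_m -> 'M[R]_k) (K : lcomp R m k) :
  open D' -> (forall x, D x -> D' (f x)) ->
  smooth_on D f -> smooth_on D A -> (forall x, D x -> A x \in unitmx) ->
  (forall j i l, smooth_on D' (fun x => K x j i l : R^o)) ->
  forall j i l, smooth_on D (fun x => pullback f A K x j i l : R^o).
Proof.
move=> oD' DD' sf sA uA sK j i l.
apply: (smooth_entry oD l i (M := fun z => ('J f z *m (lsection K (f z, delta_mx 0 j *m A z)).2 - dmx A (delta_mx 0 j) z) *m invmx (A z))).
apply: smooth_mulmx => //; last exact: smooth_invmx.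
apply: smooth_mx => // p q.
apply: (smooth_eq oD (f := fun z => ('J f z *m (lsection K (f z, delta_mx 0 j *m A z)).2) p q - dmx A (delta_mx 0 j) z p q)).
  by move=> x _; rewrite [RHS]mxE [X in _ = _ + X]mxE.
apply: smoothB => //; last by apply: smooth_entry => //; exact: smooth_dmx.
apply: (smooth_entry oD p q (M := fun z => 'J f z *m (lsection K (f z, delta_mx 0 j *m A z)).2)).
apply: smooth_mulmx => //; first exact: smooth_jacobian.
apply: smooth_mx => // a b.
apply: (smooth_eq oD (f := fun x => \sum_q K (f x) q b a * A x j q : R^o)).
  by move=> x _; rewrite mxE; apply: eq_bigr => t _; rewrite -rowE mxE.
apply: smooth_sum => // t; apply: smoothM => //; last exact: smooth_entry.
exact: (smooth_comp oD oD' DD' sf (sK t b a)).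
Qed.

End SmoothBase.

Section FlatConn.
Variables (R : realType) (m n : nat).
Local Notation E0 := (flat R m n).

Lemma jacobian_id (x : 'rV[R]_m) : 'J (fun x : 'rV[R]_m => x) x = 1%:M.
Proof.
apply/matrixP => i j; rewrite jacobianE //.
by apply: etrans (pd_coord _ _ _) _; rewrite mxE.
Qed.

Lemma jmap_id k (w : jco R m k) : jmap (fun x => x) (fun _ => 1%:M) w = w.
Proof.
case: w => [[x y] v]; apply: etrans (jmapE _ _ _ _) _ => //.
rewrite jacobian_id invmx1 mulmx1 mul1mx mulmx1 (_ : dmx _ _ _ = 0) ?addr0 //.
apply/matrixP => l i; rewrite !mxE big1 // => p _.
by rewrite /pd derive_cst mulr0.
Qed.

Lemma lrelated_id k (K : lcomp R m k) x : lrelated (fun x => x) (fun _ => 1%:M) K K x.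
Proof. by move=> y; rewrite jmap_id /bmap /= mulmx1. Qed.

Lemma fibre_rep_flat (a b : cidx E0) :
  fibre_rep (f := id) (fun p (e : fibre (v:=E0) p) => e) (atlas a) (atlas b) = fun _ => 1%:M.
Proof.
apply/funext => x; apply/matrixP => i j.
by rewrite [LHS]mxE !mxE eqxx eq_sym.
Qed.

Lemma flat_lcompat (K : lcomp R m n) :
  lconn_related (E := E0) (E' := E0) setT (f := id) (fun p (e : fibre p) => e) (fun _ => K) (fun _ => K).
Proof.
move=> a b x _; rewrite fibre_rep_flat; exact: lrelated_id.
Qed.

Lemma flat_ccompat (L : lcomp R m m) :
  cconn_related (E := E0) (E' := E0) setT id (fun _ => L) (fun _ => L).
Proof.
move=> a b x _.
rewrite (_ : (fun x => jacobian (base_rep id (atlas a) (atlas b)) x) = fun _ => 1%:M).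
  exact: lrelated_id.
by apply/funext => z; exact: jacobian_id.
Qed.

Definition smooth_comps k (K : lcomp R m k) := forall j i l, smooth_on setT (fun x => K x j i l : R^o).

Program Definition flat_lc (K : lcomp R m n) (sK : smooth_comps K) : linear_connection E0 :=
  @LinearConnection R m n E0 (fun _ => K) _ (@flat_lcompat K).
Next Obligation. by move=> K sK a j i l; rewrite flat_img; exact: sK. Qed.

Program Definition flat_cc (L : lcomp R m m) (sL : smooth_comps L) : classical_connection E0 :=
  @ClassicalConnection R m n E0 (fun _ => L) _ (@flat_ccompat L).
Next Obligation. by move=> K sK a j i l p; rewrite flat_img; exact: sK. Qed.

End FlatConn.

(** * Restriction of a natural rule to the trivial bundle *)

Section Charts.
Variables (R : realType) (m n : nat) (E : vbundle R m n) (a : cidx E).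
Local Notation c := (atlas a).

Lemma xinv_img x : cimg c x -> cdom c (xinv c x) /\ xco c (xinv c x) = x.
Proof.
have [_ _ xK _ _] := atlas_chart a.
by move=> [p dp <-]; rewrite xK.
Qed.

Lemma open_cimg : open (cimg c).
Proof. by have [] := atlas_chart a. Qed.

Lemma yinv_linear p : cdom c p -> linear (yinv c p).
Proof.
have [_ _ _ _ H] := atlas_chart a => dp; have [l K1 K2] := H p dp.
by move=> k u v; apply: (can_inj K1); rewrite l !K2.
Qed.

Variable b : cidx E.

Definition trans_base : 'rV[R]_m -> 'rV[R]_m := base_rep id c (atlas b).
Definition trans_fibre : 'rV[R]_m -> 'M[R]_n := fibre_rep (f := id) (fun p (e : fibre p) => e) c (atlas b).
Definition trans_dom : set 'rV[R]_m := overlap setT id c (atlas b).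

Lemma trans_domP x : trans_dom x <-> cimg c x /\ cdom (atlas b) (xinv c x).
Proof.
split=> [[p [[_ dp] /= dbp] <-]|[ix dbx]].
  have ip : cimg c (xco c p) by exists p.
  by have [_ _ xK _ _] := atlas_chart a; split=> //; rewrite xK.
by have [d e] := xinv_img ix; exists (xinv c x).
Qed.

Lemma open_trans_dom : open trans_dom.
Proof.
rewrite openE => x /trans_domP [ix dbx]; rewrite /interior.
have [_ _ _ [_ cinv] _] := atlas_chart a.
have [od _ _ _ _] := atlas_chart b.
have H1 : nbhs x (cimg c) by apply: open_nbhs_nbhs; split=> //; exact: open_cimg.
have H2 : nbhs x (xinv c @^-1` cdom (atlas b)) by apply: (cinv x ix); apply: open_nbhs_nbhs.
by apply: filterS2 H1 H2 => y iy dy; apply/trans_domP.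
Qed.

Lemma trans_smooth : smooth_on trans_dom trans_base /\ smooth_on trans_dom trans_fibre.
Proof. exact: atlas_smooth. Qed.

Lemma mul_lin1 p q (g : 'rV[R]_p -> 'rV[R]_q) u : linear g -> u *m lin1_mx g = g u.
Proof.
move=> lg; pose lm := GRing.isLinear.Build _ _ _ _ g lg.
pose gl : {linear 'rV[R]_p -> 'rV[R]_q} := HB.pack g lm.
by rewrite -[g]/(gl : _ -> _) mul_rV_lin1.
Qed.

Lemma trans_fibreE x y : trans_dom x ->
  y *m trans_fibre x = yco (atlas b) (yinv c (xinv c x) y).
Proof.
move=> /trans_domP [ix dbx]; have [dx _] := xinv_img ix.
rewrite /trans_fibre /fibre_rep mul_lin1 // => k u v.
have [_ _ _ _ H] := atlas_chart b; have [l _ _] := H _ dbx.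
by rewrite yinv_linear // l.
Qed.

End Charts.

Section ChartsJac.
Variables (R : realType) (m n : nat) (E : vbundle R m n).

Lemma trans_baseK (a b : cidx E) x : trans_dom a b x ->
  trans_dom b a (trans_base a b x) /\ trans_base b a (trans_base a b x) = x.
Proof.
move=> /trans_domP [ix dbx]; have [dx ex] := xinv_img ix.
have [_ _ xK _ _] := atlas_chart b.
have e : xinv (atlas b) (trans_base a b x) = xinv (atlas a) x by rewrite /trans_base /base_rep xK.
split; last by rewrite {1}/trans_base /base_rep e.
apply/trans_domP; rewrite e; split=> //.
by exists (xinv (atlas a) x).
Qed.

(** The transition functions in the two directions are inverse to each other. *)
Lemma trans_jacobian_unit (a b : cidx E) x : trans_dom a b x ->
  'J (trans_base a b) x \in unitmx.
Proof.
move=> dx; have [dy ey] := trans_baseK dx.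
have d1 := smooth_differentiable (trans_smooth a b).1 dx.
have d2 := smooth_differentiable (trans_smooth b a).1 dy.
have E1 : 'J (trans_base a b) x *m 'J (trans_base b a) (trans_base a b x) = 1%:M.
  apply: etrans (esym (jacobian_comp d1 d2)) _.
  apply: etrans (jacobian_id x).
  apply: near_jacobian; last exact: differentiable_comp d1 d2.
  have nx := open_nbhs_nbhs (conj (@open_trans_dom _ _ _ _ a b) dx).
  apply: filterS nx => z dz.
  by have [] := trans_baseK dz.
exact: (mulmx1_unit E1).1.
Qed.

End ChartsJac.

Section Transport.
Variables (R : realType) (m n : nat) (E : vbundle R m n) (a : cidx E).
Variables (f : 'rV[R]_m -> 'rV[R]_m) (A : 'rV[R]_m -> 'M[R]_n).
Hypothesis sf : smooth_on setT f.
Hypothesis injf : injective f.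
Hypothesis fimg : forall z, cimg (atlas a) (f z).
Hypothesis uJ : forall z, 'J f z \in unitmx.
Hypothesis sA : smooth_on setT A.
Hypothesis uA : forall z, A z \in unitmx.
Local Notation c := (atlas a).
Local Notation E0 := (flat R m n).

Let oT : open [set: 'rV[R]_m] := openT.

Let f0 (z : base E0) : base E := xinv c (f z).
Let phi (z : base E0) (y : fibre z) : fibre (f0 z) := yinv c (f0 z) (y *m A z).

Let df z : differentiable f z := smooth_differentiable sf I.
Let dA z : differentiable A z := smooth_differentiable sA I.

Lemma flat_map_overlap (a0 : cidx E0) b z : overlap setT f0 (atlas a0) (atlas b) z <-> trans_dom a b (f z).
Proof.
split=> [[p [_ /= dp] <-]|/trans_domP [_ dz]]; first exact/trans_domP.
by exists z.
Qed.

Lemma open_flat_map_overlap (a0 : cidx E0) b : open (overlap setT f0 (atlas a0) (atlas b)).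
Proof.
have -> : overlap setT f0 (atlas a0) (atlas b) = f @^-1` trans_dom a b.
  by apply/seteqP; split=> z /flat_map_overlap.
apply: open_comp; last exact: open_trans_dom.
by move=> z _; exact: differentiable_continuous.
Qed.

Lemma base_rep_flat_map (a0 : cidx E0) b : base_rep f0 (atlas a0) (atlas b) = fun z => trans_base a b (f z).
Proof. by []. Qed.

Lemma fibre_rep_flat_map (a0 : cidx E0) b z : overlap setT f0 (atlas a0) (atlas b) z ->
  fibre_rep phi (atlas a0) (atlas b) z = A z *m trans_fibre a b (f z).
Proof.
move=> /flat_map_overlap dz; apply/row_matrixP => i; rewrite [RHS]rowE mulmxA.
rewrite trans_fibreE // [LHS]rowE; apply/rowP => j.
rewrite /fibre_rep -rowE !mxE.
by rewrite /phi.
Qed.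

Lemma base_rep_self : base_rep f0 (atlas (v := E0) tt) c = f.
Proof. by apply/funext => z; rewrite base_rep_flat_map /trans_base /base_rep; have [_ ->] := xinv_img (fimg z). Qed.

Lemma fibre_rep_self : fibre_rep phi (atlas (v := E0) tt) c = A.
Proof.
apply/funext => z; have [dz ez] := xinv_img (fimg z).
have dd : trans_dom a a (f z) by apply/trans_domP.
rewrite fibre_rep_flat_map; last exact/flat_map_overlap.
rewrite -[RHS]mulmx1; congr (_ *m _); apply/row_matrixP => i; rewrite rowE (rowE _ 1%:M) mulmx1.
rewrite trans_fibreE //.
by have [_ _ _ _ H] := atlas_chart a; have [_ _ ->] := H _ dz.
Qed.

Lemma flat_map_smooth (a0 : cidx E0) b : smooth_rep setT phi (atlas a0) (atlas b).
Proof.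
have oo := @open_flat_map_overlap a0 b; have [s1 s2] := trans_smooth a b.
split.
  apply: smooth_mx => // i j.
  apply: (smooth_comp (f := fun y => trans_base a b y i j : R^o) (g := f) oo (@open_trans_dom _ _ _ _ a b)) => [z /flat_map_overlap//||].
    by move=> vs x _; exact: sf.
  exact: (smooth_entry (@open_trans_dom _ _ _ _ a b) i j s1).
apply: (smooth_eq oo (f := fun z => A z *m trans_fibre a b (f z))).
  by move=> z oz; rewrite fibre_rep_flat_map.
apply: smooth_mulmx => //; first by move=> vs x _; exact: sA.
apply: smooth_mx => // i j.
apply: (smooth_comp (f := fun y => trans_fibre a b y i j : R^o) (g := f) oo (@open_trans_dom _ _ _ _ a b)) => [z /flat_map_overlap//||].
  by move=> vs x _; exact: sf.
exact: (smooth_entry (@open_trans_dom _ _ _ _ a b) i j s2).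
Qed.

(** The map y |-> y A(z) read in the chart a of E, restricted to the range of f, is a
local isomorphism from the trivial bundle.  Here it matters that f is defined on
the whole coordinate space with values in the image of the chart: the source is
then the full trivial bundle. *)
Lemma flat_map_local_iso : local_iso setT phi.
Proof.
have [_ _ _ [_ cinv] lin] := atlas_chart a.
split=> //.
- move=> z _; apply: continuous_comp; first exact: differentiable_continuous.
  exact: cinv.
- move=> p q _ _ e; apply: injf.
  by have [_ <-] := xinv_img (fimg p); have [_ <-] := xinv_img (fimg q); rewrite -/(f0 p) e.
- move=> p _; have [dp _] := xinv_img (fimg p); have [l K1 K2] := lin _ dp; split.
    by move=> k u v; rewrite /phi mulmxDl -scalemxAl yinv_linear.
  exists (fun e => yco c e *m invmx (A p)) => y.
    by rewrite /phi K2 mulmxK.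
  by rewrite /phi mulmxKV // K1.
move=> a0 b; split; first exact: flat_map_smooth.
move=> z /flat_map_overlap dz; rewrite base_rep_flat_map.
rewrite (jacobian_comp (df z) (smooth_differentiable (trans_smooth a b).1 dz)).
by rewrite unitmx_mul; apply/andP; split; [exact: uJ|exact: trans_jacobian_unit].
Qed.

Variables (L : classical_connection E) (K : linear_connection E).

Let K0 := pullback f A (K a).
Let L0 := pullback f (fun z => 'J f z) (L a).

Lemma smooth_pulled_lc : smooth_comps K0.
Proof.
move=> j i l; apply: (smooth_pullback oT (@open_cimg _ _ _ _ a)) => // j' i' l'.
exact: lc_smooth.
Qed.

Lemma smooth_pulled_cc : smooth_comps L0.
Proof.
move=> j i l; apply: (smooth_pullback oT (@open_cimg _ _ _ _ a)) => //; first exact: smooth_jacobian.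
by move=> j' i' l'; exact: cc_smooth.
Qed.

Lemma related_pulled_lc : lconn_related setT phi (flat_lc smooth_pulled_lc) K.
Proof.
move=> a0 b z oz; have /flat_map_overlap dz := oz.
have [s1 s2] := trans_smooth a b.
have dT := smooth_differentiable s1 dz; have dN := smooth_differentiable s2 dz.
have rel : lrelated (fun x => trans_base a b (f x)) (fun x => A x *m trans_fibre a b (f x)) K0 (K b) z.
  apply: (@lrelated_comp _ _ _ f (trans_base a b) A (trans_fibre a b) K0 (K a) (K b)) => //.
  - exact: trans_jacobian_unit.
  - exact: lrelated_pullback.
  exact: (lc_compat K).
apply: lrelated_near rel.
- by apply: filterE => x.
- apply: filterS (open_nbhs_nbhs (conj (@open_flat_map_overlap a0 b) oz)) => x ox.
  by rewrite fibre_rep_flat_map.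
- exact: differentiable_comp (df z) dT.
- exact: differentiable_mulmx (dA z) (differentiable_mxcomp (df z) dN).
Qed.

Lemma related_pulled_cc : cconn_related setT f0 (flat_cc n smooth_pulled_cc) L.
Proof.
move=> a0 b z oz; have /flat_map_overlap dz := oz.
have [s1 s2] := trans_smooth a b.
have sJT := smooth_jacobian (@open_trans_dom _ _ _ _ a b) s1.
have dT := smooth_differentiable s1 dz; have dN := smooth_differentiable sJT dz.
have dJ x : differentiable (fun x => 'J f x) x := smooth_differentiable (smooth_jacobian oT sf) I.
have rel : lrelated (fun x => trans_base a b (f x)) (fun x => 'J f x *m 'J (trans_base a b) (f x)) L0 (L b) z.
  apply: (@lrelated_comp _ _ _ f (trans_base a b) (fun x => 'J f x) (fun x => 'J (trans_base a b) x) L0 (L a) (L b)) => //.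
  - exact: trans_jacobian_unit.
  - exact: lrelated_pullback.
  exact: (cc_compat L).
apply: lrelated_near rel.
- by apply: filterE => x.
- apply: filterS (open_nbhs_nbhs (conj (@open_flat_map_overlap a0 b) oz)) => x /flat_map_overlap dx.
  by apply/esym; apply: jacobian_comp (df x) (smooth_differentiable s1 dx).
- exact: differentiable_comp (df z) dT.
- exact: differentiable_mulmx (dJ z) (differentiable_mxcomp (df z) dN).
Qed.

(** The pulled back connections are smooth on the whole coordinate space and related
to the given ones by a local isomorphism, so invariance of the rule relates its
values. *)
Theorem transport (Gam : rule R m n) : commutes_with_local_isos Gam ->
  exists (L0 : classical_connection E0) (K0 : linear_connection E0),
  [/\ forall z, lrelated f A (K0 tt) (K a) z,
      forall z, lrelated f (fun x => 'J f x) (L0 tt) (L a) z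
    & forall w, jrelated f A (Gam E0 L0 K0 tt) (Gam E L K a) w].
Proof.
move=> nat; exists (flat_cc n smooth_pulled_cc), (flat_lc smooth_pulled_lc).
have sJ := smooth_jacobian oT sf.
split=> [z|z|w]; first exact: lrelated_pullback.
  by apply: lrelated_pullback => //; exact: smooth_differentiable sJ I.
have := nat E0 E setT f0 phi flat_map_local_iso _ _ _ _ related_pulled_cc related_pulled_lc tt a w.
rewrite base_rep_self fibre_rep_self; apply.
by apply/flat_map_overlap/trans_domP; split=> //; have [] := xinv_img (fimg w.1.1).
Qed.

End Transport.

(** * Transformation law of connections on the jet bundle *)

Section LinComp.
Variables (R : realType) (V W : normedModType R) (l : V -> W).
Hypotheses (ll : linear l) (cl : continuous l).

Let lin : {linear V -> W} := HB.pack l (GRing.isLinear.Build _ _ _ _ l ll).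

Lemma lin_differentiable x : differentiable l x.
Proof. exact: (linear_differentiable x (f := lin) cl). Qed.

Lemma lin_derive x v : 'D_v l x = l v.
Proof. by rewrite deriveE; [rewrite (@diff_lin _ _ _ lin)|exact: lin_differentiable]. Qed.

Lemma lin_comp_differentiable (g : W -> R^o) x : differentiable g (l x) ->
  differentiable (fun w => g (l w)) x.
Proof. by move=> dg; exact: differentiable_comp (lin_differentiable x) dg. Qed.

Lemma lin_comp_derive (g : W -> R^o) x v : differentiable g (l x) ->
  'D_v (fun w => g (l w)) x = 'D_(l v) g (l x).
Proof. exact: (derive_linear_comp (l := lin)). Qed.

Lemma lin_comp_smooth (D : set W) (g : W -> R^o) : open D ->
  smooth_on D g -> smooth_on (l @^-1` D) (fun w => g (l w)).
Proof.
move=> oD sg; apply/smooth_onP.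
have oD' : open (l @^-1` D) by apply: open_comp => // x _; exact: cl.
move=> k; elim: k g sg => [|k IH] g sg.
  by split=> // x Dx; apply: lin_comp_differentiable; exact: smooth_differentiable sg Dx.
split=> [x Dx|v].
  by apply: lin_comp_differentiable; exact: smooth_differentiable sg Dx.
apply: (Ck_eq oD' _ (IH _ (smooth_derive (l v) sg))) => x Dx.
by rewrite lin_comp_derive //; exact: smooth_differentiable sg Dx.
Qed.

End LinComp.

Section Law.
Variables (R : realType) (m n : nat).
Local Notation J1 := (jco R m n).

Lemma proj_x_linear : linear (fun w : J1 => w.1.1). Proof. by []. Qed.
Lemma proj_y_linear p : linear (fun w : J1 => w.1.2 0 p : R^o). Proof. by move=> k u v; rewrite /= !mxE. Qed.
Lemma proj_v_linear l p : linear (fun w : J1 => w.2 l p : R^o). Proof. by move=> k u v; rewrite /= !mxE. Qed.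
Lemma proj_x_continuous : continuous (fun w : J1 => w.1.1).
Proof. by move=> w; apply: continuous_comp; exact: cvg_fst. Qed.
Lemma proj_y_continuous p : continuous (fun w : J1 => w.1.2 0 p : R^o).
Proof.
move=> w; apply: (@continuous_comp _ _ _ (fun w : J1 => w.1) (fun z => z.2 0 p)); first exact: cvg_fst.
by apply: (@continuous_comp _ _ _ snd (fun y : 'rV[R]_n => y 0 p)); [exact: cvg_snd|exact: coord_continuous].
Qed.
Lemma proj_v_continuous l p : continuous (fun w : J1 => w.2 l p : R^o).
Proof.
by move=> w; apply: (@continuous_comp _ _ _ snd (fun y : 'M[R]_(m, n) => y l p)); [exact: cvg_snd|exact: coord_continuous].
Qed.

Variables (f : 'rV[R]_m -> 'rV[R]_m) (A : 'rV[R]_m -> 'M[R]_n).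
Hypothesis sf : smooth_on setT f.
Hypothesis sA : smooth_on setT A.
Hypothesis uJ : forall z, 'J f z \in unitmx.
Let df z : differentiable f z := smooth_differentiable sf I.
Let dA z : differentiable A z := smooth_differentiable sA I.
Let oT : open [set: 'rV[R]_m] := openT.
Let fc k := fun x => f x 0 k : R^o.
Let Ac p i := fun x => A x p i : R^o.

(** The jet prolongation written without the inverse Jacobian matrix, so that it can
be differentiated along curves in the jet space. *)
Lemma jmap_implicit (w : J1) l i :
  \sum_l' pd l (fc l') w.1.1 * (jmap f A w).2 l' i
  = \sum_p w.2 l p * A w.1.1 p i + \sum_p w.1.2 0 p * pd l (Ac p i) w.1.1.
Proof.
case: w => [[x y] v]; set U := (jmap f A (x, y, v)).2; rewrite /=.
have E : 'J f x *m U = v *m A x + dmx A y x.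
  by rewrite /U (f_equal (fun w => w.2) (jmapE f y v (dA x))) /= mulKVmx.
have R1 : (v *m A x + dmx A y x) l i =
    \sum_p v l p * A x p i + \sum_p y 0 p * pd l (Ac p i) x.
  by rewrite mxE [X in X + _]mxE [X in _ + X]mxE.
rewrite -R1 -E mxE; apply: eq_bigr => l' _.
by rewrite (jacobianE l l' (df x)).
Qed.

Lemma smooth_jmap2 l i : smooth_on [set: J1] (fun w => (jmap f A w).2 l i : R^o).
Proof.
have oJ : open [set: J1] := openT.
have sJ : smooth_on setT (fun z => invmx ('J f z)) by apply: smooth_invmx => //; exact: smooth_jacobian.
have sx (g : 'rV[R]_m -> R^o) : smooth_on setT g -> smooth_on [set: J1] (fun w : J1 => g w.1.1).
  by move=> sg; have := lin_comp_smooth proj_x_linear proj_x_continuous oT sg; rewrite preimage_setT.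
have sl (g : J1 -> R^o) : linear g -> continuous g -> smooth_on [set: J1] g.
  move=> lg cg.
  exact: (smooth_lin oJ (l := HB.pack g (GRing.isLinear.Build _ _ _ _ g lg))).
apply: (smooth_eq oJ (f := fun w : J1 => \sum_k invmx ('J f w.1.1) l k *
   (\sum_p w.2 k p * A w.1.1 p i + \sum_p w.1.2 0 p * pd k (Ac p i) w.1.1) : R^o)).
  move=> [[x y] v] _; rewrite (jmapE f y v (dA x)) [RHS]mxE; apply: eq_bigr => k _.
  by rewrite [X in _ = _ * X]mxE [X in _ = _ * (X + _)]mxE [X in _ = _ * (_ + X)]mxE.
apply: smooth_sum => // k; apply: smoothM => //.
  exact: (sx (fun z => invmx ('J f z) l k) (smooth_entry oT l k sJ)).
apply: smoothD => //; apply: smooth_sum => // p; apply: smoothM => //.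
- exact (sl _ (proj_v_linear k p) (@proj_v_continuous k p)).
- exact: (sx (fun z => A z p i) (smooth_entry oT p i sA)).
- exact (sl _ (proj_y_linear p) (@proj_y_continuous p)).
- exact: (sx (pd k (Ac p i)) (smooth_pd k (smooth_entry oT p i sA))).
Qed.

Lemma jmap_implicit_derive (w X : J1) l i :
  \sum_l' 'D_(X.1.1) (pd l (fc l')) w.1.1 * (jmap f A w).2 l' i
  + \sum_l' pd l (fc l') w.1.1 * 'D_X (fun w => (jmap f A w).2 l' i : R^o) w
  = \sum_p (X.2 l p * A w.1.1 p i + w.2 l p * 'D_(X.1.1) (Ac p i) w.1.1)
  + \sum_p (X.1.2 0 p * pd l (Ac p i) w.1.1 + w.1.2 0 p * 'D_(X.1.1) (pd l (Ac p i)) w.1.1).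
Proof.
have dx (g : 'rV[R]_m -> R^o) : smooth_on setT g ->
    differentiable (fun w : J1 => g w.1.1) w /\
    'D_X (fun w : J1 => g w.1.1) w = 'D_(X.1.1) g w.1.1.
  move=> sg; have dg : differentiable g w.1.1 := smooth_differentiable sg I.
  split; first exact: (lin_comp_differentiable proj_x_linear proj_x_continuous dg).
  exact: (lin_comp_derive proj_x_linear proj_x_continuous _ dg).
have dl (g : J1 -> R^o) : linear g -> continuous g -> differentiable g w /\ 'D_X g w = g X.
  move=> lg cg; split; first exact: lin_differentiable.
  exact: lin_derive.
have sfc k : smooth_on setT (fc k) by exact: smooth_entry.
have sAc p q : smooth_on setT (Ac p q) by exact: smooth_entry.
have dU k : differentiable (fun w => (jmap f A w).2 k i : R^o) w := smooth_differentiable (smooth_jmap2 k i) I.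
have dF k := (dx _ (smooth_pd l (sfc k))).
have dAp p := dx _ (sAc p i).
have dAd p := dx _ (smooth_pd l (sAc p i)).
have dv p := dl _ (proj_v_linear l p) (@proj_v_continuous l p).
have dy p := dl _ (proj_y_linear p) (@proj_y_continuous p).
have E : 'D_X (fun w : J1 => \sum_l' pd l (fc l') w.1.1 * (jmap f A w).2 l' i : R^o) w =
  'D_X (fun w : J1 => \sum_p w.2 l p * A w.1.1 p i + \sum_p w.1.2 0 p * pd l (Ac p i) w.1.1 : R^o) w.
  by apply: derive_scaler_eq => w'; exact: jmap_implicit.
have E1 := derive_sumM X (fun k => (dF k).1) dU.
have E2 := derive_sumM X (fun p => (dv p).1) (fun p => (dAp p).1).
have E3 := derive_sumM X (fun p => (dy p).1) (fun p => (dAd p).1).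
move: E; rewrite E1 derive_scalarD; last 2 first.
- by apply: differentiable_bigsum => p; apply: differentiableM; [exact: (dv p).1|exact: (dAp p).1].
- by apply: differentiable_bigsum => p; apply: differentiableM; [exact: (dy p).1|exact: (dAd p).1].
rewrite E2 E3 big_split /= => E.
apply: etrans (etrans _ E) _.
  by congr (_ + _); apply: eq_bigr => k _; rewrite (dF k).2.
congr (_ + _); apply: eq_bigr => p _.
  by rewrite (dv p).2 (dAp p).2.
by rewrite (dy p).2 (dAd p).2.
Qed.

Lemma diff_bmap (z xi : 'rV[R]_m * 'rV[R]_n) :
  differentiable (bmap f A) z /\
  'd (bmap f A) z xi = (\row_k 'D_(xi.1) (fc k) z.1,
    \row_j \sum_p (xi.2 0 p * A z.1 p j + z.2 0 p * 'D_(xi.1) (Ac p j) z.1)).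
Proof.
have l1 : linear (fun z : 'rV[R]_m * 'rV[R]_n => z.1) by [].
have c1 : continuous (fun z : 'rV[R]_m * 'rV[R]_n => z.1) by move=> w; exact: cvg_fst.
have l2 p : linear (fun z : 'rV[R]_m * 'rV[R]_n => z.2 0 p : R^o) by move=> k u v; rewrite /= !mxE.
have c2 p : continuous (fun z : 'rV[R]_m * 'rV[R]_n => z.2 0 p : R^o).
  by move=> w; apply: (@continuous_comp _ _ _ snd (fun y : 'rV[R]_n => y 0 p)); [exact: cvg_snd|exact: coord_continuous].
have d1 : differentiable (fun z : 'rV[R]_m * 'rV[R]_n => f z.1) z.
  by apply: differentiable_comp (lin_differentiable l1 c1 z) (df z.1).
have dAz p j : differentiable (fun z : 'rV[R]_m * 'rV[R]_n => Ac p j z.1) z.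
  by apply: (lin_comp_differentiable l1 c1); exact: differentiable_entry.
have dl2 p := lin_differentiable (l2 p) (c2 p) z.
have d2 : differentiable (fun z : 'rV[R]_m * 'rV[R]_n => z.2 *m A z.1) z.
  apply: differentiable_mx => i j.
  apply: (differentiable_ext (f := fun z : 'rV[R]_m * 'rV[R]_n => \sum_p z.2 0 p * Ac p j z.1 : R^o)).
    by move=> z'; rewrite ord1 mxE.
  by apply: differentiable_bigsum => p; apply: differentiableM.
split; first exact: differentiable_pair d1 d2.
rewrite (diff_pair d1 d2) -!deriveE //; congr (_, _); apply/rowP => j; rewrite [RHS]mxE derive_entry //.
apply: etrans (derive_scaler_eq (g := fun z : 'rV[R]_m * 'rV[R]_n => \sum_p z.2 0 p * Ac p j z.1) _ _ _) _.
  by move=> z'; rewrite mxE.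
rewrite derive_sumM //; apply: eq_bigr => p _.
rewrite (lin_derive (l2 p) (c2 p)); congr (_ + _ * _).
Qed.

Lemma diff_jmap (w X : J1) l i :
  ('d (jmap f A) w X).2 l i = 'D_X (fun w => (jmap f A w).2 l i : R^o) w.
Proof.
have l1 : linear (fun z : J1 => z.1) by [].
have c1 : continuous (fun z : J1 => z.1) by move=> w'; exact: cvg_fst.
have d1 : differentiable (fun w : J1 => bmap f A w.1) w.
  by apply: differentiable_comp (lin_differentiable l1 c1 w) _; exact: (diff_bmap w.1 0).1.
have d2 : differentiable (fun w : J1 => (jmap f A w).2) w.
  by apply: differentiable_mx => p q; exact: smooth_differentiable (smooth_jmap2 p q) I.
rewrite -derive_entry // deriveE //.
have -> : jmap f A = fun w => (bmap f A w.1, (jmap f A w).2) by [].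
by rewrite (diff_pair d1 d2).
Qed.

Variables (G0 G' : jcomp R m n) (w : J1).
Hypothesis rel : jrelated f A G0 G' w.
Local Notation w' := (jmap f A w).

(** Relatedness of connections on the jet bundle is an identity between tangent maps.
Differentiating the implicit form of the prolongation along the horizontal lift of
xi makes it a linear relation between the components. *)
Lemma transport_law (xi : 'rV[R]_m * 'rV[R]_n) l i :
  \sum_l' 'D_(xi.1) (pd l (fc l')) w.1.1 * w'.2 l' i
  + \sum_l' pd l (fc l') w.1.1 *
     (\sum_k 'D_(xi.1) (fc k) w.1.1 * G' w' (inl k) i l'
     + \sum_j (\sum_p (xi.2 0 p * A w.1.1 p j + w.1.2 0 p * 'D_(xi.1) (Ac p j) w.1.1)) * G' w' (inr j) i l')
  = \sum_p ((\sum_k xi.1 0 k * G0 w (inl k) p l + \sum_j xi.2 0 j * G0 w (inr j) p l) * A w.1.1 p i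
            + w.2 l p * 'D_(xi.1) (Ac p i) w.1.1)
  + \sum_p (xi.2 0 p * pd l (Ac p i) w.1.1 + w.1.2 0 p * 'D_(xi.1) (pd l (Ac p i)) w.1.1).
Proof.
have := jmap_implicit_derive w (hlift G0 w xi) l i; rewrite /=.
under [X in _ = X + _ -> _]eq_bigr do rewrite [(\matrix_(l, i) _) _ _]mxE.
move=> <-; congr (_ + _); apply: eq_bigr => l' _; congr (_ * _).
rewrite -diff_jmap rel /= mxE (diff_bmap w.1 xi).2 /=.
by congr (_ + _); apply: eq_bigr => j _; rewrite mxE.
Qed.

Lemma transport_law_h a l i :
  \sum_l' pd a (pd l (fc l')) w.1.1 * w'.2 l' i
  + \sum_l' pd l (fc l') w.1.1 *
     (\sum_k pd a (fc k) w.1.1 * G' w' (inl k) i l'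
     + \sum_j (\sum_p w.1.2 0 p * pd a (Ac p j) w.1.1) * G' w' (inr j) i l')
  = \sum_p (G0 w (inl a) p l * A w.1.1 p i + w.2 l p * pd a (Ac p i) w.1.1)
  + \sum_p w.1.2 0 p * pd a (pd l (Ac p i)) w.1.1.
Proof.
have := transport_law (delta_mx 0 a, 0) l i; rewrite /=.
under [X in _ + X = _ -> _]eq_bigr do
  (under [X in _ * (_ + X)]eq_bigr do (under eq_bigr do rewrite mxE mul0r add0r)).
under [X in _ = _ + X -> _]eq_bigr do rewrite mxE mul0r add0r.
move=> ->; congr (_ + _); apply: eq_bigr => p _; congr (_ * _ + _).
rewrite [X in _ + X]big1 ?addr0 => [|j _]; last by rewrite mxE mul0r.
rewrite (bigD1 a) //= mxE !eqxx mul1r big1 ?addr0 // => k ka.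
by rewrite mxE eqxx (negPf ka) mul0r.
Qed.

Lemma transport_law_v q l i :
  \sum_l' pd l (fc l') w.1.1 * (\sum_j A w.1.1 q j * G' w' (inr j) i l')
  = \sum_p G0 w (inr q) p l * A w.1.1 p i + pd l (Ac q i) w.1.1.
Proof.
have := transport_law (0, delta_mx 0 q) l i; rewrite /=.
have sE (F : 'I_n -> R) : \sum_p (delta_mx 0 q : 'rV[R]_n) 0 p * F p = F q.
  rewrite (bigD1 q) //= mxE !eqxx mul1r big1 ?addr0 // => k ka.
  by rewrite mxE eqxx (negPf ka) mul0r.
under [X in X + _ = _ -> _]eq_bigr do rewrite derive0 mul0r.
rewrite big1_eq add0r.
under [X in X = _ -> _]eq_bigr do
  (rewrite [X in _ * (X + _)]big1 ?add0r; [|by move=> *; rewrite derive0 mul0r];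
   under eq_bigr do (rewrite big_split /= sE; rewrite [X in (_ + X) * _]big1 ?addr0; [|by move=> *; rewrite derive0 mulr0])).
move=> ->; rewrite [X in _ + X]big_split /= sE [X in _ + (_ + X)]big1 ?addr0; last by move=> *; rewrite derive0 mulr0.
congr (_ + _); apply: eq_bigr => p _; rewrite derive0 mulr0 addr0 sE.
by rewrite big1 ?add0r // => k _; rewrite mxE mul0r.
Qed.

End Law.

Section LawAtOrigin.
Variables (R : realType) (m n : nat).
Variables (f : 'rV[R]_m -> 'rV[R]_m) (A : 'rV[R]_m -> 'M[R]_n) (x : 'rV[R]_m).
Hypothesis sf : smooth_on setT f.
Hypothesis sA : smooth_on setT A.
Hypothesis uJ : forall z, 'J f z \in unitmx.
Hypothesis f0 : f 0 = x.
Hypothesis A0 : A 0 = 1%:M.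
Hypothesis f1 : forall i l, pd l (fun z => f z 0 i : R^o) 0 = (l == i)%:R.
Variables (y : 'rV[R]_n) (v u : 'M[R]_(m, n)).
Hypothesis uv : forall l i, u l i = v l i + \sum_p y 0 p * pd l (fun z => A z p i : R^o) 0.
Variables G0 G' : jcomp R m n.
Hypothesis rel : jrelated f A G0 G' (0, y, v).
Local Notation w0 := ((0, y, v) : jco R m n).
Local Notation w := ((x, y, u) : jco R m n).

Let AE p j : A 0 p j = (p == j)%:R. Proof. by rewrite A0 mxE. Qed.

Lemma jmap_origin : jmap f A w0 = w.
Proof.
have j1 : (jmap f A w0).1 = (x, y) by rewrite /= /bmap /= f0 A0 mulmx1.
rewrite [LHS]surjective_pairing j1; congr (_, _); apply/matrixP => l i; rewrite uv.
have : \sum_l' pd l (fun z => f z 0 l' : R^o) 0 * (jmap f A w0).2 l' i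
    = \sum_p v l p * A 0 p i + \sum_p y 0 p * pd l (fun z => A z p i : R^o) 0.
  exact: (jmap_implicit sf sA uJ w0 l i).
under eq_bigr do rewrite f1; rewrite sum_pickl => ->.
by congr (_ + _); under eq_bigr do rewrite AE; exact: sum_pickr.
Qed.

(** Here and below the chart osculates the identity to first order at the origin, so
that both Jacobian matrices disappear from the law. *)
Lemma origin_law_v q i l :
  G' w (inr q) i l = G0 w0 (inr q) i l + pd l (fun z => A z q i : R^o) 0.
Proof.
have : \sum_l' pd l (fun z => f z 0 l' : R^o) 0 * (\sum_j A 0 q j * G' w (inr j) i l')
    = \sum_p G0 w0 (inr q) p l * A 0 p i + pd l (fun z => A z q i : R^o) 0.
  by have := transport_law_v sf sA uJ rel q l i; rewrite jmap_origin.
under [X in X = _ -> _]eq_bigr do rewrite f1; rewrite sum_pickl.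
under [X in X = _ -> _]eq_bigr do rewrite AE; rewrite sum_pickl => ->.
by congr (_ + _); under eq_bigr do rewrite AE; exact: sum_pickr.
Qed.

Lemma origin_law_h b i l :
  G' w (inl b) i l = G0 w0 (inl b) i l + \sum_p v l p * pd b (fun z => A z p i : R^o) 0
    + \sum_p y 0 p * pd b (pd l (fun z => A z p i : R^o)) 0
    - \sum_c pd b (pd l (fun z => f z 0 c : R^o)) 0 * u c i
    - \sum_j (\sum_p y 0 p * pd b (fun z => A z p j : R^o) 0) * G' w (inr j) i l.
Proof.
have : \sum_l' pd b (pd l (fun z => f z 0 l' : R^o)) 0 * u l' i
    + \sum_l' pd l (fun z => f z 0 l' : R^o) 0 *
       (\sum_k pd b (fun z => f z 0 k : R^o) 0 * G' w (inl k) i l'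
        + \sum_j (\sum_p y 0 p * pd b (fun z => A z p j : R^o) 0) * G' w (inr j) i l')
    = \sum_p (G0 w0 (inl b) p l * A 0 p i + v l p * pd b (fun z => A z p i : R^o) 0)
      + \sum_p y 0 p * pd b (pd l (fun z => A z p i : R^o)) 0.
  by have := transport_law_h sf sA uJ rel b l i; rewrite jmap_origin.
rewrite [X in _ + X = _](eq_bigr (fun l' => (l == l')%:R * (G' w (inl b) i l'
    + \sum_j (\sum_p y 0 p * pd b (fun z => A z p j : R^o) 0) * G' w (inr j) i l'))) => [|l' _]; last first.
  by rewrite f1; congr (_ * (_ + _)); under eq_bigr do rewrite f1; exact: sum_pickl.
rewrite sum_pickl [X in _ = X + _]big_split /=.
under [X in _ = X + _ + _ -> _]eq_bigr do rewrite AE; rewrite sum_pickr.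
by move=> <-; ring.
Qed.

End LawAtOrigin.

(** * Linear changes of coordinates *)
Section LinearChange.
Variables (R : realType) (m n : nat) (Gam : rule R m n).
Hypothesis nat : commutes_with_local_isos Gam.
Local Notation E0 := (flat R m n).

(** Values at the origin, which is fixed by all linear changes; by [transport] they
determine the rule. *)
Definition Gam0 (L : classical_connection E0) (K : linear_connection E0) (y : 'rV[R]_n) (v : 'M[R]_(m, n)) :=
  @Gam E0 L K tt (0, y, v).

Lemma mulmx_smooth p q (g : 'M[R]_(p, q)) : smooth_on setT (fun z : 'rV[R]_p => z *m g).
Proof.
have oT : open [set: 'rV[R]_p] := openT.
apply: smooth_mx => // i j.
apply: (smooth_eq oT (f := fun z => \sum_k z 0 k * g k j : R^o)).
  by move=> z _; rewrite [RHS]mxE ord1.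
apply: smooth_sum => // k; apply: smoothM => //; last exact: smooth_cst.
apply: (smooth_entry oT 0 k (M := fun z => z)).
by apply: (smooth_lin oT (l := idfun)) => x; exact: cvg_id.
Qed.

Lemma jacobian_mulmx p q (g : 'M[R]_(p, q)) (z : 'rV[R]_p) : 'J (fun z : 'rV[R]_p => z *m g) z = g.
Proof.
apply/matrixP => i j; rewrite (jacobianE i j (smooth_differentiable (mulmx_smooth g) I)).
rewrite /pd (derive_scaler_eq (g := fun z : 'rV[R]_p => \sum_k z 0 k * g k j)); last by move=> x; rewrite mxE.
have dk k : differentiable (fun z : 'rV[R]_p => z 0 k : R^o) z by exact: differentiable_coord.
rewrite derive_sumM // (bigD1 i) //= derive_cst mulr0 addr0 [X in X * _](pd_coord i i z) eqxx mul1r.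
rewrite big1 ?addr0 // => k ki.
by rewrite derive_cst mulr0 addr0 [X in X * _](pd_coord i k z) eq_sym (negPf ki) mul0r.
Qed.

Lemma pd_mulmx p q (g : 'M[R]_(p, q)) k j (z : 'rV[R]_p) :
  pd k (fun z : 'rV[R]_p => (z *m g) 0 j : R^o) z = g k j.
Proof. by rewrite -(jacobianE k j (smooth_differentiable (mulmx_smooth g) I)) jacobian_mulmx. Qed.

(** For linear f and constant A all second derivatives vanish, so both connections and
the rule itself transform as tensors. *)
Lemma linear_change (g : 'M[R]_m) (h : 'M[R]_n) (L : classical_connection E0) (K : linear_connection E0) :
  g \in unitmx -> h \in unitmx ->
  exists (L0 : classical_connection E0) (K0 : linear_connection E0),
  [/\ forall z j i l, \sum_p L0 tt z j p l * g p i = \sum_l' g l l' * \sum_q g j q * L tt (z *m g) q i l',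
      forall z j i l, \sum_p K0 tt z j p l * h p i = \sum_l' g l l' * \sum_q h j q * K tt (z *m g) q i l',
      forall y v u, g *m u = v *m h -> forall a l i,
        \sum_l' g l l' * \sum_k g a k * Gam0 L K (y *m h) u (inl k) i l'
        = \sum_p Gam0 L0 K0 y v (inl a) p l * h p i
    & forall y v u, g *m u = v *m h -> forall q l i,
        \sum_l' g l l' * \sum_j h q j * Gam0 L K (y *m h) u (inr j) i l'
        = \sum_p Gam0 L0 K0 y v (inr q) p l * h p i].
Proof.
move=> ug uh.
have sf := mulmx_smooth g.
have sA : smooth_on [set: 'rV[R]_m] (fun _ => h) by apply: smooth_cst; exact: openT.
have uJ z : 'J (fun z : 'rV[R]_m => z *m g) z \in unitmx by rewrite jacobian_mulmx.
have injf : injective (fun z : 'rV[R]_m => z *m g) by exact: (can_inj (mulmxK ug)).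
have fimg z : cimg (atlas (v := E0) tt) ((fun z : 'rV[R]_m => z *m g) z) by rewrite flat_img.
have [L0 [K0 [rK rL rG]]] := transport sf injf fimg uJ sA (fun _ => uh) L K nat.
have pdc (c : R) k (z : 'rV[R]_m) : pd k (fun _ => c : R^o) z = 0 by exact: derive_cst.
exists L0, K0; split=> [z j i l|z j i l|y v u guv a l i|y v u guv q l i].
- have dA : differentiable (fun x : 'rV[R]_m => 'J (fun z : 'rV[R]_m => z *m g) x) z.
    by apply: (differentiable_ext (f := fun _ => g)) => [x|//]; rewrite jacobian_mulmx.
  have := lrelated_components j i l dA (uJ z) (rL z).
  rewrite !jacobian_mulmx => <-; rewrite -[LHS]addr0; congr (_ + _).
  by rewrite -[LHS](pdc (g j i) l z) /pd; apply: derive_scaler_eq => x; rewrite jacobian_mulmx.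
- have := lrelated_components j i l (differentiable_cst h z) (uJ z) (rK z).
  by rewrite !jacobian_mulmx pdc addr0.
- have w'E : jmap (fun z : 'rV[R]_m => z *m g) (fun _ => h) (0, y, v) = (0, y *m h, u).
    apply: etrans (jmapE _ y v (differentiable_cst h _)) _.
    rewrite mul0mx jacobian_mulmx (_ : dmx _ _ _ = 0) ?addr0 -?guv ?mulKmx //.
    by apply/matrixP => a' b'; rewrite !mxE big1 // => p _; rewrite pdc mulr0.
  have := transport_law_h sf sA uJ (rG (0, y, v)) a l i; rewrite w'E /=.
  rewrite [X in X + _ = _ -> _]big1 ?add0r; last first.
    move=> l' _; rewrite (_ : pd a _ _ = 0) ?mul0r //.
    by rewrite -(pdc (g l l') a 0) /pd; apply: derive_scaler_eq => x; exact: pd_mulmx.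
  under eq_bigr do (rewrite pd_mulmx; under eq_bigr do rewrite pd_mulmx).
  under [X in X = _ -> _]eq_bigr do
    (rewrite [X in _ * (_ + X)]big1 ?addr0; [|by move=> j' _; rewrite big1 ?mul0r // => p _; rewrite pdc mulr0]).
  move=> ->; rewrite [X in _ + X]big1 ?addr0; last first.
    move=> p _; rewrite (_ : pd a _ _ = 0) ?mulr0 //.
    by rewrite -(pdc 0 a 0) /pd; apply: derive_scaler_eq => x; exact: pdc.
  by apply: eq_bigr => p _; rewrite pdc mulr0 addr0.
- have w'E : jmap (fun z : 'rV[R]_m => z *m g) (fun _ => h) (0, y, v) = (0, y *m h, u).
    apply: etrans (jmapE _ y v (differentiable_cst h _)) _.
    rewrite mul0mx jacobian_mulmx (_ : dmx _ _ _ = 0) ?addr0 -?guv ?mulKmx //.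
    by apply/matrixP => a' b'; rewrite !mxE big1 // => p _; rewrite pdc mulr0.
  have := transport_law_v sf sA uJ (rG (0, y, v)) q l i; rewrite w'E /= pdc addr0.
  by under eq_bigr do rewrite pd_mulmx.
Qed.

End LinearChange.

(** * Weighted homogeneous smooth functions *)

Section Homogeneous.
Variable R : realType.

(** Scalings are available for nonzero factors only; continuity supplies the identity
at zero. *)
Lemma continuous_eq_off0 (f g : R^o -> R^o) : {for 0, continuous f} -> {for 0, continuous g} ->
  (forall c, c != 0 -> f c = g c) -> f = g.
Proof.
move=> cf cg fg; apply/funext => c; have [->|c0] := eqVneq c 0; last exact: fg.
have cf' : f x @[x --> 0^'] --> f 0 by move/continuous_withinNx: cf.
have cg' : g x @[x --> 0^'] --> g 0 by move/continuous_withinNx: cg.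
have E : f x @[x --> 0^'] --> g 0.
  apply: cvg_trans cg'; apply: near_eq_cvg; near=> x; apply/esym/fg.
  by near: x; exact: nbhs_dnbhs_neq.
exact: (norm_cvg_unique cf' E).
Unshelve. all: by end_near. Qed.

Lemma differentiable_exprn (k : nat) (c : R^o) : differentiable (fun c : R^o => c ^+ k : R^o) c.
Proof. by have /derivable1_diffP := @exprn_derivable R k c 1. Qed.

Lemma derive_monom (k : nat) (x : R) (c : R^o) :
  'D_1 (fun c : R^o => c ^+ k * x : R^o) c = k%:R * c ^+ k.-1 * x.
Proof.
rewrite derive_scalarM //; last exact: differentiable_exprn.
rewrite derive_cst mulr0 addr0; congr (_ * _).
by apply: etrans (@exp_derive R k c 1) _; rewrite /GRing.scale /= mulr1.
Qed.

Lemma differentiable_monom (k : nat) (x : R) (c : R^o) :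
  differentiable (fun c : R^o => c ^+ k * x : R^o) c.
Proof.
by apply: differentiableM => //; exact: differentiable_exprn.
Qed.

Variables (W : normedModType R) (T : finType) (e : T -> W) (w : T -> nat).
Hypothesis w1 : forall t, (0 < w t)%N.
Variables (H : W -> R^o).
Hypothesis sH : smooth_on setT H.
Variables (x : T -> R) (a : R).

(** Orbit of the point with coordinates x under the weighted homotheties with weights
w. *)
Definition curve (c : R) : W := \sum_t (c ^+ w t * x t) *: e t.

Let curve0 : curve 0 = 0.
Proof. by rewrite /curve big1 // => t _; rewrite expr0n gtn_eqF // mul0r scale0r. Qed.

Let dcurve g : smooth_on setT g -> forall c : R^o,
  differentiable (fun c : R^o => g (curve c) : R^o) c /\
  'D_1 (fun c : R^o => g (curve c) : R^o) c
  = \sum_t (w t)%:R * c ^+ (w t).-1 * x t * 'D_(e t) g (curve c).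
Proof.
move=> sg c; have dm t := differentiable_monom (w t) (x t).
have E c' : g (curve c') = g (0 + \sum_t (c' ^+ w t * x t) *: e t) by rewrite add0r.
have dg z : differentiable g z := smooth_differentiable sg I.
split.
  apply: (differentiable_ext (f := fun c' : R^o => g (0 + \sum_t (c' ^+ w t * x t) *: e t))) => [c'|].
    by rewrite E.
  apply: differentiable_comp (dg _).
  by apply: (@differentiable_lincomb R R^o W T 0 e (fun t (c' : R^o) => c' ^+ w t * x t : R^o)) => t; exact: dm.
rewrite (derive_scaler_eq (g := fun c' : R^o => g (0 + \sum_t (c' ^+ w t * x t) *: e t))); last exact: E.
rewrite (@derive_comp_lincomb R R^o W T 0 e (fun t (c' : R^o) => c' ^+ w t * x t : R^o) g c 1) //.
by apply: eq_bigr => t _; rewrite derive_monom add0r.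
Qed.

Let cont (f : R^o -> R^o) : differentiable f 0 -> {for 0, continuous f}.
Proof. exact: differentiable_continuous. Qed.

(** A smooth function that is homogeneous of degree one along a curve of positive
weights is found by one differentiation at c = 0, where every coordinate of weight
greater than one has zero velocity. *)
Lemma homogeneous1 : (forall c, c != 0 -> H (curve c) = c * a) ->
  a = \sum_(t | w t == 1) x t * 'D_(e t) H 0.
Proof.
move=> Ha; have E : (fun c : R^o => H (curve c)) = (fun c : R^o => c ^+ 1 * a).
  apply: continuous_eq_off0 => [||c c0]; last by rewrite Ha // expr1.
  - by apply: cont; have [] := dcurve sH 0.
  - by apply: cont; exact: differentiable_monom.
have [_] := dcurve sH 0; rewrite E derive_monom expr0 !mul1r => ->.
rewrite [RHS]big_mkcond /=; apply: eq_bigr => t _; rewrite curve0.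
by case: (w t) (w1 t) => [//|[|k]] _; rewrite /= ?expr0 ?mul1r // expr0n /= mulr0 !mul0r.
Qed.

(** As for degree one, with two differentiations; now a coordinate of weight two
contributes linearly and those of weight one quadratically. *)
Lemma homogeneous2 : (forall c, c != 0 -> H (curve c) = c ^+ 2 * a) ->
  a = \sum_(t | w t == 2) x t * 'D_(e t) H 0
    + \sum_(t | w t == 1) \sum_(u | w u == 1) x t * x u * (2^-1 * 'D_(e u) ('D_(e t) H) 0).
Proof.
move=> Ha; have E : (fun c : R^o => H (curve c)) = (fun c : R^o => c ^+ 2 * a).
  apply: continuous_eq_off0 => [||c c0]; last by rewrite Ha.
  - by apply: cont; have [] := dcurve sH 0.
  - by apply: cont; exact: differentiable_monom.
have E1 (c : R^o) : \sum_t ((c ^+ (w t).-1 * ((w t)%:R * x t)) * 'D_(e t) H (curve c)) = c ^+ 1 * (2 * a).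
  have [_] := dcurve sH c; rewrite E derive_monom /= expr1 => e2.
  transitivity (2%:R * c * a); last by ring.
  by rewrite e2; apply: eq_bigr => t _; ring.
have : 'D_1 (fun c : R^o => \sum_t ((c ^+ (w t).-1 * ((w t)%:R * x t)) * 'D_(e t) H (curve c)) : R^o) 0 = 2 * a.
  by rewrite (derive_scaler_eq _ _ E1) derive_monom expr0 mulr1 mul1r.
have dm t := differentiable_monom (w t).-1 ((w t)%:R * x t).
have sD t := smooth_derive (e t) sH.
rewrite (derive_sumM (F := fun t (c : R^o) => c ^+ (w t).-1 * ((w t)%:R * x t) : R^o)
  (G := fun t (c : R^o) => 'D_(e t) H (curve c) : R^o)); [|by move=> t; exact: dm|by move=> t; exact: (dcurve (sD t) 0).1].
move=> e2; apply: (mulfI (x := 2)); first by rewrite pnatr_eq0.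
rewrite -e2 mulrDr big_split /=; congr (_ + _).
  rewrite [X in 2 * X]big_mkcond mulr_sumr /=; apply: eq_bigr => t _; rewrite derive_monom curve0.
  case: (w t) (w1 t) => [//|[|[|k]]] _ /=; rewrite ?mul0r ?mulr0 ?expr0 ?mul1r ?mulr1 ?mulrA //.
  by rewrite expr0n /= !mulr0 !mul0r.
rewrite mulr_sumr [RHS]big_mkcond /=; apply: eq_bigr => t _.
rewrite (dcurve (sD t) 0).2 curve0.
case: (w t) (w1 t) => [//|[|k]] _ /=; last by rewrite expr0n /= !mul0r.
rewrite expr0 !mul1r mulr_sumr mulr_sumr [RHS]big_mkcond /=; apply: eq_bigr => u _.
case: (w u) (w1 u) => [//|[|k]] _ /=; last by rewrite expr0n /= !mulr0 !mul0r mulr0.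
rewrite expr0 !mul1r; move: ('D_(e u) _ _ : R) => D.
by field.
Qed.

End Homogeneous.

(** * Polynomial form of the rule at the origin *)

Section JetScaling.
Variables (R : realType) (m : nat).

Definition dirs s (al : midx m s) : seq 'rV[R]_m :=
  flatten [seq nseq (val al l) (delta_mx 0 l) | l <- enum 'I_m].

Lemma mpd_dirs s (al : midx m s) (f : 'rV[R]_m -> R^o) :
  mpd al f = foldr (fun v g => 'D_v g) f (dirs al).
Proof.
rewrite /mpd /dirs; elim: (enum 'I_m) => //= l ls ->.
rewrite foldr_cat; elim: (val al l : nat) => //= k ->.
by [].
Qed.

Lemma size_dirs s (al : midx m s) : size (dirs al) = (\sum_l val al l)%N.
Proof.
rewrite /dirs size_flatten /shape -map_comp sumnE big_map -big_enum /=.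
by apply: eq_bigr => l _; rewrite size_nseq.
Qed.

Lemma derive_scaled (f : 'rV[R]_m -> R^o) c (vs : seq 'rV[R]_m) : smooth_on setT f ->
  foldr (fun v g => 'D_v g) (fun x => c * f (c *: x) : R^o) vs
  = fun x => c ^+ (size vs).+1 * foldr (fun v g => 'D_v g) f vs (c *: x).
Proof.
move=> sf; elim: vs => [|v vs IH] /=; first by apply/funext => x; rewrite expr1.
rewrite IH; apply/funext => x; set g := foldr _ _ _.
have dg z : differentiable g z by exact: (sf vs).
have ll : linear ( *:%R c : 'rV[R]_m -> 'rV[R]_m).
  by move=> k u w; rewrite scalerDr !scalerA mulrC.
have cl : continuous ( *:%R c : 'rV[R]_m -> 'rV[R]_m) by exact: scaler_continuous.
have dgc := lin_comp_differentiable ll cl (dg (c *: x)).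
rewrite derive_scalarM // derive_cst mul0r add0r [in RHS]exprSr -mulrA; congr (_ * _).
rewrite (lin_comp_derive ll cl) // !deriveE //.
by rewrite linearZ.
Qed.

(** Under z |-> c z a partial derivative of order j picks up the factor c^j, and the
components of a connection carry one more factor c for their lower base index. *)
Lemma jet_scaled k s (K K' : lcomp R m k) c : smooth_comps K ->
  (forall z j i l, K' z j i l = c * K (c *: z) j i l) ->
  jet s K' 0 = \row_t (c ^+ (\sum_l val (enum_val t : jet_idx m k s).1 l).+1 * jet s K 0 0 t).
Proof.
move=> sK KK; apply/rowP => t; rewrite !mxE /=.
set q := enum_val t.
have -> : (fun x => K' x q.2.1.1 q.2.1.2 q.2.2) = (fun x => c * K (c *: x) q.2.1.1 q.2.1.2 q.2.2).
  by apply/funext => x; rewrite KK.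
by rewrite !mpd_dirs (derive_scaled c _ (sK q.2.1.1 q.2.1.2 q.2.2)) scaler0 size_dirs.
Qed.

End JetScaling.

Section PolyForm.
Variables (R : realType) (m n s r : nat) (Gam : rule R m n).
Hypothesis ordG : of_order s r Gam.
Hypothesis natG : commutes_with_local_isos Gam.
Local Notation E0 := (flat R m n).
Local Notation G := (Gam0 Gam).
Local Notation W := ('rV[R]_#|jet_idx m m s| * 'rV[R]_#|jet_idx m n r|)%type.

Lemma sum_scalar p (c : R) (F : 'I_p -> R) l : \sum_k (c%:M : 'M[R]_p) l k * F k = c * F l.
Proof.
rewrite (bigD1 l) //= mxE eqxx big1 ?addr0 // => k kl.
by rewrite mxE eq_sym (negPf kl) mul0r.
Qed.

Lemma sum_scalar_r p (c : R) (F : 'I_p -> R) l : \sum_k F k * (c%:M : 'M[R]_p) k l = c * F l.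
Proof.
rewrite (bigD1 l) //= mxE eqxx big1 ?addr0 1?mulrC // => k kl.
by rewrite mxE (negPf kl) mulr0.
Qed.

Lemma scaling (L : classical_connection E0) (K : linear_connection E0) (c h : R) :
  c != 0 -> h != 0 ->
  exists (L0 : classical_connection E0) (K0 : linear_connection E0),
  [/\ forall z j i l, L0 tt z j i l = c * L tt (c *: z) j i l,
      forall z j i l, K0 tt z j i l = c * K tt (c *: z) j i l,
      forall y v a l i, c ^+ 2 * G L K (h *: y) ((c^-1 * h) *: v) (inl a) i l = h * G L0 K0 y v (inl a) i l
    & forall y v q l i, c * G L K (h *: y) ((c^-1 * h) *: v) (inr q) i l = G L0 K0 y v (inr q) i l].
Proof.
move=> c0 h0.
have uc : (c%:M : 'M[R]_m) \in unitmx by rewrite unitmxE det_scalar unitfE expf_neq0.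
have uh : (h%:M : 'M[R]_n) \in unitmx by rewrite unitmxE det_scalar unitfE expf_neq0.
have [L0 [K0 [HL HK Hh Hv]]] := linear_change natG L K uc uh.
have guv (v : 'M[R]_(m, n)) : c%:M *m ((c^-1 * h) *: v) = v *m h%:M.
  by rewrite mul_scalar_mx scalerA mulrA divff // mul1r mul_mx_scalar.
exists L0, K0; split=> [z j i l|z j i l|y v a l i|y v q l i].
- have := HL z j i l; rewrite sum_scalar_r !sum_scalar mul_mx_scalar.
  by move/(mulfI c0).
- have := HK z j i l; rewrite sum_scalar_r !sum_scalar mul_mx_scalar mulrCA.
  by move/(mulfI h0).
- have := Hh y v _ (guv v) a l i.
  by rewrite sum_scalar_r !sum_scalar mul_mx_scalar mulrA -expr2.
have := Hv y v _ (guv v) q l i.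
by rewrite sum_scalar_r !sum_scalar mul_mx_scalar mulrCA => /(mulfI h0).
Qed.

Definition jets (L : classical_connection E0) (K : linear_connection E0) : W :=
  (jet s (L tt) 0, jet r (K tt) 0).

Definition jet_coord : finType := ('I_#|jet_idx m m s| + 'I_#|jet_idx m n r|)%type.
Definition jet_basis (t : jet_coord) : W :=
  match t with inl t => (delta_mx 0 t, 0) | inr t => (0, delta_mx 0 t) end.
(** A partial derivative of order j of a component has weight j + 1. *)
Definition jet_weight (t : jet_coord) : nat :=
  match t with inl t => (\sum_l val (enum_val t : jet_idx m m s).1 l).+1
             | inr t => (\sum_l val (enum_val t : jet_idx m n r).1 l).+1 end.
Definition jet_value (j : W) (t : jet_coord) : R :=
  match t with inl t => j.1 0 t | inr t => j.2 0 t end.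

(** The homothety of the base moves the jets at the origin along a weighted curve, to
which the homogeneity lemmas apply. *)
Lemma jets_curve (L L0 : classical_connection E0) (K K0 : linear_connection E0) c :
  (forall z j i l, L0 tt z j i l = c * L tt (c *: z) j i l) ->
  (forall z j i l, K0 tt z j i l = c * K tt (c *: z) j i l) ->
  jets L0 K0 = curve jet_basis jet_weight (jet_value (jets L K)) c.
Proof.
have sL : smooth_comps (L tt) by move=> j i l; have := @cc_smooth _ _ _ _ L tt j i l; rewrite flat_img.
have sK : smooth_comps (K tt) by move=> j i l; have := @lc_smooth _ _ _ _ K tt j i l; rewrite flat_img.
move=> HL HK; rewrite /jets (jet_scaled s sL HL) (jet_scaled r sK HK).
set j := jets L K.
have sum1 (F : jet_coord -> W) : (\sum_t F t).1 = \sum_t (F t).1 by exact: (big_morph (fun z : W => z.1)).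
have sum2 (F : jet_coord -> W) : (\sum_t F t).2 = \sum_t (F t).2 by exact: (big_morph (fun z : W => z.2)).
rewrite [RHS]surjective_pairing /curve; congr (_, _).
  rewrite sum1 big_sumType /= [X in _ + X]big1 ?addr0; last by move=> t _; rewrite scaler0.
  rewrite {1}[LHS]row_sum_delta; apply: eq_bigr => t _; congr (_ *: _).
  by rewrite mxE.
rewrite sum2 big_sumType /= [X in X + _]big1 ?add0r; last by move=> t _; rewrite scaler0.
rewrite {1}[LHS]row_sum_delta; apply: eq_bigr => t _; congr (_ *: _).
by rewrite mxE.
Qed.

(** Index of a component of the pair of connections: of the classical one on the left,
of the linear one on the right. *)
Definition comp_idx : finType := ('I_m * 'I_m * 'I_m + 'I_n * 'I_n * 'I_m)%type.
Definition comp (L : lcomp R m m) (K : lcomp R m n) (t : comp_idx) : 'rV[R]_m -> R^o :=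
  match t with
  | inl q => fun x => L x q.1.1 q.1.2 q.2
  | inr q => fun x => K x q.1.1 q.1.2 q.2 end.

Definition jet_comp (t : jet_coord) : comp_idx :=
  match t with
  | inl t => inl (enum_val t : jet_idx m m s).2
  | inr t => inr (enum_val t : jet_idx m n r).2 end.

Lemma mpd0 q (al : midx m q) (f : 'rV[R]_m -> R^o) : (\sum_l val al l)%N = 0 -> mpd al f = f.
Proof. by move=> a0; rewrite mpd_dirs; have := size_dirs R al; rewrite a0; case: (dirs R al). Qed.

Lemma mpd1 q (al : midx m q) (f : 'rV[R]_m -> R^o) : (\sum_l val al l)%N = 1 ->
  exists k, forall f : 'rV[R]_m -> R^o, mpd al f = pd k f.
Proof.
move=> a1; have := size_dirs R al; rewrite a1 => sz.
have : exists k, dirs R al = [:: delta_mx 0 k :> 'rV[R]_m].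
  have mem v : v \in dirs R al -> exists k, v = delta_mx 0 k :> 'rV[R]_m.
    by move=> /flattenP [z /mapP [l _ ->]] /nseqP [-> _]; exists l.
  case: (dirs R al) sz mem => [//|v [|//]] _ mem.
  by have [k ->] := mem v (mem_head _ _); exists k.
by move=> [k ek]; exists k => g; rewrite mpd_dirs ek.
Qed.

Lemma jet_value_weight1 L K (t : jet_coord) : jet_weight t == 1 -> jet_value (jets L K) t = comp (L tt) (K tt) (jet_comp t) 0.
Proof.
case: t => t /= /eqP [] w0; rewrite !mxE /= mpd0 //.
Qed.

Lemma jet_value_weight2 (t : jet_coord) : jet_weight t == 2 ->
  exists k, forall L K, jet_value (jets L K) t = pd k (comp (L tt) (K tt) (jet_comp t)) 0.
Proof.
case: t => t /= /eqP [] w0.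
  have [k kE] := mpd1 (fun _ => 0) w0; exists k => L K.
  by rewrite mxE /= kE.
have [k kE] := mpd1 (fun _ => 0) w0; exists k => L K.
by rewrite mxE /= kE.
Qed.

Lemma sum_regroup (T T' : finType) (P : pred T) (g : T -> T') (X : T' -> R) (x d : T -> R) :
  (forall t, P t -> x t = X (g t)) ->
  \sum_(t | P t) x t * d t = \sum_t' X t' * \sum_(t | P t && (g t == t')) d t.
Proof.
move=> xX; rewrite (partition_big g predT) //=; apply: eq_bigr => t' _.
by rewrite mulr_sumr; apply: eq_bigr => t /andP [Pt /eqP <-]; rewrite xX.
Qed.

Lemma sum_weight1 (d : jet_coord -> R) : exists d' : comp_idx -> R, forall L K,
  \sum_(t | jet_weight t == 1) jet_value (jets L K) t * d t = \sum_t comp (L tt) (K tt) t 0 * d' t.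
Proof.
exists (fun t' => \sum_(t | (jet_weight t == 1) && (jet_comp t == t')) d t) => L K.
by apply: sum_regroup => t /jet_value_weight1.
Qed.

Lemma sum_weight2 (d : jet_coord -> R) : exists d' : 'I_m -> comp_idx -> R, forall L K,
  \sum_(t | jet_weight t == 2) jet_value (jets L K) t * d t
  = \sum_k \sum_t pd k (comp (L tt) (K tt) t) 0 * d' k t.
Proof.
have H (t : jet_coord) : exists k : option 'I_m, jet_weight t == 2 -> exists2 k', k = Some k' &
    forall L K, jet_value (jets L K) t = pd k' (comp (L tt) (K tt) (jet_comp t)) 0.
  have [w2|w2] := boolP (jet_weight t == 2); last by exists None.
  by have [k kE] := jet_value_weight2 w2; exists (Some k) => _; exists k.
have [kk kkP] := choice H.
pose X L K (q : option 'I_m * comp_idx) : R := if q.1 is Some k then pd k (comp (L tt) (K tt) q.2) 0 else 0.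
pose dd (q : option 'I_m * comp_idx) := \sum_(t | (jet_weight t == 2) && ((kk t, jet_comp t) == q)) d t.
exists (fun k t => dd (Some k, t)) => L K.
rewrite (sum_regroup (g := fun t => (kk t, jet_comp t)) (X := X L K)); last first.
  by move=> t /kkP [k' kE ->]; rewrite /X /= kE.
rewrite -(pair_bigA _ (fun k t => X L K (k, t) * dd (k, t))) /= (bigD1 None) //= big1 ?add0r.
  rewrite (reindex_omap Some id) /=; last by case.
  by apply: eq_bigl => k; rewrite eqxx.
by move=> t _; rewrite /X /= mul0r.
Qed.

Section Fibres.

Let emb (j : W) : jco R m n * W := (0, j).
Let emb_linear : linear emb.
Proof. by move=> k u v; rewrite /emb; congr (_, _); rewrite /= scaler0 addr0. Qed.
Let emb_continuous : continuous emb.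
Proof.
move=> j.
exact: (@cvg_pair W (jco R m n) W (nbhs j) (nbhs (0 : jco R m n)) (nbhs j) _ _ _ (fun _ => 0) id (cvg_cst _) cvg_id).
Qed.

Lemma smooth_emb (H : jco R m n * W -> R^o) : smooth_on setT H -> smooth_on setT (fun j => H (emb j)).
Proof.
move=> sH; have oT : open [set: jco R m n * W] := openT.
by have := lin_comp_smooth emb_linear emb_continuous oT sH; rewrite preimage_setT.
Qed.

(** A smooth function that is homogeneous of degree one along a line coincides with
its derivative at the origin of the line. *)
Lemma linear_of_homogeneous (H : jco R m n * W -> R^o) z0 e a : smooth_on setT H ->
  (forall k : R, k != 0 -> H (z0 + k *: e) = k * a) -> a = 'D_e H z0.
Proof.
move=> sH Ha.
have dH z : differentiable H z := smooth_differentiable sH I.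
have dk c : differentiable (fun k : R^o => k : R^o) c by [].
have sE k : \sum_(t : unit) k *: e = k *: e by rewrite big_const /= card_unit /= addr0.
have dphi : differentiable (fun k : R^o => H (z0 + \sum_(t : unit) k *: e) : R^o) 0.
  apply: differentiable_comp (dH _).
  by apply: (@differentiable_lincomb R R^o _ unit z0 (fun _ => e) (fun _ k => k)).
have E : (fun k : R^o => H (z0 + \sum_(t : unit) k *: e) : R^o) = (fun k => k ^+ 1 * a).
  apply: continuous_eq_off0 => [||k k0].
  - exact: differentiable_continuous.
  - by apply: differentiable_continuous; exact: differentiable_monom.
  by rewrite sE Ha // expr1.
have := @derive_comp_lincomb R R^o _ unit z0 (fun _ => e) (fun _ k => k) H 0 1 (fun _ => dk 0) (dH _).
rewrite E derive_monom expr0 !mul1r => ->.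
rewrite sE scale0r addr0 big_const /= card_unit /= addr0.
by rewrite derive_id mul1r.
Qed.

Lemma const_of_homogeneous (H : jco R m n * W -> R^o) z0 e a : smooth_on setT H ->
  (forall k : R, k != 0 -> H (z0 + k *: e) = a) -> a = H z0.
Proof.
move=> sH Ha.
have dH z : differentiable H z := smooth_differentiable sH I.
have E : (fun k : R^o => H (z0 + k *: e) : R^o) = (fun k => a).
  apply: continuous_eq_off0 => //; last exact: cst_continuous.
  apply: differentiable_continuous; apply: differentiable_comp (dH _).
  apply: differentiableD => //; exact: differentiableZl.
by have := f_equal (fun f => f 0) E; rewrite /= scale0r addr0.
Qed.

End Fibres.

(** The smooth function is taken from the order hypothesis for the trivial bundle; the
jets of all orders are still present. *)
Lemma jet_determined A i l : exists F : jco R m n * W -> R^o,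
  smooth_on setT F /\ forall L K y v, G L K y v A i l = F (0, y, v, jets L K).
Proof.
have [F [sF FE]] := ordG (E := E0) tt A i l.
rewrite flat_img in sF; exists F; split=> // L K y v.
by rewrite /Gam0 FE // flat_img.
Qed.

(** The homothety h of the fibre leaves every linear connection invariant, so the rule
has degree one in (y, v) on the base directions and degree zero on the fibre
directions. *)
Lemma fibre_scaling L K h y v i l : h != 0 ->
  (forall a, G L K (h *: y) (h *: v) (inl a) i l = h * G L K y v (inl a) i l) /\
  (forall q, G L K (h *: y) (h *: v) (inr q) i l = G L K y v (inr q) i l).
Proof.
move=> h0; have [L0 [K0 [HL HK Hh Hv]]] := scaling L K (oner_neq0 R) h0.
have jE : jets L0 K0 = jets L K.
  rewrite /jets; congr (jet _ _ _, jet _ _ _).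
    by apply/funext => z; apply/funext => j; apply/funext => p; apply/funext => q; rewrite HL mul1r scale1r.
  by apply/funext => z; apply/funext => j; apply/funext => p; apply/funext => q; rewrite HK mul1r scale1r.
have GE A : G L0 K0 y v A i l = G L K y v A i l.
  by have [F [_ FE]] := jet_determined A i l; rewrite !FE jE.
split=> a; first by have := Hh y v a l i; rewrite invr1 expr1n !mul1r GE.
by have := Hv y v a l i; rewrite invr1 !mul1r GE.
Qed.

(** Degree zero in (y, v) makes the component constant in these variables, and the
homothety of the base makes it homogeneous of degree one in the jets: only values
of the connections survive. *)
Lemma ver_polynomial q i l : exists d : comp_idx -> R, forall L K y v,
  G L K y v (inr q) i l = \sum_t comp (L tt) (K tt) t 0 * d t.
Proof.
have [F [sF FE]] := jet_determined (inr q) i l.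
have [d dE] := sum_weight1 (fun t => 'D_(jet_basis t) (fun j => F (0, j)) 0).
exists d => L K y v; rewrite -dE.
have yv0 : G L K y v (inr q) i l = G L K 0 0 (inr q) i l.
  rewrite [RHS]FE; apply: (const_of_homogeneous (e := ((0, y, v), 0) : jco R m n * W)) => // k k0.
  have [_ /(_ q) <-] := fibre_scaling L K y v i l k0.
  rewrite FE; congr F.
  transitivity ((0 + k *: 0 : 'rV[R]_m, 0 + k *: y, 0 + k *: v), jets L K + k *: (0 : W)) => //.
  by rewrite !scaler0 !addr0 !add0r.
rewrite yv0 FE.
apply: (homogeneous1 (w := jet_weight)).
- by case.
- exact: smooth_emb.
move=> c c0.
have [L0 [K0 [HL HK _ Hv]]] := scaling L K c0 (oner_neq0 R).
have E1 L1 K1 : F (0, jets L1 K1) = G L1 K1 0 0 (inr q) i l by rewrite FE.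
by rewrite -(jets_curve HL HK) !E1 -Hv !scaler0.
Qed.

(** Degree one in (y, v) makes the component linear in these variables.  The base
homothety then gives weight two to the coefficient of y and weight one to that of
v, since v itself scales inversely to the base. *)
Lemma hor_polynomial k i l : exists (al : 'I_m * 'I_n -> comp_idx -> R) (be : 'I_n -> comp_idx -> comp_idx -> R)
    (ga : 'I_n -> 'I_m -> comp_idx -> R), forall L K y v,
  G L K y v (inl k) i l
  = \sum_p y 0 p * (\sum_a \sum_t pd a (comp (L tt) (K tt) t) 0 * ga p a t
                    + \sum_t \sum_u comp (L tt) (K tt) t 0 * comp (L tt) (K tt) u 0 * be p t u)
  + \sum_q v q.1 q.2 * \sum_t comp (L tt) (K tt) t 0 * al q t.
Proof.
have [F [sF FE]] := jet_determined (inl k) i l.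
pose ey (p : 'I_n) : jco R m n * W := ((0, delta_mx 0 p, 0), 0).
pose ev (q : 'I_m * 'I_n) : jco R m n * W := ((0, 0, delta_mx q.1 q.2), 0).
pose Hy p (j : W) : R^o := 'D_(ey p) F (0, j).
pose Hv q (j : W) : R^o := 'D_(ev q) F (0, j).
have dF z : differentiable F z := smooth_differentiable sF I.
have lin L K y v : G L K y v (inl k) i l =
    \sum_p y 0 p * Hy p (jets L K) + \sum_q v q.1 q.2 * Hv q (jets L K).
  have -> : G L K y v (inl k) i l = 'D_((0, y, v), 0) F (0, jets L K).
    apply: linear_of_homogeneous => // h h0.
    have [/(_ k) <- _] := fibre_scaling L K y v i l h0.
    rewrite FE; congr F.
    transitivity ((0 + h *: 0 : 'rV[R]_m, 0 + h *: y, 0 + h *: v), jets L K + h *: (0 : W)) => //.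
    by rewrite !scaler0 !addr0 !add0r.
  have -> : ((0, y, v), 0) = \sum_p y 0 p *: ey p + \sum_q v q.1 q.2 *: ev q :> jco R m n * W.
    have -> : \sum_p y 0 p *: ey p = ((0, y, 0), 0) :> jco R m n * W.
      rewrite {2}[y]row_sum_delta; elim/big_rec2: _ => // p y1 y2 _ ->.
      by congr ((_, _, _), _); rewrite /= ?scaler0 ?addr0.
    have -> : \sum_q v q.1 q.2 *: ev q = ((0, 0, v), 0) :> jco R m n * W.
      rewrite {2}[v]mx_lincomb add0r; elim/big_rec2: _ => // p y1 y2 _ ->.
      by congr ((_, _, _), _); rewrite /= ?scaler0 ?addr0.
    by congr ((_, _, _), _); rewrite /= ?addr0 ?add0r.
  rewrite deriveE // linearD !linear_sum; congr (_ + _); apply: eq_bigr => p _;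
    by rewrite linearZ /= /Hy /Hv deriveE.
have hom_y p L K (c : R) : c != 0 -> Hy p (curve jet_basis jet_weight (jet_value (jets L K)) c) = c ^+ 2 * Hy p (jets L K).
  move=> c0; have E L1 K1 : Hy p (jets L1 K1) = G L1 K1 (delta_mx 0 p) 0 (inl k) i l.
    rewrite lin [X in _ + X]big1 ?addr0; last by move=> q _; rewrite mxE mul0r.
    rewrite (bigD1 p) //= mxE !eqxx mul1r big1 ?addr0 // => q qp.
    by rewrite mxE eqxx (negPf qp) mul0r.
  have [L0 [K0 [HL HK Hh _]]] := scaling L K c0 (oner_neq0 R).
  rewrite -(jets_curve HL HK) !E.
  by have := Hh (delta_mx 0 p) 0 k l i; rewrite scale1r scaler0 mul1r => ->.
have hom_v q L K (c : R) : c != 0 -> Hv q (curve jet_basis jet_weight (jet_value (jets L K)) c) = c * Hv q (jets L K).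
  move=> c0; have E L1 K1 : Hv q (jets L1 K1) = G L1 K1 0 (delta_mx q.1 q.2) (inl k) i l.
    rewrite lin [X in X + _]big1 ?add0r; last by move=> p _; rewrite mxE mul0r.
    rewrite (bigD1 q) //= mxE !eqxx mul1r big1 ?addr0 // => q' qp.
    rewrite mxE (_ : (_ && _) = false) ?mul0r //.
    by apply/negP => /andP [/eqP e1 /eqP e2]; move/eqP: qp; apply; rewrite [q']surjective_pairing e1 e2 -surjective_pairing.
  have [L0 [K0 [HL HK Hh _]]] := scaling L K c0 (oner_neq0 R).
  rewrite -(jets_curve HL HK) !E.
  have := Hh 0 (c *: delta_mx q.1 q.2) k l i.
  rewrite scaler0 mulr1 scalerA mulVf // scale1r mul1r.
  have lin2 : G L0 K0 0 (c *: delta_mx q.1 q.2) (inl k) i l = c * G L0 K0 0 (delta_mx q.1 q.2) (inl k) i l.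
    by have [/(_ k) <- _] := fibre_scaling L0 K0 0 (delta_mx q.1 q.2) i l c0; rewrite scaler0.
  by rewrite lin2 expr2 -mulrA => /(mulfI c0).
have jw1 t : (0 < jet_weight t)%N by case: t.
have sHy p : smooth_on setT (Hy p) by exact: (smooth_emb (H := 'D_(ey p) F) (smooth_derive (ey p) sF)).
have sHv q : smooth_on setT (Hv q) by exact: (smooth_emb (H := 'D_(ev q) F) (smooth_derive (ev q) sF)).
have /choice [al alE] q : exists d : comp_idx -> R, forall L K, Hv q (jets L K) = \sum_t comp (L tt) (K tt) t 0 * d t.
  have [d dE] := sum_weight1 (fun t => 'D_(jet_basis t) (Hv q) 0); exists d => L K.
  by rewrite -dE; apply: homogeneous1 => // c; exact: hom_v.
have /choice [gb gbE] p : exists d : ('I_m -> comp_idx -> R) * (comp_idx -> comp_idx -> R), forall L K, Hy p (jets L K) =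
    \sum_a \sum_t pd a (comp (L tt) (K tt) t) 0 * d.1 a t
    + \sum_t \sum_u comp (L tt) (K tt) t 0 * comp (L tt) (K tt) u 0 * d.2 t u.
  have [d1 d1E] := sum_weight2 (fun t => 'D_(jet_basis t) (Hy p) 0).
  have /choice [d2 d2E] (t : jet_coord) := sum_weight1 (fun u => 2^-1 * 'D_(jet_basis u) ('D_(jet_basis t) (Hy p)) 0).
  have /choice [d3 d3E] (u : comp_idx) := sum_weight1 (fun t => d2 t u).
  exists (d1, fun t u => d3 u t) => L K /=; rewrite -d1E.
  have := homogeneous2 jw1 (sHy p) (x := jet_value (jets L K)) (e := jet_basis) (a := Hy p (jets L K)).
  move=> -> => [|c c0]; last exact: hom_y.
  congr (_ + _); rewrite [RHS]exchange_big /=.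
  transitivity (\sum_(t | jet_weight t == 1) jet_value (jets L K) t * \sum_u comp (L tt) (K tt) u 0 * d2 t u).
    apply: eq_bigr => t _; rewrite -d2E mulr_sumr.
    by apply: eq_bigr => u _; rewrite mulrA.
  transitivity (\sum_u comp (L tt) (K tt) u 0 * \sum_(t | jet_weight t == 1) jet_value (jets L K) t * d2 t u).
    under eq_bigr do rewrite mulr_sumr.
    under [RHS]eq_bigr do rewrite mulr_sumr.
    rewrite [LHS]exchange_big /=; apply: eq_bigr => u _; apply: eq_bigr => t _.
    by rewrite mulrCA.
  apply: eq_bigr => u _; rewrite d3E mulr_sumr; apply: eq_bigr => t _.
  by rewrite mulrA (mulrC (comp _ _ u 0)).
exists al, (fun p => (gb p).2), (fun p => (gb p).1) => L K y v.
rewrite lin; congr (_ + _); apply: eq_bigr => p _; first by rewrite gbE.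
by rewrite alE.
Qed.

End PolyForm.

(** * First fundamental theorem for the general linear group *)

Section FFT.
Variables (R : numFieldType) (m k : nat).
Local Notation X := {ffun 'I_k -> 'I_m}.
Local Notation S := {perm 'I_k}.

Definition permute (s : S) (x : X) : X := [ffun i => x (s i)].

Lemma permuteM s t x : permute s (permute t x) = permute (s * t)%g x.
Proof. by apply/ffunP => i; rewrite !ffunE permM. Qed.

Lemma permute1 x : permute 1%g x = x.
Proof. by apply/ffunP => i; rewrite ffunE perm1. Qed.

Lemma permuteK s : cancel (permute s) (permute s^-1%g).
Proof. by move=> x; rewrite permuteM mulVg permute1. Qed.

Lemma permuteKV s : cancel (permute s^-1%g) (permute s).
Proof. by move=> x; rewrite permuteM mulgV permute1. Qed.

Definition perm_mx_entry (s : S) (x y : X) : R := (y == permute s x)%:R.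

Definition commutes (C M : X -> X -> R) := forall a b, \sum_z C a z * M z b = \sum_z M a z * C z b.

Definition invariant_mx (M : X -> X -> R) := forall s a b, M (permute s a) (permute s b) = M a b.

(** A linear projector of the space of matrices onto the span of the permutation
matrices, written in coordinates. *)
Lemma span_projector : exists w0 : S -> X -> X -> R, forall t x y,
  \sum_s (\sum_a \sum_b w0 s a b * perm_mx_entry t a b) * perm_mx_entry s x y = perm_mx_entry t x y.
Proof.
pose B : 'M[R]_(#|{: S}|, #|{: X * X}|) :=
  \matrix_(i, j) perm_mx_entry (enum_val i) (enum_val j).1 (enum_val j).2.
exists (fun s a b => pinvmx B (enum_rank (a, b)) (enum_rank s)) => t x y.
have E := mulmxKpV (submx_refl B).
have : (B *m pinvmx B *m B) (enum_rank t) (enum_rank (x, y)) = B (enum_rank t) (enum_rank (x, y)).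
  by rewrite E.
rewrite mxE [RHS]mxE !enum_rankK /= => <-.
rewrite (reindex (@enum_val S (mem predT))) /=; last first.
  by exists enum_rank => i _; [rewrite enum_valK|rewrite enum_rankK].
apply: eq_bigr => i _; rewrite [B _ _]mxE enum_rankK /=; congr (_ * _).
rewrite enum_valK mxE pair_big /=.
rewrite (reindex (@enum_val (X * X)%type (mem predT))) /=; last first.
  by exists enum_rank => j _; [rewrite enum_valK|rewrite enum_rankK].
apply: eq_bigr => j _; rewrite [B _ _]mxE enum_rankK mulrC.
by rewrite -surjective_pairing enum_valK.
Qed.

Lemma card_perm_neq0 : #|{: S}|%:R != 0 :> R.
Proof. by rewrite pnatr_eq0 -lt0n; apply/card_gt0P; exists 1%g. Qed.

(** Averaging the projector over the group gives invariant matrices P i j whose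
partial traces are a resolution of the identity.  Moving C across them writes C a
j through permutation matrices only.  The coefficients depend linearly on C
through the fixed functional w, so families C depending on further indices are
treated uniformly. *)
Lemma double_commutant : exists w : S -> X -> X -> R, forall C : X -> X -> R,
  (forall M, invariant_mx M -> commutes C M) ->
  forall a b, C a b = \sum_s (\sum_x \sum_y w s x y * C x y) * perm_mx_entry s a b.
Proof.
have [w0 w0P] := span_projector.
pose w (s : S) x y := #|{: S}|%:R^-1 * \sum_(t : S) w0 (s * t^-1)%g (permute t x) y.
exists w => C CC a j.
pose P i j (z b : X) := #|{: S}|%:R^-1 * \sum_(t : S) \sum_s w0 s (permute t b) i * perm_mx_entry s (permute t z) j.
have invP i l : invariant_mx (P i l).
  move=> s z b; congr (_ * _); rewrite [RHS](reindex_inj (mulIg s)) /=.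
  by apply: eq_bigr => t _; rewrite !permuteM.
have P1 z l : \sum_i P i l z i = (z == l)%:R.
  rewrite /P -mulr_sumr exchange_big /=.
  transitivity (#|{: S}|%:R^-1 * \sum_(t : S) (z == l)%:R : R).
    congr (_ * _); apply: eq_bigr => t _.
    transitivity (perm_mx_entry t^-1%g (permute t z) l); last by rewrite /perm_mx_entry permuteK eq_sym.
    rewrite -w0P exchange_big /=; apply: eq_bigr => s _.
    rewrite -mulr_suml; congr (_ * _).
    rewrite (reindex (permute t^-1%g)) /=; last first.
      by exists (permute t) => x _; [rewrite permuteKV|rewrite permuteK].
    apply: eq_bigr => x _; rewrite permuteKV (bigD1 (permute t^-1 x)) //= /perm_mx_entry eqxx mulr1.
    by rewrite big1 ?addr0 // => y /negPf ->; rewrite mulr0.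
  by rewrite sumr_const -[X in _ * X = _]mulr_natl mulrA mulVf ?mul1r // card_perm_neq0.
transitivity (\sum_z C a z * \sum_i P i j z i).
  rewrite (bigD1 j) //= P1 eqxx mulr1 big1 ?addr0 // => z zj.
  by rewrite P1 (negPf zj) mulr0.
transitivity (\sum_i \sum_z P i j a z * C z i).
  under eq_bigr do rewrite mulr_sumr.
  by rewrite exchange_big; apply: eq_bigr => i _; exact: CC.
transitivity (\sum_(t : S) \sum_s \sum_z \sum_i #|{: S}|%:R^-1 * w0 s (permute t z) i * C z i * perm_mx_entry s (permute t a) j).
  rewrite exchange_big /= /P.
  under eq_bigr do under eq_bigr do (rewrite mulr_sumr mulr_suml;
    under eq_bigr do rewrite mulr_sumr mulr_suml).
  under eq_bigr do rewrite exchange_big.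
  rewrite exchange_big; apply: eq_bigr => t _.
  under eq_bigr do rewrite exchange_big.
  rewrite exchange_big; apply: eq_bigr => s _; apply: eq_bigr => z _; apply: eq_bigr => i _.
  by ring.
transitivity (\sum_(t : S) \sum_s \sum_z \sum_i #|{: S}|%:R^-1 * w0 (s * t^-1)%g (permute t z) i * C z i * perm_mx_entry s a j).
  apply: eq_bigr => t _; rewrite (reindex_inj (mulIg t^-1%g)) /=.
  apply: eq_bigr => s _; apply: eq_bigr => z _; apply: eq_bigr => i _; congr (_ * _).
  by rewrite /perm_mx_entry permuteM mulgKV.
rewrite exchange_big; apply: eq_bigr => s _; rewrite /w.
rewrite mulr_suml; under [RHS]eq_bigr do rewrite mulr_suml.
rewrite exchange_big; apply: eq_bigr => z _; rewrite exchange_big; apply: eq_bigr => i _.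
by rewrite mulr_sumr !mulr_suml.
Qed.

Definition tensor_power (g : 'I_m -> 'I_m -> R) (x y : X) : R := \prod_i g (x i) (y i).

(** Commutation with g + t 1 is a polynomial identity in t which holds wherever the
determinant, a nonzero polynomial in t, does not vanish. *)
Lemma commutes_all (C : X -> X -> R) :
  (forall g : 'M[R]_m, g \in unitmx -> commutes C (tensor_power g)) ->
  forall g : 'M[R]_m, commutes C (tensor_power g).
Proof.
move=> CC g a b.
pose gp (i j : 'I_m) : {poly R} := (g i j)%:P + (i == j)%:R *: 'X.
pose tp (x y : X) : {poly R} := \prod_i gp (x i) (y i).
pose p : {poly R} := \sum_z (C a z *: tp z b - C z b *: tp a z).
have gpE t i j : (gp i j).[t] = (g + t%:M) i j.
  by rewrite /gp !hornerE !mxE mulr_natl.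
have tpE t x y : (tp x y).[t] = tensor_power (g + t%:M) x y.
  by rewrite /tp horner_prod; apply: eq_bigr => i _; rewrite gpE.
have pE t : p.[t] = \sum_z C a z * tensor_power (g + t%:M) z b - \sum_z tensor_power (g + t%:M) a z * C z b.
  rewrite /p horner_sum -sumrB; apply: eq_bigr => z _.
  by rewrite !hornerE !tpE (mulrC (C z b)).
(* the determinant of g + t 1 as a polynomial in t *)
pose d : {poly R} := char_poly (- g).
have dE t : d.[t] = \det (g + t%:M).
  rewrite /d /char_poly -horner_evalE -det_map_mx; congr (\det _).
  apply/matrixP => i j; rewrite !mxE /= /horner_eval.
  by rewrite hornerD hornerN hornerC hornerMn hornerX opprK addrC.
have d0 : d != 0 by apply: monic_neq0; exact: char_poly_monic.
have pd0 t : (p * d).[t] = 0.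
  rewrite hornerM; have [dt0|dt0] := eqVneq d.[t] 0; first by rewrite dt0 mulr0.
  rewrite pE CC ?subrr ?mul0r // unitmxE unitfE -dE //.
have : p * d = 0.
  apply/eqP; apply: contraT => pd1.
  have := @max_poly_roots _ (p * d) [seq i%:R | i <- iota 0 (size (p * d))] pd1.
  rewrite size_map size_iota ltnn => -> //.
    by apply/allP => t _; apply/rootP; exact: pd0.
  rewrite map_inj_uniq ?iota_uniq // => i j /eqP; rewrite eqr_nat => /eqP //.
move=> /eqP; rewrite mulf_eq0 (negPf d0) orbF => /eqP p0.
have := pE 0; rewrite p0 horner0 (_ : 0%:M = 0) ?addr0; last by apply/matrixP => i j; rewrite !mxE mul0rn.
by move/esym/eqP; rewrite subr_eq0 => /eqP.
Qed.

Lemma commutes_sum (C : X -> X -> R) (T : finType) (c : T -> R) (M : T -> X -> X -> R) (N : X -> X -> R) :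
  (forall t, commutes C (M t)) -> (forall a b, N a b = \sum_t c t * M t a b) -> commutes C N.
Proof.
move=> CM NE a b; under eq_bigr do rewrite NE mulr_sumr.
under [RHS]eq_bigr do rewrite NE mulr_suml.
rewrite exchange_big [RHS]exchange_big; apply: eq_bigr => t _ /=.
transitivity (c t * \sum_z C a z * M t z b).
  by rewrite mulr_sumr; apply: eq_bigr => z _; rewrite mulrCA.
by rewrite CM mulr_sumr; apply: eq_bigr => z _; rewrite mulrA.
Qed.

(** Ryser formula for the permanent.  Here it serves as a polarization identity:
symmetrized elementary tensors are combinations of tensor powers. *)
Lemma permanent_ryser (x : 'I_k -> 'I_k -> R) :
  \sum_(s : S) \prod_i x i (s i)
  = \sum_(J : {set 'I_k}) (\prod_j (if j \in J then 1 else -1)) * \prod_i \sum_(j in J) x i j.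
Proof.
have distr (J : {set 'I_k}) : \prod_i \sum_(j in J) x i j
    = \sum_(f : {ffun 'I_k -> 'I_k}) \prod_i ((f i \in J)%:R * x i (f i)).
  rewrite -(bigA_distr_bigA (fun i j => (j \in J)%:R * x i j)).
  by apply: eq_bigr => i _; rewrite big_mkcond; apply: eq_bigr => j _; case: (j \in J); rewrite ?mul1r ?mul0r.
under [RHS]eq_bigr do rewrite distr mulr_sumr.
rewrite exchange_big /=.
have inner (f : {ffun 'I_k -> 'I_k}) :
   \sum_(J : {set 'I_k}) (\prod_j (if j \in J then 1 else -1)) * \prod_i ((f i \in J)%:R * x i (f i))
   = (injectiveb f)%:R * \prod_i x i (f i).
  transitivity ((\prod_j (1 - (j \notin codom f)%:R)) * \prod_i x i (f i)); last first.
    congr (_ * _); have [inj|ninj] := boolP (injectiveb f).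
      rewrite big1 // => j _.
      by rewrite (injF_onto (injectiveP _ inj)) subr0.
    have [j nj] : exists j, j \notin codom f.
      apply/existsP; rewrite -negb_forall; apply: contra ninj => /forallP all.
      apply/card_uniqP; rewrite size_codom; apply: eq_card => j.
      by rewrite all.
    by rewrite (bigD1 j) //= nj subrr mul0r.
  rewrite bigA_distr mulr_suml; apply: eq_bigr => J _.
  have -> : \prod_i ((f i \in J)%:R * x i (f i)) = (\prod_i (f i \in J)%:R) * \prod_i x i (f i).
    by rewrite big_split.
  rewrite mulrA; congr (_ * _).
  have [/forallP fJ|nfJ] := boolP [forall i, f i \in J].
    rewrite [X in _ * X]big1 ?mulr1 => [|i _]; last by rewrite fJ.
    apply: eq_bigr => j _; case: ifP => // jJ.
    suff -> : j \notin codom f by [].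
    by apply/negP => /codomP [i ji]; rewrite ji fJ in jJ.
  have [i nfi] : exists i, f i \notin J by apply/existsP; rewrite -negb_forall.
  rewrite [X in _ * X](bigD1 i) //= (negPf nfi) mul0r mulr0.
  by rewrite (bigD1 (f i)) //= (negPf nfi) codom_f oppr0 mul0r.
under [RHS]eq_bigr do rewrite inner.
rewrite (bigID (fun f : {ffun 'I_k -> 'I_k} => injectiveb f)) /= [X in _ = _ + X]big1 ?addr0; last first.
  by move=> f /negPf ->; rewrite mul0r.
rewrite (reindex_onto (fun s : S => pval s) (fun f => insubd (1%g : S) f)) /=; last first.
  by move=> f injf; exact: (insubdK (1%g : S) injf).
apply: eq_big => [s|s _].
  by rewrite (valP s) /= valKd eqxx.
by rewrite (valP s) mul1r; apply: eq_bigr => i _; rewrite pvalE.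
Qed.

(** Every matrix invariant under permutations of the indices is a combination of the
symmetrized elementary tensors, and these are combinations of tensor powers. *)
Lemma commutes_invariant (C : X -> X -> R) :
  (forall g : 'M[R]_m, commutes C (tensor_power g)) ->
  forall M, invariant_mx M -> commutes C M.
Proof.
move=> CC M invM.
pose sym (q : X * X) (z b : X) : R := \sum_(s : S) \prod_i ((z i == q.1 (s i)) && (b i == q.2 (s i)))%:R.
have Csym q : commutes C (sym q).
  (* the sum over J of elementary matrices; its tensor powers are the terms of Ryser *)
  pose g (J : {set 'I_k}) : 'M[R]_m := \matrix_(u, v) \sum_(j in J) ((u == q.1 j) && (v == q.2 j))%:R.
  apply: (commutes_sum (T := {set 'I_k}) (c := fun J => \prod_j (if j \in J then 1 else -1))
    (M := fun J => tensor_power (g J))) => [J|z b]; first exact: CC.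
  rewrite /sym (permanent_ryser (fun i j => ((z i == q.1 j) && (b i == q.2 j))%:R)).
  by apply: eq_bigr => J _; congr (_ * _); apply: eq_bigr => i _; rewrite mxE.
apply: (commutes_sum (c := fun q : X * X => #|{: S}|%:R^-1 * M q.1 q.2) Csym) => z b.
transitivity (#|{: S}|%:R^-1 * \sum_(s : S) M z b).
  by rewrite sumr_const -[M z b *+ _]mulr_natl mulrA mulVf ?mul1r // card_perm_neq0.
under [RHS]eq_bigr do rewrite -mulrA.
rewrite -mulr_sumr; congr (_ * _).
under [RHS]eq_bigr do rewrite mulr_sumr.
rewrite exchange_big; apply: eq_bigr => s _ /=.
have prodE (x y : X) : \prod_i ((x i == y (s i)))%:R = (x == permute s y)%:R :> R.
  have [->|nxy] := eqVneq x (permute s y); first by rewrite big1 // => i _; rewrite ffunE eqxx.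
  have [i ni] : exists i, x i != y (s i).
    apply/existsP; rewrite -negb_forall; apply: contra nxy => /forallP xy.
    by apply/eqP/ffunP => i; rewrite ffunE; exact/eqP.
  by rewrite (bigD1 i) //= (negPf ni) mul0r.
have E (q : X * X) : M q.1 q.2 * \prod_i ((z i == q.1 (s i)) && (b i == q.2 (s i)))%:R
   = (q == (permute s^-1 z, permute s^-1 b)%g)%:R * M z b.
  transitivity (M q.1 q.2 * ((z == permute s q.1)%:R * (b == permute s q.2)%:R)).
    congr (_ * _); rewrite -!prodE -big_split /=; apply: eq_bigr => i _.
    by rewrite -natrM mulnb.
  case: q => q1 q2 /=; rewrite xpair_eqE -(can2_eq (permuteK s) (permuteKV s)) -(can2_eq (permuteK s) (permuteKV s)).
  rewrite -natrM mulnb (eq_sym z) (eq_sym b).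
  have [/andP[/eqP <- /eqP <-]|] := boolP (_ && _); last by rewrite mulr0 mul0r.
  by rewrite mulr1 mul1r invM.
under eq_bigr do rewrite E.
rewrite (bigD1 (permute s^-1%g z, permute s^-1%g b)) //= eqxx mul1r big1 ?addr0 // => q /negPf ->.
by rewrite mul0r.
Qed.

(** Commuting with the tensor powers of invertible matrices means commuting with
everything invariant under permutations; the double commutant is spanned by
permutations. *)
Theorem first_fundamental_theorem : exists w : S -> X -> X -> R, forall C : X -> X -> R,
  (forall g : 'M[R]_m, g \in unitmx -> commutes C (tensor_power g)) ->
  forall a b, C a b = \sum_s (\sum_x \sum_y w s x y * C x y) * perm_mx_entry s a b.
Proof.
have [w wP] := double_commutant; exists w => C CC.
by apply: wP => M; apply: commutes_invariant; exact: commutes_all.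
Qed.

End FFT.

(** * Tensors with few indices *)

Section Indices.
Variables (T : finType).

Definition mk1 (a : T) : {ffun 'I_1 -> T} := [ffun _ => a].
Definition mk2 (a b : T) : {ffun 'I_2 -> T} := [ffun i : 'I_2 => nth a [:: a; b] i].
Definition mk3 (a b c : T) : {ffun 'I_3 -> T} := [ffun i : 'I_3 => nth a [:: a; b; c] i].
Definition mk4 (a b c d : T) : {ffun 'I_4 -> T} := [ffun i : 'I_4 => nth a [:: a; b; c; d] i].

Lemma mk2_eta (z : {ffun 'I_2 -> T}) : z = mk2 (z (inord 0)) (z (inord 1)).
Proof.
apply/ffunP => -[[|[|i]] Hi] //; rewrite ffunE /=; congr (z _); apply/esym/val_inj; exact: inordK.
Qed.

Lemma mk3_eta (z : {ffun 'I_3 -> T}) : z = mk3 (z (inord 0)) (z (inord 1)) (z (inord 2)).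
Proof.
apply/ffunP => -[[|[|[|i]]] Hi] //; rewrite ffunE /=; congr (z _); apply/esym/val_inj; exact: inordK.
Qed.

Lemma mk4_eta (z : {ffun 'I_4 -> T}) : z = mk4 (z (inord 0)) (z (inord 1)) (z (inord 2)) (z (inord 3)).
Proof.
apply/ffunP => -[[|[|[|[|i]]]] Hi] //; rewrite ffunE /=; congr (z _); apply/esym/val_inj; exact: inordK.
Qed.

Lemma mk2E (a b : T) : (mk2 a b (inord 0) = a) * (mk2 a b (inord 1) = b).
Proof. by rewrite !ffunE !inordK. Qed.

Lemma mk3E (a b c : T) :
  (mk3 a b c (inord 0) = a) * (mk3 a b c (inord 1) = b) * (mk3 a b c (inord 2) = c).
Proof. by rewrite !ffunE !inordK. Qed.

Lemma mk4E (a b c d : T) :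
  (mk4 a b c d (inord 0) = a) * (mk4 a b c d (inord 1) = b) * (mk4 a b c d (inord 2) = c)
  * (mk4 a b c d (inord 3) = d).
Proof. by rewrite !ffunE !inordK. Qed.

Variable (R : nmodType).

Lemma sum_mk1 (F : {ffun 'I_1 -> T} -> R) : \sum_z F z = \sum_a F (mk1 a).
Proof.
rewrite (reindex mk1) //; exists (fun z : {ffun 'I_1 -> T} => z ord0) => z _; first by rewrite ffunE.
by apply/ffunP => i; rewrite ffunE (ord1 i).
Qed.

Lemma sum_mk2 (F : {ffun 'I_2 -> T} -> R) : \sum_z F z = \sum_a \sum_b F (mk2 a b).
Proof.
rewrite pair_big (reindex (fun t : T * T => mk2 t.1 t.2)) //.
exists (fun z : {ffun 'I_2 -> T} => (z (inord 0), z (inord 1))) => [[a b]|z] _.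
  by rewrite !mk2E.
by rewrite -mk2_eta.
Qed.

Lemma sum_mk3 (F : {ffun 'I_3 -> T} -> R) : \sum_z F z = \sum_a \sum_b \sum_c F (mk3 a b c).
Proof.
rewrite pair_big pair_big (reindex (fun t : T * T * T => mk3 t.1.1 t.1.2 t.2)) //.
exists (fun z : {ffun 'I_3 -> T} => (z (inord 0), z (inord 1), z (inord 2))) => [[[a b] c]|z] _.
  by rewrite !mk3E.
by rewrite -mk3_eta.
Qed.

Lemma sum_mk4 (F : {ffun 'I_4 -> T} -> R) : \sum_z F z = \sum_a \sum_b \sum_c \sum_d F (mk4 a b c d).
Proof.
rewrite pair_big pair_big pair_big (reindex (fun t : T * T * T * T => mk4 t.1.1.1 t.1.1.2 t.1.2 t.2)) //.
exists (fun z : {ffun 'I_4 -> T} => (z (inord 0), z (inord 1), z (inord 2), z (inord 3))) => [[[[a b] c] d]|z] _.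
  by rewrite !mk4E.
by rewrite -mk4_eta.
Qed.

End Indices.

Section FFTUse.
Variables (R : numFieldType) (m : nat).

Lemma tensor_power1 g (a b : 'I_m) : tensor_power (R := R) g (mk1 a) (mk1 b) = g a b.
Proof. by rewrite /tensor_power big_ord1 !ffunE. Qed.

Lemma tensor_power2 g (a b c d : 'I_m) :
  tensor_power (R := R) g (mk2 a b) (mk2 c d) = g a c * g b d.
Proof. by rewrite /tensor_power !big_ord_recl big_ord0 !ffunE /= mulr1. Qed.

Lemma tensor_power3 g (a b c a' b' c' : 'I_m) :
  tensor_power (R := R) g (mk3 a b c) (mk3 a' b' c') = g a a' * (g b b' * g c c').
Proof. by rewrite /tensor_power !big_ord_recl big_ord0 !ffunE /= mulr1. Qed.

Lemma tensor_power4 g (a b c d a' b' c' d' : 'I_m) :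
  tensor_power (R := R) g (mk4 a b c d) (mk4 a' b' c' d') = g a a' * (g b b' * (g c c' * g d d')).
Proof. by rewrite /tensor_power !big_ord_recl big_ord0 !ffunE /= mulr1. Qed.

(** A permutation matrix as a kernel permutes the indices of the argument. *)
Lemma kernel_sum k : exists w : {perm 'I_k} -> {ffun 'I_k -> 'I_m} -> {ffun 'I_k -> 'I_m} -> R,
  forall C : {ffun 'I_k -> 'I_m} -> {ffun 'I_k -> 'I_m} -> R,
  (forall g : 'M[R]_m, g \in unitmx -> commutes C (tensor_power g)) ->
  forall (X : {ffun 'I_k -> 'I_m} -> R) a,
  \sum_b C a b * X b = \sum_s (\sum_x \sum_y w s x y * C x y) * X (permute s a).
Proof.
have [w wP] := @first_fundamental_theorem R m k; exists w => C CC X a.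
under eq_bigr do rewrite wP // mulr_suml.
rewrite exchange_big; apply: eq_bigr => s _ /=.
move: (\sum_x \sum_y w s x y * C x y) => kp.
rewrite (bigD1 (permute s a)) //= /perm_mx_entry eqxx mulr1 big1 ?addr0 // => b /negPf ->.
by rewrite mulr0 mul0r.
Qed.

(** The case of one index: a matrix commuting with all invertible ones is a scalar
multiple of the identity.  The scalar is again obtained by a fixed functional. *)
Lemma scalar_kernel : exists w : 'I_m -> 'I_m -> R, forall C : 'I_m -> 'I_m -> R,
  (forall g : 'M[R]_m, g \in unitmx -> forall a b, \sum_z C a z * g z b = \sum_z g a z * C z b) ->
  forall a b, C a b = (\sum_x \sum_y w x y * C x y) * (a == b)%:R.
Proof.
have [w wP] := @first_fundamental_theorem R m 1.
exists (fun x y => w 1%g (mk1 x) (mk1 y)) => C CC a b.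
pose D (x y : {ffun 'I_1 -> 'I_m}) := C (x 0) (y 0).
have CD g : g \in unitmx -> commutes D (tensor_power g).
  move=> ug x y; rewrite !sum_mk1 /D.
  have xE z : z = mk1 (z 0) :> {ffun 'I_1 -> 'I_m} by apply/ffunP => i; rewrite ffunE (ord1 i).
  rewrite (xE x) (xE y) !ffunE.
  under eq_bigr do rewrite tensor_power1 ffunE.
  under [RHS]eq_bigr do rewrite tensor_power1 ffunE.
  exact: CC.
have := wP D CD (mk1 a) (mk1 b); rewrite {1}/D !ffunE => ->.
have s1 (s : {perm 'I_1}) : s = 1%g by apply/permP => i; rewrite !ord1.
rewrite (bigD1 1%g) //= [X in _ + X]big1 ?addr0; last by move=> s; rewrite (s1 s) eqxx.
congr (_ * _).
  rewrite sum_mk1; apply: eq_bigr => x _; rewrite sum_mk1.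
  by apply: eq_bigr => y _; rewrite /D !ffunE.
rewrite /perm_mx_entry permute1 eq_sym; congr (_%:R); congr nat_of_bool.
by apply/eqP/eqP => [/ffunP /(_ 0)|->//]; rewrite !ffunE.
Qed.

End FFTUse.

(** * Equivariance of the coefficients *)

Section Affine.
Variables (R : realType) (m k : nat).

(** Affine components realize every 1-jet at the origin. *)
Definition affine (c : 'I_k * 'I_k * 'I_m -> R) (d : 'I_m -> 'I_k * 'I_k * 'I_m -> R) : lcomp R m k :=
  fun x j i l => c (j, i, l) + \sum_a x 0 a * d a (j, i, l).

Lemma smooth_affine c d : smooth_comps (affine c d).
Proof.
have oT : open [set: 'rV[R]_m] := openT.
move=> j i l; apply: smoothD => //; first exact: smooth_cst.
apply: smooth_sum => // a; apply: smoothM => //; last exact: smooth_cst.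
apply: (smooth_entry oT 0 a (M := fun z => z)).
by apply: (smooth_lin oT (l := idfun)) => x; exact: cvg_id.
Qed.

Lemma affine0 c d j i l : affine c d 0 j i l = c (j, i, l).
Proof. by rewrite /affine big1 ?addr0 // => a _; rewrite mxE mul0r. Qed.

Lemma pd_affine c d b j i l x : pd b (fun x => affine c d x j i l) x = d b (j, i, l).
Proof.
have dk a : differentiable (fun x : 'rV[R]_m => x 0 a : R^o) x by exact: differentiable_coord.
have dd a : differentiable (fun _ : 'rV[R]_m => d a (j, i, l) : R^o) x by [].
rewrite /pd derive_scalarD //; last by apply: differentiable_bigsum => a; exact: differentiableM.
rewrite derive_cst add0r derive_sumM // (bigD1 b) //= derive_cst mulr0 addr0.
rewrite [X in X * _](pd_coord b b x) eqxx mul1r big1 ?addr0 // => a ab.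
by rewrite derive_cst mulr0 addr0 [X in X * _](pd_coord b a x) eq_sym (negPf ab) mul0r.
Qed.

End Affine.

Section Arrays.
Variables (R : realType) (m n s r : nat) (Gam : rule R m n).
Hypothesis ordG : of_order s r Gam.
Hypothesis natG : commutes_with_local_isos Gam.
Local Notation E0 := (flat R m n).
Local Notation G := (Gam0 Gam).
Local Notation btriple := ('I_m * 'I_m * 'I_m)%type.
Local Notation ftriple := ('I_n * 'I_n * 'I_m)%type.

Definition val0 k (L : lcomp R m k) (t : 'I_k * 'I_k * 'I_m) : R := L 0 t.1.1 t.1.2 t.2.
Definition val1 k (L : lcomp R m k) a (t : 'I_k * 'I_k * 'I_m) : R :=
  pd a (fun x => L x t.1.1 t.1.2 t.2) 0.

(** Coefficients of the polynomial form when K vanishes at the origin: those of v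
times L, of y times L times L, of y times the derivatives of L and of K, and of L
in the fibre directions. *)
Record coefs := Coefs {
  coef_v : 'I_m -> 'I_n -> 'I_m -> 'I_m * 'I_n -> btriple -> R;
  coef_LL : 'I_m -> 'I_n -> 'I_m -> 'I_n -> btriple -> btriple -> R;
  coef_dL : 'I_m -> 'I_n -> 'I_m -> 'I_n -> 'I_m -> btriple -> R;
  coef_dK : 'I_m -> 'I_n -> 'I_m -> 'I_n -> 'I_m -> ftriple -> R;
  coef_vert : 'I_n -> 'I_n -> 'I_m -> btriple -> R }.

Definition hor_poly (C : coefs) (y : 'rV[R]_n) (v : 'M[R]_(m, n)) (l : btriple -> R) (l1 : 'I_m -> btriple -> R)
    (k1 : 'I_m -> ftriple -> R) a i l' : R :=
  \sum_p y 0 p * (\sum_c \sum_t l1 c t * coef_dL C a i l' p c t + \sum_c \sum_t k1 c t * coef_dK C a i l' p c t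
                  + \sum_t \sum_u l t * l u * coef_LL C a i l' p t u)
  + \sum_q v q.1 q.2 * \sum_t l t * coef_v C a i l' q t.

Definition ver_poly (C : coefs) (l : btriple -> R) q i l' : R := \sum_t l t * coef_vert C q i l' t.

Lemma poly_arrays : exists C : coefs, forall (L : classical_connection E0) (K : linear_connection E0) y v,
  (forall j i l, K tt 0 j i l = 0) ->
  (forall a i l, G L K y v (inl a) i l = hor_poly C y v (val0 (L tt)) (val1 (L tt)) (val1 (K tt)) a i l) /\
  (forall q i l, G L K y v (inr q) i l = ver_poly C (val0 (L tt)) q i l).
Proof.
have /choice [h hP] (t : 'I_m * 'I_n * 'I_m) : exists c : ('I_m * 'I_n -> comp_idx m n -> R) * ('I_n -> comp_idx m n -> comp_idx m n -> R)
    * ('I_n -> 'I_m -> comp_idx m n -> R), forall L K y v,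
  G L K y v (inl t.1.1) t.1.2 t.2
  = \sum_p y 0 p * (\sum_a \sum_t pd a (comp (L tt) (K tt) t) 0 * c.2 p a t
                    + \sum_t \sum_u comp (L tt) (K tt) t 0 * comp (L tt) (K tt) u 0 * c.1.2 p t u)
  + \sum_q v q.1 q.2 * \sum_t comp (L tt) (K tt) t 0 * c.1.1 q t.
  by have [al [be [ga H]]] := hor_polynomial ordG natG t.1.1 t.1.2 t.2; exists (al, be, ga).
have /choice [e eP] (t : 'I_n * 'I_n * 'I_m) := ver_polynomial ordG natG t.1.1 t.1.2 t.2.
exists (Coefs (fun a i l q t => (h (a, i, l)).1.1 q (inl t))
  (fun a i l p t u => (h (a, i, l)).1.2 p (inl t) (inl u))
  (fun a i l p c t => (h (a, i, l)).2 p c (inl t))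
  (fun a i l p c t => (h (a, i, l)).2 p c (inr t))
  (fun q i l t => e (q, i, l) (inl t))) => L K y v K0.
have sum0 (d : comp_idx m n -> R) : \sum_t comp (L tt) (K tt) t 0 * d t = \sum_t val0 (L tt) t * d (inl t).
  rewrite big_sumType /= [X in _ + X]big1 ?addr0 // => t _.
  by rewrite K0 mul0r.
split=> [a i l|q i l]; last by rewrite (eP (q, i, l)) sum0.
rewrite (hP (a, i, l)) /hor_poly /=; congr (_ + _); last by apply: eq_bigr => q _; rewrite sum0.
apply: eq_bigr => p _; congr (_ * (_ + _)).
  by rewrite -big_split /=; apply: eq_bigr => c _; rewrite big_sumType.
under eq_bigr do (under eq_bigr do rewrite -mulrA; rewrite -mulr_sumr).
rewrite sum0; apply: eq_bigr => t _; rewrite sum0 mulr_sumr.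
by apply: eq_bigr => u _; rewrite mulrA.
Qed.

Lemma unitmx_cancel p (g : 'M[R]_p) (x x' : 'I_p -> R) : g \in unitmx ->
  (forall i, \sum_q x q * g q i = \sum_q x' q * g q i) -> x =1 x'.
Proof.
move=> ug xx i.
have : (\row_q x q) *m g = (\row_q x' q) *m g.
  by apply/rowP => j; rewrite !mxE; under eq_bigr do rewrite mxE; under [RHS]eq_bigr do rewrite mxE.
by move=> /(can_inj (mulmxK ug)) /rowP /(_ i); rewrite !mxE.
Qed.

Variable C : coefs.
Hypothesis CP : forall (L : classical_connection E0) (K : linear_connection E0) y v,
  (forall j i l, K tt 0 j i l = 0) ->
  (forall a i l, G L K y v (inl a) i l = hor_poly C y v (val0 (L tt)) (val1 (L tt)) (val1 (K tt)) a i l) /\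
  (forall q i l, G L K y v (inr q) i l = ver_poly C (val0 (L tt)) q i l).

(** The transformation law of the value at the origin under linear g and h, without
inverse matrices; l belongs to the source of the change and l' to its target. *)
Definition pulled0 k (g : 'M[R]_m) (h : 'M[R]_k) (l' l : 'I_k * 'I_k * 'I_m -> R) :=
  forall j i b, \sum_p l (j, p, b) * h p i = \sum_b' g b b' * \sum_q h j q * l' (q, i, b').
Definition pulled1 k (g : 'M[R]_m) (h : 'M[R]_k) (l' l : 'I_m -> 'I_k * 'I_k * 'I_m -> R) :=
  forall c j i b, \sum_p l c (j, p, b) * h p i
    = \sum_b' g b b' * \sum_q h j q * \sum_c' g c c' * l' c' (q, i, b').

Lemma val1_pulled k (g : 'M[R]_m) (h : 'M[R]_k) (K K0 : lcomp R m k) c j i b :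
  smooth_comps K0 -> 
  (forall z j i l, \sum_p K0 z j p l * h p i = \sum_l' g l l' * \sum_q h j q * K (z *m g) q i l') ->
  forall (c0 : 'I_k * 'I_k * 'I_m -> R) d, K = affine c0 d ->
  \sum_p val1 K0 c (j, p, b) * h p i = \sum_b' g b b' * \sum_q h j q * \sum_c' g c c' * d c' (q, i, b').
Proof.
move=> sK0 rel c0 d KE.
have dK0 p : differentiable (fun x => K0 x j p b : R^o) 0 := smooth_differentiable (sK0 j p b) I.
transitivity (pd c (fun z => \sum_p K0 z j p b * h p i : R^o) 0).
  rewrite /pd derive_sumM //; apply: eq_bigr => p _.
  by rewrite derive_cst mulr0 addr0.
have sg := mulmx_smooth g.
have dKg q b' : differentiable (fun x => K x q i b' : R^o) (0 *m g).
  by rewrite KE; exact: smooth_differentiable (smooth_affine c0 d q i b') I.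
have dKg' q b' : differentiable (fun z : 'rV[R]_m => K (z *m g) q i b' : R^o) 0.
  exact: (differentiable_comp (smooth_differentiable sg (I : setT 0)) (dKg q b')).
transitivity (pd c (fun z : 'rV[R]_m => \sum_l' g b l' * \sum_q h j q * K (z *m g) q i l' : R^o) 0).
  by apply: derive_scaler_eq => z; rewrite rel.
have dsum l' : differentiable (fun z : 'rV[R]_m => \sum_q h j q * K (z *m g) q i l' : R^o) 0.
  by apply: differentiable_bigsum => q; apply: differentiableM.
rewrite /pd derive_sumM //; apply: eq_bigr => b' _; rewrite derive_cst mul0r add0r; congr (_ * _).
rewrite derive_sumM //; apply: eq_bigr => q _; rewrite derive_cst mul0r add0r; congr (_ * _).
apply: etrans (pd_comp c (smooth_differentiable sg (I : setT 0)) (dKg q b')) _.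
by apply: eq_bigr => c' _; rewrite jacobian_mulmx KE pd_affine.
Qed.

(** Both sides are the transformation law of the rule on affine connections, which
realize arbitrary 1-jets with vanishing value of K. *)
Lemma poly_equivariance (g : 'M[R]_m) (h : 'M[R]_n) y v u l l' l1 l1' k1 k1' :
  g \in unitmx -> h \in unitmx -> g *m u = v *m h ->
  pulled0 g g l' l -> pulled1 g g l1' l1 -> pulled1 g h k1' k1 ->
  (forall a b i, \sum_b' g b b' * \sum_a' g a a' * hor_poly C (y *m h) u l' l1' k1' a' i b'
     = \sum_p hor_poly C y v l l1 k1 a p b * h p i) /\
  (forall q b i, \sum_b' g b b' * \sum_j h q j * ver_poly C l' j i b' = \sum_p ver_poly C l q p b * h p i).
Proof.
move=> ug uh guv pl pl1 pk1.
pose L := flat_cc n (smooth_affine l' l1').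
pose K := flat_lc (smooth_affine (fun _ => 0) k1').
have [L0 [K0 [HL HK Hh Hv]]] := linear_change natG L K ug uh.
have sL0 : smooth_comps (L0 tt) by move=> j i b; have := @cc_smooth _ _ _ _ L0 tt j i b; rewrite flat_img.
have sK0 : smooth_comps (K0 tt) by move=> j i b; have := @lc_smooth _ _ _ _ K0 tt j i b; rewrite flat_img.
have L00 : val0 (L0 tt) = l.
  apply/funext => -[[j p] b]; apply: (unitmx_cancel (x := fun p => val0 (L0 tt) (j, p, b)) (x' := fun p => l (j, p, b)) ug) => i.
  rewrite /val0 /= HL pl mul0mx; apply: eq_bigr => b' _; congr (_ * _).
  by apply: eq_bigr => q _; congr (_ * _); exact: affine0.
have L01 : val1 (L0 tt) = l1.
  apply/funext => c; apply/funext => -[[j p] b].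
  apply: (unitmx_cancel (x := fun p => val1 (L0 tt) c (j, p, b)) (x' := fun p => l1 c (j, p, b)) ug) => i.
  by rewrite (val1_pulled c j i b sL0 HL erefl) pl1.
have Kv0 j p b : K tt 0 j p b = 0 by exact: affine0.
have K00 j p b : K0 tt 0 j p b = 0.
  apply: (unitmx_cancel (x := fun p => K0 tt 0 j p b) (x' := fun p => 0) uh) => i.
  rewrite HK [RHS]big1 => [|q _]; last by rewrite mul0r.
  by rewrite mul0mx big1 // => b' _; rewrite big1 ?mulr0 // => q _; rewrite Kv0 mulr0.
have K01 : val1 (K0 tt) = k1.
  apply/funext => c; apply/funext => -[[j p] b].
  apply: (unitmx_cancel (x := fun p => val1 (K0 tt) c (j, p, b)) (x' := fun p => k1 c (j, p, b)) uh) => i.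
  by rewrite (val1_pulled c j i b sK0 HK erefl) pk1.
have Lv0 : val0 (L tt) = l' by apply/funext => -[[j p] b]; exact: affine0.
have Lv1 : val1 (L tt) = l1' by apply/funext => c; apply/funext => -[[j p] b]; exact: pd_affine.
have Kv1 : val1 (K tt) = k1' by apply/funext => c; apply/funext => -[[j p] b]; exact: pd_affine.
have [P0h P0v] := CP L0 y v K00.
have [P1h P1v] := CP L (y *m h) u Kv0.
split=> [a b i|q b i].
  have := Hh y v u guv a b i.
  under [X in X = _ -> _]eq_bigr do under eq_bigr do rewrite P1h Lv0 Lv1 Kv1.
  by under [X in _ = X -> _]eq_bigr do rewrite P0h L00 L01 K01.
have := Hv y v u guv q b i.
under [X in X = _ -> _]eq_bigr do under eq_bigr do rewrite P1v Lv0.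
by under [X in _ = X -> _]eq_bigr do rewrite P0v L00.
Qed.

End Arrays.

(** * Invariant coefficients as sums over permutations *)

Section RankOne.
Variables (R : comRingType) (m k : nat).
Local Notation btriple := ('I_k * 'I_k * 'I_m)%type.

Lemma sum_t3 (F : btriple -> R) : \sum_t F t = \sum_j \sum_p \sum_b F (j, p, b).
Proof. by rewrite pair_big pair_big; apply: eq_bigr => -[[j p] b] _. Qed.

Lemma sum_pair (T U : finType) (F : T * U -> R) : \sum_q F q = \sum_a \sum_b F (a, b).
Proof. by rewrite pair_big; apply: eq_bigr => -[a b] _. Qed.

(** A rank one tensor on the target side and its pullback [source]: testing an
equivariance relation on such pairs extracts it coefficient by coefficient, again
without inverse matrices. *)
Definition target (P : 'I_k) (B : 'I_m) (x : 'I_k -> R) (t : btriple) : R :=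
  (t.1.1 == P)%:R * ((t.2 == B)%:R * x t.1.2).

Definition source (x : 'I_k -> R) (Q : 'I_k) (z : 'I_m -> R) (t : btriple) : R :=
  x t.1.1 * ((t.1.2 == Q)%:R * z t.2).

Lemma sum_target P B x F : \sum_t target P B x t * F t = \sum_p x p * F (P, p, B).
Proof.
rewrite sum_t3 /target /=.
under eq_bigr do under eq_bigr do under eq_bigr do rewrite -!mulrA.
under eq_bigr do under eq_bigr do rewrite -mulr_sumr sum_pick.
under eq_bigr do rewrite -mulr_sumr.
by rewrite sum_pick.
Qed.

Lemma sum_source x Q z F : \sum_t source x Q z t * F t = \sum_j \sum_b x j * (z b * F (j, Q, b)).
Proof.
rewrite sum_t3 /source /=; apply: eq_bigr => j _.
under eq_bigr do under eq_bigr do rewrite -!mulrA mulrCA.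
under eq_bigr do rewrite -mulr_sumr.
by rewrite sum_pick.
Qed.

End RankOne.

Section Commutes.
Variables (R : realType) (m : nat).

Lemma mul_delta_r p q r (g : 'M[R]_(p, q)) (A0 : 'I_q) (B0 : 'I_r) q1 q2 :
  (g *m delta_mx A0 B0) q1 q2 = (q2 == B0)%:R * g q1 A0.
Proof.
rewrite mxE (bigD1 A0) //= mxE eqxx /= big1 ?addr0; first by rewrite mulrC.
by move=> j /negPf jA; rewrite mxE jA mulr0.
Qed.

Lemma mul_delta_l p q r (h : 'M[R]_(q, r)) (A0 : 'I_p) (B0 : 'I_q) q1 q2 :
  (delta_mx A0 B0 *m h) q1 q2 = (q1 == A0)%:R * h B0 q2.
Proof.
rewrite mxE (bigD1 B0) //= mxE eqxx andbT big1 ?addr0 //.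
by move=> j /negPf jA; rewrite mxE jA andbF mul0r.
Qed.

Lemma pulled_rank_one k (g : 'M[R]_m) (h : 'M[R]_k) P B Q :
  pulled0 g h (target P B (h Q)) (source (h^~ P) Q (g^~ B)).
Proof.
move=> j i b; rewrite /target /source /=.
transitivity (h j P * g b B * h Q i).
  under eq_bigr do rewrite -!mulrA mulrCA.
  by rewrite sum_pick; ring.
transitivity (\sum_b' (b' == B)%:R * (g b b' * (h j P * h Q i))).
  by rewrite sum_pick; ring.
apply: eq_bigr => b' _; under [X in _ = _ * X]eq_bigr do rewrite mulrCA.
by rewrite sum_pick; ring.
Qed.

Lemma pulled_id k l : pulled0 (1%:M : 'M[R]_m) (1%:M : 'M[R]_k) l l.
Proof.
move=> j i b; rewrite sum_scalar_r mul1r.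
by rewrite !sum_scalar !mul1r.
Qed.

Lemma pulled1E k (g : 'M[R]_m) (h : 'M[R]_k) (l l' : 'I_k * 'I_k * 'I_m -> R) A :
  pulled0 g h l' l -> pulled1 g h (fun c t => (c == A)%:R * l' t) (fun c t => g c A * l t).
Proof.
move=> pl c j i b; under eq_bigr do rewrite -mulrA.
rewrite -mulr_sumr pl mulr_sumr; apply: eq_bigr => b' _; rewrite mulrCA; congr (_ * _).
rewrite mulr_sumr; apply: eq_bigr => q _; rewrite mulrCA; congr (_ * _).
by under [RHS]eq_bigr do rewrite mulrCA; rewrite sum_pick.
Qed.

Lemma pulled1_0 k (g : 'M[R]_m) (h : 'M[R]_k) : pulled1 g h (fun _ _ => 0) (fun _ _ => 0).
Proof.
move=> c j i b; rewrite big1 => [|p _]; last by rewrite mul0r.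
rewrite big1 // => b' _; rewrite big1 ?mulr0 // => q _; rewrite big1 ?mulr0 // => c' _.
by rewrite mulr0.
Qed.

End Commutes.

(** Only the lower indices, listed in z, are permuted; the upper index Q is kept
apart, to be summed against a lower one. *)
Definition contract3 (R : realType) (m : nat) (X : 'I_m -> 'I_m * 'I_m * 'I_m -> R) Q (z : {ffun 'I_3 -> 'I_m}) : R :=
  X (z (inord 0)) (z (inord 1), Q, z (inord 2)).

Definition contract4 (R : realType) (m : nat) (l : 'I_m * 'I_m * 'I_m -> R) Q Q' (z : {ffun 'I_4 -> 'I_m}) : R :=
  l (z (inord 0), Q, z (inord 1)) * l (z (inord 2), Q', z (inord 3)).

Section Base.
Variables (R : realType) (m : nat).
Local Notation btriple := ('I_m * 'I_m * 'I_m)%type.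

(** The upper index of X is moved to the other side of the equivariance relation,
where it becomes a lower one; the coefficients then form a kernel commuting with
tensor powers. *)
Lemma invariant_kernel3 (c : 'I_m -> 'I_m -> 'I_m -> btriple -> R) :
  (forall g : 'M[R]_m, g \in unitmx -> forall a b A0 P Q B,
    \sum_b' g b b' * \sum_a' g a a' * \sum_p g Q p * c a' b' A0 (P, p, B)
    = \sum_z g z A0 * \sum_j \sum_b' g j P * (g b' B * c a b z (j, Q, b'))) ->
  exists k : {perm 'I_3} -> R, forall X a b, \sum_z \sum_t X z t * c a b z t
    = \sum_s k s * \sum_Q contract3 X Q (permute s (mk3 a b Q)).
Proof.
move=> eqc.
pose D (x y : {ffun 'I_3 -> 'I_m}) := c (x (inord 0)) (x (inord 1)) (y (inord 0)) (y (inord 1), x (inord 2), y (inord 2)).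
have CD g : g \in unitmx -> commutes D (tensor_power g).
  move=> ug x y; rewrite (mk3_eta x) (mk3_eta y).
  move: (x (inord 0)) (x (inord 1)) (x (inord 2)) (y (inord 0)) (y (inord 1)) (y (inord 2)) => a b Q A0 P B {x y}.
  rewrite !sum_mk3.
  transitivity (\sum_z g z A0 * \sum_j \sum_b' g j P * (g b' B * c a b z (j, Q, b'))).
    apply: eq_bigr => z1 _; rewrite mulr_sumr; apply: eq_bigr => z2 _.
    rewrite mulr_sumr; apply: eq_bigr => z3 _.
    by rewrite tensor_power3 /D !mk3E; ring.
  rewrite -eqc //; under eq_bigr do rewrite mulr_sumr.
  rewrite exchange_big; apply: eq_bigr => z1 _; apply: eq_bigr => z2 _ /=.
  rewrite !mulr_sumr; apply: eq_bigr => z3 _.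
  by rewrite tensor_power3 /D !mk3E; ring.
have [w wP] := kernel_sum R m 3.
exists (fun s => \sum_x \sum_y w s x y * D x y) => X a b.
transitivity (\sum_Q \sum_z D (mk3 a b Q) z * contract3 X Q z).
  under [RHS]eq_bigr do rewrite sum_mk3.
  rewrite [RHS]exchange_big; apply: eq_bigr => z1 _ /=.
  rewrite sum_t3 [RHS]exchange_big; apply: eq_bigr => z2 _; apply: eq_bigr => Q _.
  by apply: eq_bigr => z3 _; rewrite /D /contract3 !mk3E; ring.
under eq_bigr => Q _ do rewrite (wP D CD).
by rewrite exchange_big; apply: eq_bigr => s _; rewrite mulr_sumr.
Qed.

Lemma invariant_kernel4 (c : 'I_m -> 'I_m -> btriple -> btriple -> R) :
  (forall g : 'M[R]_m, g \in unitmx -> forall a b P Q B P' Q' B',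
    \sum_b' g b b' * \sum_a' g a a' * \sum_p g Q p * \sum_p' g Q' p' * c a' b' (P, p, B) (P', p', B')
    = \sum_j \sum_b' g j P * (g b' B * \sum_j' \sum_b'' g j' P' * (g b'' B' * c a b (j, Q, b') (j', Q', b'')))) ->
  exists k : {perm 'I_4} -> R, forall l a b, \sum_t \sum_u l t * (l u * c a b t u)
    = \sum_s k s * \sum_Q \sum_Q' contract4 l Q Q' (permute s (mk4 a b Q Q')).
Proof.
move=> eqc.
pose D (x y : {ffun 'I_4 -> 'I_m}) := c (x (inord 0)) (x (inord 1))
  (y (inord 0), x (inord 2), y (inord 1)) (y (inord 2), x (inord 3), y (inord 3)).
have CD g : g \in unitmx -> commutes D (tensor_power g).
  move=> ug x y; rewrite (mk4_eta x) (mk4_eta y).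
  move: (x (inord 0)) (x (inord 1)) (x (inord 2)) (x (inord 3)) (y (inord 0)) (y (inord 1)) (y (inord 2)) (y (inord 3))
    => a b Q Q' P B P' B' {x y}.
  rewrite !sum_mk4.
  transitivity (\sum_j \sum_b' g j P * (g b' B * \sum_j' \sum_b'' g j' P' * (g b'' B' * c a b (j, Q, b') (j', Q', b'')))).
    apply: eq_bigr => z1 _; apply: eq_bigr => z2 _; rewrite !mulr_sumr; apply: eq_bigr => z3 _.
    rewrite !mulr_sumr; apply: eq_bigr => z4 _.
    by rewrite tensor_power4 /D !mk4E; ring.
  rewrite -eqc //; under eq_bigr do rewrite mulr_sumr.
  rewrite exchange_big; apply: eq_bigr => z1 _; apply: eq_bigr => z2 _ /=.
  rewrite !mulr_sumr; apply: eq_bigr => z3 _; rewrite !mulr_sumr; apply: eq_bigr => z4 _.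
  by rewrite tensor_power4 /D !mk4E; ring.
have [w wP] := kernel_sum R m 4.
exists (fun s => \sum_x \sum_y w s x y * D x y) => l a b.
transitivity (\sum_Q \sum_Q' \sum_z D (mk4 a b Q Q') z * contract4 l Q Q' z).
  under [RHS]eq_bigr do under eq_bigr do rewrite sum_mk4.
  transitivity (\sum_j \sum_Q \sum_b' \sum_j' \sum_Q' \sum_b''
    l (j, Q, b') * (l (j', Q', b'') * c a b (j, Q, b') (j', Q', b''))).
    rewrite sum_t3; apply: eq_bigr => j _; apply: eq_bigr => Q _; apply: eq_bigr => b' _.
    by rewrite sum_t3.
  rewrite exchange_big; apply: eq_bigr => Q _ /=.
  rewrite [RHS]exchange_big; apply: eq_bigr => j _ /=.
  rewrite [RHS]exchange_big; apply: eq_bigr => b' _ /=.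
  rewrite [RHS]exchange_big; apply: eq_bigr => j' _ /=.
  apply: eq_bigr => Q' _; apply: eq_bigr => b'' _.
  by rewrite /D /contract4 !mk4E; ring.
under eq_bigr => Q _ do under eq_bigr => Q' _ do rewrite (wP D CD).
under eq_bigr do rewrite exchange_big.
rewrite exchange_big; apply: eq_bigr => s _ /=; rewrite mulr_sumr.
by apply: eq_bigr => Q _; rewrite mulr_sumr.
Qed.

Lemma invariant_kernel2 (c : 'I_m -> btriple -> R) :
  (forall g : 'M[R]_m, g \in unitmx -> forall b P Q B,
    \sum_b' g b b' * \sum_p g Q p * c b' (P, p, B) = \sum_j \sum_b' g j P * (g b' B * c b (j, Q, b'))) ->
  exists k : {perm 'I_2} -> R, forall l b, \sum_t l t * c b t
    = \sum_s k s * \sum_Q l (permute s (mk2 b Q) (inord 0), Q, permute s (mk2 b Q) (inord 1)).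
Proof.
move=> eqc.
pose D (x y : {ffun 'I_2 -> 'I_m}) := c (x (inord 0)) (y (inord 0), x (inord 1), y (inord 1)).
have CD g : g \in unitmx -> commutes D (tensor_power g).
  move=> ug x y; rewrite (mk2_eta x) (mk2_eta y).
  move: (x (inord 0)) (x (inord 1)) (y (inord 0)) (y (inord 1)) => b Q P B {x y}.
  rewrite !sum_mk2.
  transitivity (\sum_j \sum_b' g j P * (g b' B * c b (j, Q, b'))).
    apply: eq_bigr => z1 _; apply: eq_bigr => z2 _.
    by rewrite tensor_power2 /D !mk2E; ring.
  rewrite -eqc //; apply: eq_bigr => z1 _; rewrite mulr_sumr; apply: eq_bigr => z2 _ /=.
  by rewrite tensor_power2 /D !mk2E; ring.
have [w wP] := kernel_sum R m 2.
exists (fun s => \sum_x \sum_y w s x y * D x y) => l b.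
transitivity (\sum_Q \sum_z D (mk2 b Q) z * l (z (inord 0), Q, z (inord 1))).
  under [RHS]eq_bigr do rewrite sum_mk2.
  rewrite sum_t3 [RHS]exchange_big; apply: eq_bigr => z1 _ /=; apply: eq_bigr => Q _.
  by apply: eq_bigr => z2 _; rewrite /D !mk2E mulrC.
under eq_bigr => Q _ do rewrite (wP D CD (fun z => l (z (inord 0), Q, z (inord 1)))).
by rewrite exchange_big; apply: eq_bigr => s _; rewrite mulr_sumr.
Qed.

End Base.

Lemma perm2_cases (s : {perm 'I_2}) :
  (s (inord 0) = inord 0 /\ s (inord 1) = inord 1) \/ (s (inord 0) = inord 1 /\ s (inord 1) = inord 0).
Proof.
have i2 (i : 'I_2) : i = inord 0 \/ i = inord 1.
  case: i => -[|[|k]] Hk //; [left|right]; apply: val_inj; rewrite /= inordK //.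
have n01 : inord 0 != inord 1 :> 'I_2 by apply/eqP => /(f_equal val); rewrite /= !inordK.
have inj : s (inord 0) != s (inord 1) by rewrite (inj_eq perm_inj).
by case: (i2 (s (inord 0))) (i2 (s (inord 1))) inj => -> [->|->]; rewrite ?eqxx //; [left|right].
Qed.

Lemma commutes_suml (R : numFieldType) (m k : nat) (T : finType) (c : T -> R)
  (D : T -> {ffun 'I_k -> 'I_m} -> {ffun 'I_k -> 'I_m} -> R)
  (N M : {ffun 'I_k -> 'I_m} -> {ffun 'I_k -> 'I_m} -> R) :
  (forall t, commutes (D t) M) -> (forall x y, N x y = \sum_t c t * D t x y) -> commutes N M.
Proof.
move=> CD NE a b; under eq_bigr do rewrite NE mulr_suml.
under [RHS]eq_bigr do rewrite NE mulr_sumr.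
rewrite exchange_big [RHS]exchange_big; apply: eq_bigr => t _ /=.
transitivity (c t * \sum_z D t a z * M z b).
  by rewrite mulr_sumr; apply: eq_bigr => z _; rewrite mulrA.
by rewrite CD mulr_sumr; apply: eq_bigr => z _; rewrite mulrCA.
Qed.

Section Structure.
Variables (R : realType) (m n : nat) (C : coefs R m n).
Local Notation btriple := ('I_m * 'I_m * 'I_m)%type.
Local Notation ftriple := ('I_n * 'I_n * 'I_m)%type.
Hypothesis eqv : forall (g : 'M[R]_m) (h : 'M[R]_n) y v u l l' l1 l1' k1 k1',
  g \in unitmx -> h \in unitmx -> g *m u = v *m h ->
  pulled0 g g l' l -> pulled1 g g l1' l1 -> pulled1 g h k1' k1 ->
  (forall a b i, \sum_b' g b b' * \sum_a' g a a' * hor_poly C (y *m h) u l' l1' k1' a' i b'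
     = \sum_p hor_poly C y v l l1 k1 a p b * h p i) /\
  (forall q b i, \sum_b' g b b' * \sum_j h q j * ver_poly C l' j i b' = \sum_p ver_poly C l q p b * h p i).

Variable i0 : 'I_n.

Let e0 : btriple -> R := fun _ => 0.
Let e1 : 'I_m -> btriple -> R := fun _ _ => 0.
Let f1 : 'I_m -> ftriple -> R := fun _ _ => 0.

Let pulled_e0 g : pulled0 g g e0 e0.
Proof.
move=> j i b; rewrite big1 => [|p _]; last by rewrite mul0r.
by rewrite big1 // => b' _; rewrite big1 ?mulr0 // => q _; rewrite mulr0.
Qed.
Let pulled_e1 g : pulled1 g g e1 e1. Proof. exact: pulled1_0. Qed.
Let pulled_f1 g h : pulled1 g h f1 f1. Proof. exact: pulled1_0. Qed.

Let u1m : (1%:M : 'M[R]_m) \in unitmx := unitmx1 _ _.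
Let u1n : (1%:M : 'M[R]_n) \in unitmx := unitmx1 _ _.

Let scalar (D : 'I_n -> 'I_n -> R) :
  (forall h : 'M[R]_n, h \in unitmx -> forall a b, \sum_z D a z * h z b = \sum_z h a z * D z b) ->
  forall a b, D a b = (a == b)%:R * D i0 i0.
Proof.
have [w wP] := scalar_kernel R n => CD a b.
by rewrite [LHS](wP D CD) [in RHS](wP D CD) eqxx mulr1 mulrC.
Qed.

Section VPart.
Let A (v : 'M[R]_(m, n)) l a i b := \sum_q v q.1 q.2 * \sum_t l t * coef_v C a i b q t.

Let PhA v l l1 k1 a i b : hor_poly C 0 v l l1 k1 a i b = A v l a i b.
Proof. by rewrite /hor_poly [X in X + _]big1 ?add0r // => p _; rewrite mxE mul0r. Qed.

Let eqA g h u v l l' : g \in unitmx -> h \in unitmx -> g *m u = v *m h -> pulled0 g g l' l ->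
  forall a b i, \sum_b' g b b' * \sum_a' g a a' * A u l' a' i b' = \sum_p A v l a p b * h p i.
Proof.
move=> ug uh guv pl a b i.
have [H _] := eqv 0 ug uh guv pl (pulled_e1 g) (pulled_f1 g h).
have := H a b i; rewrite mul0mx.
under [X in X = _ -> _]eq_bigr do under eq_bigr do rewrite PhA.
by under [X in _ = X -> _]eq_bigr do rewrite PhA.
Qed.

Let A_delta l a i b A0 B0 : A (delta_mx A0 B0) l a i b = \sum_t l t * coef_v C a i b (A0, B0) t.
Proof.
rewrite /A -(sum_pick (A0, B0) (fun q => \sum_t l t * coef_v C a i b q t)); apply: eq_bigr => -[a1 b1] _; congr (_ * _).
by rewrite mxE xpair_eqE.
Qed.

Let al' a b A0 t := coef_v C a i0 b (A0, i0) t.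

Let alE a i b A0 B0 t : coef_v C a i b (A0, B0) t = (B0 == i)%:R * al' a b A0 t.
Proof.
apply: (scalar (D := fun B i => coef_v C a i b (A0, B) t)) => h uh B1 i1.
have v1 : 1%:M *m (delta_mx A0 B1 *m h) = delta_mx A0 B1 *m h by rewrite mul1mx.
have := eqA u1m uh v1 (pulled_id (fun t' => (t' == t)%:R)) a b i1.
rewrite !sum_scalar !mul1r.
under [X in _ = X -> _]eq_bigr do rewrite A_delta sum_pick.
move=> <-; rewrite /A.
rewrite (eq_bigr (fun q : 'I_m * 'I_n => (q.1 == A0)%:R * (h B1 q.2 * coef_v C a i1 b q t))).
  rewrite sum_pair /=.
  under eq_bigr do rewrite -mulr_sumr.
  by rewrite sum_pick.
move=> [q1 q2] _ /=; rewrite sum_pick mulrA; congr (_ * _).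
exact: mul_delta_l.
Qed.

(** The fibre index of v is only matched with i by Schur reasoning; the remaining
three base indices are permuted. *)
Lemma v_part : exists k : {perm 'I_3} -> R, forall (v : 'I_m -> 'I_n -> R) l a i b,
  \sum_q v q.1 q.2 * (\sum_t l t * coef_v C a i b q t)
  = \sum_s k s * \sum_Q contract3 (fun c t => v c i * l t) Q (permute s (mk3 a b Q)).
Proof.
have [k kP] : exists k : {perm 'I_3} -> R, forall X a b, \sum_c \sum_t X c t * al' a b c t
    = \sum_s k s * \sum_Q contract3 X Q (permute s (mk3 a b Q)).
  apply: invariant_kernel3 => g ug a b A0 P Q B.
  have := eqA ug u1n (esym (mulmx1 (g *m delta_mx A0 i0))) (pulled_rank_one g g P B Q) a b i0.
  rewrite sum_scalar_r mul1r.
  under [X in X = _ -> _]eq_bigr do under eq_bigr do rewrite A_delta sum_target.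
  move=> ->.
  rewrite /A (eq_bigr (fun q : 'I_m * 'I_n => (q.2 == i0)%:R * (g q.1 A0 * \sum_j \sum_b' g j P * (g b' B * coef_v C a i0 b q (j, Q, b'))))).
    by rewrite sum_pair /=; apply: eq_bigr => z1 _; rewrite sum_pick.
  move=> [q1 q2] _; rewrite sum_source mulrA; congr (_ * _).
  exact: mul_delta_r.
exists k => v l a i b; rewrite -kP sum_pair; apply: eq_bigr => c _ /=.
under eq_bigr do (under eq_bigr do rewrite alE mulrCA; rewrite -mulr_sumr mulrCA).
rewrite sum_pick mulr_sumr.
by apply: eq_bigr => t _; rewrite mulrA.
Qed.
End VPart.

Section LinearInY.
Let Y l l1 k1 a i b p := \sum_c \sum_t l1 c t * coef_dL C a i b p c t + \sum_c \sum_t k1 c t * coef_dK C a i b p c t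
                  + \sum_t \sum_u l t * l u * coef_LL C a i b p t u.

Let PhY y l l1 k1 a i b : hor_poly C y 0 l l1 k1 a i b = \sum_p y 0 p * Y l l1 k1 a i b p.
Proof. by rewrite /hor_poly [X in _ + X]big1 ?addr0 // => p _; rewrite mxE mul0r. Qed.

Let eqY g h l l' l1 l1' k1 k1' B0 : g \in unitmx -> h \in unitmx ->
  pulled0 g g l' l -> pulled1 g g l1' l1 -> pulled1 g h k1' k1 ->
  forall a b i, \sum_b' g b b' * \sum_a' g a a' * \sum_p h B0 p * Y l' l1' k1' a' i b' p
    = \sum_p Y l l1 k1 a p b B0 * h p i.
Proof.
move=> ug uh pl pl1 pk1 a b i.
have guv : g *m 0 = 0 *m h :> 'M[R]_(m, n) by rewrite mulmx0 mul0mx.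
have [H _] := eqv (delta_mx 0 B0) ug uh guv pl pl1 pk1.
have := H a b i.
under [X in X = _ -> _]eq_bigr do under eq_bigr do rewrite PhY -rowE.
under [X in _ = X -> _]eq_bigr do rewrite PhY.
have hE p : \sum_q (delta_mx 0 B0 : 'rV[R]_n) 0 q * Y l l1 k1 a p b q = Y l l1 k1 a p b B0.
  rewrite -(sum_pick B0 (Y l l1 k1 a p b)); apply: eq_bigr => q _; congr (_ * _).
  by rewrite mxE eqxx.
under [X in _ = X -> _]eq_bigr do rewrite hE.
move=> <-; apply: eq_bigr => b' _; congr (_ * _); apply: eq_bigr => a' _; congr (_ * _).
by apply: eq_bigr => p _; rewrite mxE.
Qed.

Section DLPart.
Let Gm l1 a i b p := \sum_c \sum_t l1 c t * coef_dL C a i b p c t.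

Let YG l1 a i b p : Y e0 l1 f1 a i b p = Gm l1 a i b p.
Proof.
rewrite /Y /e0 /f1 [X in _ + X + _]big1 => [|c _]; last by rewrite big1 // => t _; rewrite mul0r.
by rewrite [X in _ + X]big1 => [|t _]; [rewrite !addr0|rewrite big1 // => u _; rewrite !mul0r].
Qed.

Let eqG g h l1 l1' B0 : g \in unitmx -> h \in unitmx -> pulled1 g g l1' l1 ->
  forall a b i, \sum_b' g b b' * \sum_a' g a a' * \sum_p h B0 p * Gm l1' a' i b' p
    = \sum_p Gm l1 a p b B0 * h p i.
Proof.
move=> ug uh pl1 a b i; have := eqY B0 ug uh (pulled_e0 g) pl1 (pulled_f1 g h) a b i.
under [X in X = _ -> _]eq_bigr do under eq_bigr do under eq_bigr do rewrite YG.
by under [X in _ = X -> _]eq_bigr do rewrite YG.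
Qed.

Let Gm_pick A (l : btriple -> R) a i b p : Gm (fun c t => (c == A)%:R * l t) a i b p = \sum_t l t * coef_dL C a i b p A t.
Proof.
rewrite /Gm; under eq_bigr do (under eq_bigr do rewrite -mulrA; rewrite -mulr_sumr).
exact: sum_pick.
Qed.

Let ga' a b c t := coef_dL C a i0 b i0 c t.

Let gaE a i b B0 c t : coef_dL C a i b B0 c t = (B0 == i)%:R * ga' a b c t.
Proof.
apply: (scalar (D := fun B i => coef_dL C a i b B c t)) => h uh B1 i1.
have pl := pulled1E c (pulled_id (R := R) (fun t' : btriple => (t' == t)%:R)).
have := eqG B1 u1m uh pl a b i1.
rewrite !sum_scalar !mul1r.
under [X in X = _ -> _]eq_bigr do rewrite Gm_pick sum_pick.
move=> ->; apply: eq_bigr => p _; congr (_ * _).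
rewrite /Gm; apply/esym.
transitivity (\sum_c' (c' == c)%:R * \sum_t' (t' == t)%:R * coef_dL C a p b B1 c' t').
  apply: eq_bigr => c' _; rewrite mulr_sumr; apply: eq_bigr => t' _.
  by rewrite mxE mulrA.
by rewrite sum_pick sum_pick.
Qed.

Lemma dL_part : exists k : {perm 'I_3} -> R, forall (y : 'I_n -> R) l1 a i b,
  \sum_p y p * (\sum_c \sum_t l1 c t * coef_dL C a i b p c t)
  = y i * \sum_s k s * \sum_Q contract3 l1 Q (permute s (mk3 a b Q)).
Proof.
have [k kP] : exists k : {perm 'I_3} -> R, forall X a b, \sum_c \sum_t X c t * ga' a b c t
    = \sum_s k s * \sum_Q contract3 X Q (permute s (mk3 a b Q)).
  apply: invariant_kernel3 => g ug a b A0 P Q B.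
  have := eqG i0 ug u1n (pulled1E A0 (pulled_rank_one g g P B Q)) a b i0.
  rewrite sum_scalar_r mul1r.
  under [X in X = _ -> _]eq_bigr do under eq_bigr do rewrite sum_scalar mul1r Gm_pick sum_target.
  move=> ->; rewrite /Gm; apply: eq_bigr => c _.
  by under eq_bigr do rewrite -mulrA; rewrite -mulr_sumr sum_source.
exists k => y l1 a i b; rewrite -kP.
rewrite -(sum_pick i (fun p => y p * _)); apply: eq_bigr => p _.
rewrite mulrCA; congr (_ * _); rewrite mulr_sumr; apply: eq_bigr => c _.
by rewrite mulr_sumr; apply: eq_bigr => t _; rewrite gaE mulrCA.
Qed.
End DLPart.

Section LLPart.
Let q l a i b p := \sum_t \sum_u l t * l u * coef_LL C a i b p t u.
Let b2 a i b p t u := coef_LL C a i b p t u + coef_LL C a i b p u t.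
Let q2 (X X' : btriple -> R) a i b p := \sum_t \sum_u X t * (X' u * b2 a i b p t u).

Let Yq l a i b p : Y l e1 f1 a i b p = q l a i b p.
Proof.
rewrite /Y /e1 /f1 [X in X + _ + _]big1 => [|c _]; last by rewrite big1 // => t _; rewrite mul0r.
by rewrite [X in _ + X + _]big1 => [|c _]; [rewrite !add0r|rewrite big1 // => t _; rewrite mul0r].
Qed.

Let eqq g h l l' B0 : g \in unitmx -> h \in unitmx -> pulled0 g g l' l ->
  forall a b i, \sum_b' g b b' * \sum_a' g a a' * \sum_p h B0 p * q l' a' i b' p
    = \sum_p q l a p b B0 * h p i.
Proof.
move=> ug uh pl a b i; have := eqY B0 ug uh pl (pulled_e1 g) (pulled_f1 g h) a b i.
under [X in X = _ -> _]eq_bigr do under eq_bigr do under eq_bigr do rewrite Yq.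
by under [X in _ = X -> _]eq_bigr do rewrite Yq.
Qed.

Let q2E X X' a i b p : q2 X X' a i b p = q (fun t => X t + X' t) a i b p - q X a i b p - q X' a i b p.
Proof.
apply/eqP; rewrite eq_sym subr_eq subr_eq; apply/eqP.
have -> : q2 X X' a i b p = \sum_t \sum_u (X t * X' u + X' t * X u) * coef_LL C a i b p t u.
  rewrite /q2 /b2.
  under eq_bigr do (under eq_bigr do rewrite 2!mulrDr; rewrite big_split /=).
  rewrite big_split /= [X in _ + X]exchange_big /= -big_split; apply: eq_bigr => t _ /=.
  by rewrite -big_split; apply: eq_bigr => u _ /=; ring.
rewrite /q -!big_split; apply: eq_bigr => t _ /=.
by rewrite -!big_split; apply: eq_bigr => u _ /=; ring.
Qed.

Let q_half l a i b p : q l a i b p = 2^-1 * q2 l l a i b p.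
Proof.
have -> : q2 l l a i b p = q l a i b p + q l a i b p.
  rewrite /q2 /b2.
  under eq_bigr do (under eq_bigr do rewrite 2!mulrDr; rewrite big_split /=).
  rewrite big_split /= [X in _ + X]exchange_big /= /q; congr (_ + _);
    by apply: eq_bigr => t _; apply: eq_bigr => u _; ring.
by field.
Qed.

Let eqq2 g h X X' Z Z' B0 : g \in unitmx -> h \in unitmx -> pulled0 g g X' X -> pulled0 g g Z' Z ->
  forall a b i, \sum_b' g b b' * \sum_a' g a a' * \sum_p h B0 p * q2 X' Z' a' i b' p
    = \sum_p q2 X Z a p b B0 * h p i.
Proof.
move=> ug uh pX pZ a b i.
have pXZ : pulled0 g g (fun t => X' t + Z' t) (fun t => X t + Z t).
  move=> j i1 b1; under eq_bigr do rewrite mulrDl.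
  rewrite big_split /= pX pZ -big_split; apply: eq_bigr => b' _ /=.
  rewrite -mulrDr; congr (_ * _); rewrite -big_split; apply: eq_bigr => r _ /=.
  by rewrite mulrDr.
transitivity (\sum_p q (fun t => X t + Z t) a p b B0 * h p i - \sum_p q X a p b B0 * h p i
  - \sum_p q Z a p b B0 * h p i).
  rewrite -(eqq B0 ug uh pXZ) -(eqq B0 ug uh pX) -(eqq B0 ug uh pZ) -!sumrB.
  apply: eq_bigr => b' _; rewrite -!mulrBr; congr (_ * _); rewrite -!sumrB.
  apply: eq_bigr => a' _; rewrite -!mulrBr; congr (_ * _); rewrite -!sumrB.
  by apply: eq_bigr => p _; rewrite -!mulrBr q2E.
by rewrite -!sumrB; apply: eq_bigr => p _; rewrite -!mulrBl q2E.
Qed.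

Let be' a b t u := b2 a i0 b i0 t u.

Let beE a i b B0 t u : b2 a i b B0 t u = (B0 == i)%:R * be' a b t u.
Proof.
apply: (scalar (D := fun B i => b2 a i b B t u)) => h uh B1 i1.
have pt (t0 : btriple) := pulled_id (R := R) (fun t' : btriple => (t' == t0)%:R).
have q2p a1 i2 b1 p : q2 (fun t' : btriple => (t' == t)%:R) (fun t' : btriple => (t' == u)%:R) a1 i2 b1 p = b2 a1 i2 b1 p t u.
  rewrite /q2; under eq_bigr do rewrite -mulr_sumr sum_pick.
  by rewrite sum_pick.
have := eqq2 B1 u1m uh (pt t) (pt u) a b i1.
rewrite !sum_scalar !mul1r.
under [X in X = _ -> _]eq_bigr do rewrite q2p.
by under [X in _ = X -> _]eq_bigr do rewrite q2p.
Qed.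

(** The quadratic form is polarized, so that equivariance can be tested on pairs of
independent rank one tensors. *)
Lemma LL_part : exists k : {perm 'I_4} -> R, forall (y : 'I_n -> R) l a i b,
  \sum_p y p * (\sum_t \sum_u l t * l u * coef_LL C a i b p t u)
  = y i * \sum_s k s * \sum_Q \sum_Q' contract4 l Q Q' (permute s (mk4 a b Q Q')).
Proof.
have [k kP] : exists k : {perm 'I_4} -> R, forall l a b, \sum_t \sum_u l t * (l u * be' a b t u)
    = \sum_s k s * \sum_Q \sum_Q' contract4 l Q Q' (permute s (mk4 a b Q Q')).
  apply: invariant_kernel4 => g ug a b P Q B P' Q' B'.
  have := eqq2 i0 ug u1n (pulled_rank_one g g P B Q) (pulled_rank_one g g P' B' Q') a b i0.
  rewrite sum_scalar_r mul1r.
  have E1 a' b' : q2 (target P B (g Q)) (target P' B' (g Q')) a' i0 b' i0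
      = \sum_p g Q p * \sum_p' g Q' p' * be' a' b' (P, p, B) (P', p', B').
    rewrite /q2; under eq_bigr do (rewrite -mulr_sumr sum_target).
    by rewrite sum_target.
  under [X in X = _ -> _]eq_bigr do under eq_bigr do rewrite sum_scalar mul1r E1.
  move=> ->; rewrite /q2.
  under eq_bigr do rewrite -mulr_sumr sum_source.
  by rewrite sum_source.
exists (fun s => 2^-1 * k s) => y l a i b.
under [X in _ = _ * X]eq_bigr do rewrite -mulrA.
rewrite -mulr_sumr -kP.
rewrite -(sum_pick i (fun p => y p * _)); apply: eq_bigr => p _.
rewrite mulrCA; congr (_ * _); rewrite -/(q l a i b p) q_half mulrCA; congr (_ * _).
rewrite /q2 mulr_sumr; apply: eq_bigr => t _; rewrite mulr_sumr; apply: eq_bigr => u _.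
by rewrite beE; ring.
Qed.
End LLPart.

Section DKPart.
Let Dl k1 a i b p := \sum_c \sum_t k1 c t * coef_dK C a i b p c t.

Let YD k1 a i b p : Y e0 e1 k1 a i b p = Dl k1 a i b p.
Proof.
rewrite /Y /e0 /e1 [X in X + _ + _]big1 => [|c _]; last by rewrite big1 // => t _; rewrite mul0r.
by rewrite [X in _ + X]big1 => [|t _]; [rewrite add0r addr0|rewrite big1 // => u _; rewrite !mul0r].
Qed.

Let eqD g h k1 k1' B0 : g \in unitmx -> h \in unitmx -> pulled1 g h k1' k1 ->
  forall a b i, \sum_b' g b b' * \sum_a' g a a' * \sum_p h B0 p * Dl k1' a' i b' p
    = \sum_p Dl k1 a p b B0 * h p i.
Proof.
move=> ug uh pk1 a b i; have := eqY B0 ug uh (pulled_e0 g) (pulled_e1 g) pk1 a b i.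
under [X in X = _ -> _]eq_bigr do under eq_bigr do under eq_bigr do rewrite YD.
by under [X in _ = X -> _]eq_bigr do rewrite YD.
Qed.

Let Dl_pick A (l : ftriple -> R) a i b p : Dl (fun c t => (c == A)%:R * l t) a i b p = \sum_t l t * coef_dK C a i b p A t.
Proof.
rewrite /Dl; under eq_bigr do (under eq_bigr do rewrite -mulrA; rewrite -mulr_sumr).
exact: sum_pick.
Qed.

Let comm_base i B0 q0 g : g \in unitmx -> commutes
  (fun x y : {ffun 'I_2 -> 'I_m} => coef_dK C (x (inord 0)) i (x (inord 1)) B0 (y (inord 0)) (q0, y (inord 1)))
  (tensor_power g).
Proof.
move=> ug x y; rewrite (mk2_eta x) (mk2_eta y).
move: (x (inord 0)) (x (inord 1)) (y (inord 0)) (y (inord 1)) => a b A0 B {x y}.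
have pl : pulled0 g 1%:M (fun t : ftriple => (t.1 == q0)%:R * (t.2 == B)%:R) (fun t => (t.1 == q0)%:R * g t.2 B).
  move=> j i1 b1; rewrite sum_scalar_r mul1r /=.
  transitivity (\sum_b' (b' == B)%:R * (((j, i1) == q0)%:R * g b1 b')); first by rewrite sum_pick.
  by apply: eq_bigr => b' _; rewrite sum_scalar; ring.
have := eqD B0 ug u1n (pulled1E A0 pl) a b i.
rewrite sum_scalar_r mul1r.
have E1 a' b' : \sum_p (1%:M : 'M[R]_n) B0 p * Dl (fun c t => (c == A0)%:R * ((t.1 == q0)%:R * (t.2 == B)%:R)) a' i b' p
    = coef_dK C a' i b' B0 A0 (q0, B).
  rewrite sum_scalar mul1r Dl_pick sum_pair /=.
  under eq_bigr do under eq_bigr do rewrite -mulrA.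
  by under eq_bigr do rewrite -mulr_sumr sum_pick; rewrite sum_pick.
under [X in X = _ -> _]eq_bigr do under eq_bigr do rewrite E1.
move=> E; rewrite !sum_mk2.
transitivity (Dl (fun c t => g c A0 * ((t.1 == q0)%:R * g t.2 B)) a i b B0).
  rewrite /Dl; apply: eq_bigr => c _; rewrite sum_pair /=.
  transitivity (\sum_q (q == q0)%:R * (\sum_r g c A0 * g r B * coef_dK C a i b B0 c (q, r))).
    rewrite sum_pick; apply: eq_bigr => r _.
    by rewrite !mk2E tensor_power2 mulrC.
  by apply: eq_bigr => q _; rewrite mulr_sumr; apply: eq_bigr => r _; ring.
rewrite -E; under eq_bigr do rewrite mulr_sumr.
rewrite exchange_big; apply: eq_bigr => z1 _; apply: eq_bigr => z2 _ /=.
by rewrite tensor_power2 !mk2E; ring.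
Qed.

Let comm_fibre a b A0 B h : h \in unitmx -> commutes
  (fun x y : {ffun 'I_2 -> 'I_n} => coef_dK C a (y (inord 0)) b (x (inord 0)) A0 (y (inord 1), x (inord 1), B))
  (tensor_power h).
Proof.
move=> uh x y; rewrite (mk2_eta x) (mk2_eta y).
move: (x (inord 0)) (x (inord 1)) (y (inord 0)) (y (inord 1)) => B0 Q i P {x y}.
have := eqD B0 u1m uh (pulled1E A0 (pulled_rank_one 1%:M h P B Q)) a b i.
rewrite !sum_scalar !mul1r.
under [X in X = _ -> _]eq_bigr do rewrite Dl_pick sum_target.
move=> E; rewrite !sum_mk2.
transitivity (\sum_p Dl (fun c t => (1%:M : 'M[R]_m) c A0 * source (h^~ P) Q ((1%:M : 'M[R]_m)^~ B) t) a p b B0 * h p i).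
  apply: eq_bigr => p _.
  have -> : Dl (fun c t => (1%:M : 'M[R]_m) c A0 * source (h^~ P) Q ((1%:M : 'M[R]_m)^~ B) t) a p b B0
      = \sum_j h j P * coef_dK C a p b B0 A0 (j, Q, B).
    rewrite /Dl.
    transitivity (\sum_c (c == A0)%:R * \sum_j h j P * coef_dK C a p b B0 c (j, Q, B)).
      apply: eq_bigr => c _; under eq_bigr do rewrite -mulrA; rewrite -mulr_sumr mxE sum_source.
      congr (_ * _); apply: eq_bigr => j _.
      rewrite -(sum_pick B (fun b' => h j P * coef_dK C a p b B0 c (j, Q, b'))); apply: eq_bigr => b' _.
      by rewrite mxE mulrCA.
    exact: sum_pick.
  rewrite mulr_suml; apply: eq_bigr => j _.
  by rewrite !mk2E tensor_power2; ring.
rewrite -E; apply: eq_bigr => z1 _; rewrite mulr_sumr; apply: eq_bigr => z2 _ /=.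
by rewrite tensor_power2 !mk2E; ring.
Qed.

(** There are two indices of each kind.  The base indices are treated first: a
transposition only changes the sign because the derivative of K enters
antisymmetrized.  Then the two fibre permutations give the trace of k1 and its
contraction with y. *)
Lemma dK_part : exists e1 e2 : R, forall (y : 'I_n -> R) (k1 : 'I_m -> ftriple -> R) a i b,
  (forall c q c', k1 c (q, c') = - k1 c' (q, c)) ->
  \sum_p y p * (\sum_c \sum_t k1 c t * coef_dK C a i b p c t)
  = e1 * (y i * \sum_j k1 a (j, j, b)) + e2 * \sum_p y p * k1 a (p, i, b).
Proof.
have [w wP] := kernel_sum R m 2.
pose sg (s : {perm 'I_2}) : R := if s (inord 0) == inord 0 then 1 else -1.
have n01 : (inord 1 == inord 0 :> 'I_2) = false by apply/eqP => /(f_equal val); rewrite /= !inordK.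
pose D i B0 q0 (x y : {ffun 'I_2 -> 'I_m}) := coef_dK C (x (inord 0)) i (x (inord 1)) B0 (y (inord 0)) (q0, y (inord 1)).
pose d i B0 q0 := \sum_s sg s * (\sum_x \sum_y w s x y * D i B0 q0 x y).
have dE k1 a i b p : (forall c q c', k1 c (q, c') = - k1 c' (q, c)) ->
    Dl k1 a i b p = \sum_q0 d i p q0 * k1 a (q0, b).
  move=> anti.
  transitivity (\sum_q0 \sum_z D i p q0 (mk2 a b) z * k1 (z (inord 0)) (q0, z (inord 1))).
    rewrite /Dl; under eq_bigr do rewrite sum_pair.
    rewrite exchange_big; apply: eq_bigr => q0 _ /=; rewrite sum_mk2.
    by apply: eq_bigr => c _; apply: eq_bigr => r _; rewrite /D !mk2E mulrC.
  apply: eq_bigr => q0 _.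
  rewrite (wP (D i p q0) (fun g ug => comm_base i p q0 ug) (fun z => k1 (z (inord 0)) (q0, z (inord 1)))).
  rewrite /d mulr_suml; apply: eq_bigr => s _; rewrite mulrC [RHS]mulrAC; congr (_ * _).
  rewrite /sg; have [[s0 s1]|[s0 s1]] := perm2_cases s; rewrite s0 !ffunE s0 s1 ?inordK //= ?eqxx ?n01.
    by rewrite mul1r.
  by rewrite anti mulN1r.
pose N (x y : {ffun 'I_2 -> 'I_n}) := d (y (inord 0)) (x (inord 0)) (y (inord 1), x (inord 1)).
have CN h : h \in unitmx -> commutes N (tensor_power h).
  move=> uh.
  apply: (commutes_suml (T := ({perm 'I_2} * {ffun 'I_2 -> 'I_m} * {ffun 'I_2 -> 'I_m})%type)
    (c := fun q => sg q.1.1 * w q.1.1 q.1.2 q.2)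
    (D := fun q x y => coef_dK C (q.1.2 (inord 0)) (y (inord 0)) (q.1.2 (inord 1)) (x (inord 0)) (q.2 (inord 0)) (y (inord 1), x (inord 1), q.2 (inord 1)))).
    by move=> q; exact: comm_fibre.
  move=> x y; rewrite sum_pair sum_pair /=; apply: eq_bigr => s _; rewrite mulr_sumr; apply: eq_bigr => x' _.
  by rewrite mulr_sumr; apply: eq_bigr => y' _; rewrite mulrA.
have [w' wP'] := kernel_sum R n 2.
pose k s := \sum_x \sum_y w' s x y * N x y.
exists (\sum_(s : {perm 'I_2}) (s (inord 0) == inord 0)%:R * k s),
  (\sum_(s : {perm 'I_2}) (s (inord 0) != inord 0)%:R * k s) => y k1 a i b anti.
transitivity (\sum_p \sum_i' y p * \sum_z N (mk2 p i') z * ((z (inord 0) == i)%:R * k1 a (z (inord 1), i', b))).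
  apply: eq_bigr => p _; rewrite -/(Dl k1 a i b p) dE // -mulr_sumr; congr (_ * _).
  rewrite sum_pair exchange_big; apply: eq_bigr => i' _ /=; rewrite sum_mk2.
  transitivity (\sum_j (j == i)%:R * \sum_j' d j p (j', i') * k1 a (j', i', b)); first by rewrite sum_pick.
  apply: eq_bigr => j _; rewrite mulr_sumr; apply: eq_bigr => j' _.
  by rewrite /N !mk2E; ring.
under eq_bigr => p _ do under eq_bigr => i' _ do
  (rewrite (wP' N CN (fun z => (z (inord 0) == i)%:R * k1 a (z (inord 1), i', b))) mulr_sumr).
under eq_bigr do rewrite exchange_big.
rewrite exchange_big /= !mulr_suml -big_split; apply: eq_bigr => s _ /=; rewrite -/(k s).
have [[s0 s1]|[s0 s1]] := perm2_cases s; rewrite s0 ?eqxx ?n01 /=.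
  transitivity (\sum_p (p == i)%:R * \sum_i' (y p * k s * k1 a (i', i', b))).
    apply: eq_bigr => p _; rewrite mulr_sumr; apply: eq_bigr => i' _.
    by rewrite !ffunE s0 s1 !inordK //=; ring.
  by rewrite sum_pick mul0r mul0r addr0 mul1r -mulr_sumr; ring.
transitivity (\sum_p \sum_i' (i' == i)%:R * (y p * k s * k1 a (p, i', b))).
  apply: eq_bigr => p _; apply: eq_bigr => i' _.
  by rewrite !ffunE s0 s1 !inordK //=; ring.
rewrite mul0r mul0r add0r mul1r mulr_sumr; apply: eq_bigr => p _.
by rewrite sum_pick; ring.
Qed.
End DKPart.

End LinearInY.

Section VertPart.
Let eqV g h l l' : g \in unitmx -> h \in unitmx -> pulled0 g g l' l ->
  forall q b i, \sum_b' g b b' * \sum_j h q j * ver_poly C l' j i b' = \sum_p ver_poly C l q p b * h p i.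
Proof.
move=> ug uh pl.
have guv : g *m 0 = 0 *m h :> 'M[R]_(m, n) by rewrite mulmx0 mul0mx.
by have [_ H] := eqv 0 ug uh guv pl (pulled_e1 g) (pulled_f1 g h).
Qed.

Let et' b t := coef_vert C i0 i0 b t.

Let etE q i b t : coef_vert C q i b t = (q == i)%:R * et' b t.
Proof.
apply: (scalar (D := fun q i => coef_vert C q i b t)) => h uh q1 i1.
have := eqV u1m uh (pulled_id (fun t' => (t' == t)%:R)) q1 b i1.
rewrite sum_scalar mul1r /ver_poly.
under [X in X = _ -> _]eq_bigr do rewrite sum_pick.
by under [X in _ = X -> _]eq_bigr do rewrite sum_pick.
Qed.

Lemma vert_part : exists k : {perm 'I_2} -> R, forall l q i b,
  ver_poly C l q i b = (q == i)%:R *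
    \sum_s k s * \sum_Q l (permute s (mk2 b Q) (inord 0), Q, permute s (mk2 b Q) (inord 1)).
Proof.
have [k kP] : exists k : {perm 'I_2} -> R, forall l b, \sum_t l t * et' b t
    = \sum_s k s * \sum_Q l (permute s (mk2 b Q) (inord 0), Q, permute s (mk2 b Q) (inord 1)).
  apply: invariant_kernel2 => g ug b P Q B.
  have := eqV ug u1n (pulled_rank_one g g P B Q) i0 b i0.
  rewrite sum_scalar_r mul1r /ver_poly sum_source.
  by under [X in X = _ -> _]eq_bigr do rewrite sum_scalar mul1r sum_target.
exists k => l q i b; rewrite -kP /ver_poly mulr_sumr; apply: eq_bigr => t _.
by rewrite etE mulrCA.
Qed.
End VertPart.

End Structure.

(** * Complete contractions of torsion and curvature *)

Section Shapes.
Variables (R : realType) (m : nat).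
Local Notation btriple := ('I_m * 'I_m * 'I_m)%type.

Lemma ord3_case (i : 'I_3) : [\/ i = inord 0, i = inord 1 | i = inord 2].
Proof.
case: i => -[|[|[|k]]] Hk //; [apply: Or31|apply: Or32|apply: Or33];
  by apply: val_inj; rewrite /= inordK.
Qed.

Lemma ord4_case (i : 'I_4) : [\/ i = inord 0, i = inord 1, i = inord 2 | i = inord 3].
Proof.
case: i => -[|[|[|[|k]]]] Hk //; [apply: Or41|apply: Or42|apply: Or43|apply: Or44];
  by apply: val_inj; rewrite /= inordK.
Qed.

Lemma perm_neq k (s : {perm 'I_k}) i j : i != j -> s i = s j -> False.
Proof. by move=> ij /perm_inj /eqP; rewrite (negPf ij). Qed.

Lemma inord_neq k i j : (i < k.+1)%N -> (j < k.+1)%N -> i != j -> (inord i : 'I_k.+1) != inord j.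
Proof. by move=> Hi Hj; apply: contra => /eqP /(f_equal val); rewrite /= !inordK // => ->. Qed.

Lemma perm3_cases (s : {perm 'I_3}) (P : 'I_3 -> 'I_3 -> 'I_3 -> Prop) :
  P (inord 0) (inord 1) (inord 2) -> P (inord 0) (inord 2) (inord 1) ->
  P (inord 1) (inord 0) (inord 2) -> P (inord 1) (inord 2) (inord 0) ->
  P (inord 2) (inord 0) (inord 1) -> P (inord 2) (inord 1) (inord 0) ->
  P (s (inord 0)) (s (inord 1)) (s (inord 2)).
Proof.
move=> *; have n01 := @perm_neq _ s _ _ (@inord_neq 2 0 1 isT isT isT).
have n02 := @perm_neq _ s _ _ (@inord_neq 2 0 2 isT isT isT).
have n12 := @perm_neq _ s _ _ (@inord_neq 2 1 2 isT isT isT).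
move: n01 n02 n12; case: (ord3_case (s (inord 0))) => ->; case: (ord3_case (s (inord 1))) => ->;
  case: (ord3_case (s (inord 2))) => -> n01 n02 n12; try (by []);
  by case: (n01 erefl) || case: (n02 erefl) || case: (n12 erefl).
Qed.

Lemma perm4_cases (s : {perm 'I_4}) (P : 'I_4 -> 'I_4 -> 'I_4 -> 'I_4 -> Prop) :
  (forall i j k l : 'I_4, uniq [:: i; j; k; l] -> P i j k l) ->
  P (s (inord 0)) (s (inord 1)) (s (inord 2)) (s (inord 3)).
Proof.
apply; have -> : [:: s (inord 0); s (inord 1); s (inord 2); s (inord 3)]
  = map s [:: inord 0; inord 1; inord 2; inord 3] by [].
by rewrite (map_inj_uniq (@perm_inj _ s)) -(map_inj_uniq val_inj) /= !inordK.
Qed.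

(** Up to antisymmetry the six permutations give three contractions, according to the
slot in which the derivation or velocity index of X goes. *)
Lemma torsion_derivative_contractions (k : {perm 'I_3} -> R) : exists c1 c2 c3 : R, forall X : 'I_m -> btriple -> R,
  (forall c i j b, X c (j, i, b) = - X c (b, i, j)) -> forall a b,
  \sum_s k s * \sum_Q contract3 X Q (permute s (mk3 a b Q))
  = c1 * (\sum_Q X b (Q, Q, a)) + c2 * (\sum_Q X a (Q, Q, b)) + c3 * (\sum_Q X Q (a, Q, b)).
Proof.
have H (s : {perm 'I_3}) : exists c : R * R * R, forall X : 'I_m -> btriple -> R,
  (forall c i j b, X c (j, i, b) = - X c (b, i, j)) -> forall a b,
  \sum_Q contract3 X Q (permute s (mk3 a b Q))
  = c.1.1 * (\sum_Q X b (Q, Q, a)) + c.1.2 * (\sum_Q X a (Q, Q, b)) + c.2 * (\sum_Q X Q (a, Q, b)).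
  suff : exists c : R * R * R, forall X : 'I_m -> btriple -> R,
    (forall c i j b, X c (j, i, b) = - X c (b, i, j)) -> forall a b,
    \sum_Q X (mk3 a b Q (s (inord 0))) (mk3 a b Q (s (inord 1)), Q, mk3 a b Q (s (inord 2)))
    = c.1.1 * (\sum_Q X b (Q, Q, a)) + c.1.2 * (\sum_Q X a (Q, Q, b)) + c.2 * (\sum_Q X Q (a, Q, b)).
    move=> [c cP]; exists c => X anti a b; rewrite -cP //.
    by apply: eq_bigr => Q _; rewrite /contract3 /permute ![finfun _ _]ffunE.
  apply: (@perm3_cases s (fun i0 i1 i2 => exists c : R * R * R, forall X : 'I_m -> btriple -> R,
    (forall c i j b, X c (j, i, b) = - X c (b, i, j)) -> forall a b,
    \sum_Q X (mk3 a b Q i0) (mk3 a b Q i1, Q, mk3 a b Q i2)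
    = c.1.1 * (\sum_Q X b (Q, Q, a)) + c.1.2 * (\sum_Q X a (Q, Q, b)) + c.2 * (\sum_Q X Q (a, Q, b))));
  [exists (0, -1, 0)|exists (0, 1, 0)|exists (-1, 0, 0)|exists (1, 0, 0)|exists (0, 0, 1)|exists (0, 0, -1)] => X anti a b;
  rewrite !mulr_sumr -!big_split; apply: eq_bigr => Q _ /=; rewrite !mk3E; (try by ring); rewrite anti; ring.
have [c cP] := choice H.
exists (\sum_s k s * (c s).1.1), (\sum_s k s * (c s).1.2), (\sum_s k s * (c s).2) => X anti a b.
rewrite !mulr_suml -!big_split; apply: eq_bigr => s _ /=; rewrite cP //; ring.
Qed.

(** The symmetrization in the argument comes from the second order terms of normal
coordinates; by antisymmetry and the Bianchi identity it only leaves two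
independent traces. *)
Lemma curvature_contractions (k : {perm 'I_3} -> R) : exists d1 d2 : R, forall Rm : 'I_m -> 'I_m -> 'I_m -> 'I_m -> R,
  (forall j i c b, Rm j i c b = - Rm j i b c) ->
  (forall j i c b, Rm j i c b + Rm c i b j + Rm b i j c = 0) -> forall a b,
  \sum_s k s * \sum_Q contract3 (fun c t => Rm t.1.1 t.1.2 c t.2 + Rm t.2 t.1.2 c t.1.1) Q (permute s (mk3 a b Q))
  = d1 * (\sum_Q Rm Q Q a b) + d2 * (\sum_Q Rm a Q Q b).
Proof.
have H (s : {perm 'I_3}) : exists c : R * R, forall Rm : 'I_m -> 'I_m -> 'I_m -> 'I_m -> R,
  (forall j i c b, Rm j i c b = - Rm j i b c) ->
  (forall j i c b, Rm j i c b + Rm c i b j + Rm b i j c = 0) -> forall a b,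
  \sum_Q contract3 (fun c t => Rm t.1.1 t.1.2 c t.2 + Rm t.2 t.1.2 c t.1.1) Q (permute s (mk3 a b Q))
  = c.1 * (\sum_Q Rm Q Q a b) + c.2 * (\sum_Q Rm a Q Q b).
  suff : exists c : R * R, forall Rm : 'I_m -> 'I_m -> 'I_m -> 'I_m -> R,
    (forall j i c b, Rm j i c b = - Rm j i b c) ->
    (forall j i c b, Rm j i c b + Rm c i b j + Rm b i j c = 0) -> forall a b,
    \sum_Q (Rm (mk3 a b Q (s (inord 1))) Q (mk3 a b Q (s (inord 0))) (mk3 a b Q (s (inord 2)))
            + Rm (mk3 a b Q (s (inord 2))) Q (mk3 a b Q (s (inord 0))) (mk3 a b Q (s (inord 1))))
    = c.1 * (\sum_Q Rm Q Q a b) + c.2 * (\sum_Q Rm a Q Q b).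
    move=> [c cP]; exists c => Rm anti bianchi a b; rewrite -cP //.
    by apply: eq_bigr => Q _; rewrite /contract3 /permute ![finfun _ _]ffunE.
  apply: (@perm3_cases s (fun i0 i1 i2 => exists c : R * R, forall Rm : 'I_m -> 'I_m -> 'I_m -> 'I_m -> R,
    (forall j i c b, Rm j i c b = - Rm j i b c) ->
    (forall j i c b, Rm j i c b + Rm c i b j + Rm b i j c = 0) -> forall a b,
    \sum_Q (Rm (mk3 a b Q i1) Q (mk3 a b Q i0) (mk3 a b Q i2) + Rm (mk3 a b Q i2) Q (mk3 a b Q i0) (mk3 a b Q i1))
    = c.1 * (\sum_Q Rm Q Q a b) + c.2 * (\sum_Q Rm a Q Q b)));
  [exists (2, -1)|exists (2, -1)|exists (-1, -1)|exists (-1, -1)|exists (-1, 2)|exists (-1, 2)] => Rm anti bianchi a b;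
  rewrite !mulr_sumr -!big_split; apply: eq_bigr => Q _ /=; rewrite !mk3E;
  have := bianchi Q Q a b; have := anti b Q a Q; have := anti a Q b Q; have := anti Q Q b a; lra.
have [c cP] := choice H.
exists (\sum_s k s * (c s).1), (\sum_s k s * (c s).2) => Rm anti bianchi a b.
rewrite !mulr_suml -!big_split; apply: eq_bigr => s _ /=; rewrite cP //; ring.
Qed.

Lemma two_index_contractions (k : {perm 'I_2} -> R) : exists h : R, forall l : btriple -> R,
  (forall i j b, l (j, i, b) = - l (b, i, j)) -> forall b,
  \sum_s k s * \sum_Q l (permute s (mk2 b Q) (inord 0), Q, permute s (mk2 b Q) (inord 1))
  = h * \sum_Q l (Q, Q, b).
Proof.
exists (\sum_(s : {perm 'I_2}) k s * (if s (inord 0) == inord 0 then -1 else 1)) => l anti b.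
rewrite mulr_suml; apply: eq_bigr => s _; rewrite -mulrA; congr (_ * _).
rewrite mulr_sumr; apply: eq_bigr => Q _; rewrite /permute ![finfun _ _]ffunE.
have n01 : (inord 1 == inord 0 :> 'I_2) = false by apply: negbTE; exact: (@inord_neq 1 1 0 isT isT isT).
have [[s0 s1]|[s0 s1]] := perm2_cases s; rewrite s0 s1 ?eqxx ?n01 !inordK /=;
  rewrite ?mul1r // anti ?mulN1r //.
Qed.

(** The permutations fall into six classes under antisymmetry in each factor;
exchanging the factors identifies these classes in pairs. *)
Lemma torsion_square_contractions (k : {perm 'I_4} -> R) : exists b1 b2 b3 : R, forall l : btriple -> R,
  (forall i j b, l (j, i, b) = - l (b, i, j)) -> forall a b,
  \sum_s k s * \sum_Q \sum_Q' contract4 l Q Q' (permute s (mk4 a b Q Q'))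
  = b1 * (\sum_Q \sum_Q' l (Q, Q, a) * l (Q', Q', b)) + b2 * (\sum_Q \sum_Q' l (Q', Q, a) * l (Q, Q', b))
    + b3 * (\sum_Q \sum_Q' l (Q, Q, Q') * l (a, Q', b)).
Proof.
pose goal (i0 i1 i2 i3 : 'I_4) := exists c : R * R * R, forall l : btriple -> R,
  (forall i j b, l (j, i, b) = - l (b, i, j)) -> forall a b,
  \sum_Q \sum_Q' l (mk4 a b Q Q' i0, Q, mk4 a b Q Q' i1) * l (mk4 a b Q Q' i2, Q', mk4 a b Q Q' i3)
  = c.1.1 * (\sum_Q \sum_Q' l (Q, Q, a) * l (Q', Q', b)) + c.1.2 * (\sum_Q \sum_Q' l (Q', Q, a) * l (Q, Q', b))
    + c.2 * (\sum_Q \sum_Q' l (Q, Q, Q') * l (a, Q', b)).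
have swap1 i0 i1 i2 i3 : goal i0 i1 i2 i3 -> goal i1 i0 i2 i3.
  move=> [c cP]; exists (- c.1.1, - c.1.2, - c.2) => l anti a b /=.
  transitivity (- (\sum_Q \sum_Q' l (mk4 a b Q Q' i0, Q, mk4 a b Q Q' i1) * l (mk4 a b Q Q' i2, Q', mk4 a b Q Q' i3))).
    rewrite -sumrN; apply: eq_bigr => Q _; rewrite -sumrN; apply: eq_bigr => Q' _.
    by rewrite anti mulNr.
  by rewrite cP //; ring.
have swap2 i0 i1 i2 i3 : goal i0 i1 i2 i3 -> goal i0 i1 i3 i2.
  move=> [c cP]; exists (- c.1.1, - c.1.2, - c.2) => l anti a b /=.
  transitivity (- (\sum_Q \sum_Q' l (mk4 a b Q Q' i0, Q, mk4 a b Q Q' i1) * l (mk4 a b Q Q' i2, Q', mk4 a b Q Q' i3))).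
    rewrite -sumrN; apply: eq_bigr => Q _; rewrite -sumrN; apply: eq_bigr => Q' _.
    by rewrite [X in _ * X = _]anti mulrN.
  by rewrite cP //; ring.
have sw i0 i1 i2 i3 : goal i0 i1 i2 i3 ->
    [/\ goal i0 i1 i2 i3, goal i1 i0 i2 i3, goal i0 i1 i3 i2 & goal i1 i0 i3 i2].
  by move=> g; split; [|apply: swap1|apply: swap2|apply/swap1/swap2].
pose e := fun i : nat => inord i : 'I_4.
have g0123 : goal (e 0) (e 1) (e 2) (e 3).
  exists (0, 0, -1) => l anti a b /=; rewrite !mul0r !add0r mulN1r exchange_big -sumrN.
  apply: eq_bigr => Q _; rewrite -sumrN; apply: eq_bigr => Q' _; rewrite /e !mk4E.
  by rewrite [X in _ * X = _]anti mulrN mulrC.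
have g2301 : goal (e 2) (e 3) (e 0) (e 1).
  exists (0, 0, 1) => l anti a b /=; rewrite !mul0r !add0r mul1r.
  by apply: eq_bigr => Q _; apply: eq_bigr => Q' _; rewrite /e !mk4E.
have g0213 : goal (e 0) (e 2) (e 1) (e 3).
  exists (1, 0, 0) => l anti a b /=; rewrite !mul0r !addr0 mul1r.
  apply: eq_bigr => Q _; apply: eq_bigr => Q' _; rewrite /e !mk4E.
  by rewrite anti [X in _ * X = _]anti mulrNN.
have g1302 : goal (e 1) (e 2) (e 0) (e 3).
  exists (1, 0, 0) => l anti a b /=; rewrite !mul0r !addr0 mul1r exchange_big.
  apply: eq_bigr => Q _; apply: eq_bigr => Q' _; rewrite /e !mk4E.
  by rewrite anti [X in _ * X = _]anti mulrNN mulrC.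
have g0312 : goal (e 0) (e 3) (e 1) (e 2).
  exists (0, 1, 0) => l anti a b /=; rewrite !mul0r add0r addr0 mul1r.
  apply: eq_bigr => Q _; apply: eq_bigr => Q' _; rewrite /e !mk4E.
  by rewrite anti [X in _ * X = _]anti mulrNN.
have g1203 : goal (e 1) (e 3) (e 0) (e 2).
  exists (0, 1, 0) => l anti a b /=; rewrite !mul0r add0r addr0 mul1r exchange_big.
  apply: eq_bigr => Q _; apply: eq_bigr => Q' _; rewrite /e !mk4E.
  by rewrite anti [X in _ * X = _]anti mulrNN mulrC.
have H (s : {perm 'I_4}) : goal (s (inord 0)) (s (inord 1)) (s (inord 2)) (s (inord 3)).
  have [h1 h2 h3 h4] := sw _ _ _ _ g0123; have [h5 h6 h7 h8] := sw _ _ _ _ g2301.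
  have [h9 h10 h11 h12] := sw _ _ _ _ g0213; have [h13 h14 h15 h16] := sw _ _ _ _ g1302.
  have [h17 h18 h19 h20] := sw _ _ _ _ g0312; have [h21 h22 h23 h24] := sw _ _ _ _ g1203.
  apply: perm4_cases => i0 i1 i2 i3; rewrite -/(e _).
  by case: (ord4_case i0) => ->; case: (ord4_case i1) => ->; rewrite -?/(e _);
    try (by rewrite /= !inE !eqxx); case: (ord4_case i2) => ->;
    try (by rewrite /= !inE !eqxx ?orbT); case: (ord4_case i3) => ->;
    try (by rewrite /= !inE !eqxx ?orbT ?andbF).
have [c cP] := choice H.
exists (\sum_s k s * (c s).1.1), (\sum_s k s * (c s).1.2), (\sum_s k s * (c s).2) => l anti a b.
rewrite !mulr_suml -!big_split; apply: eq_bigr => s _ /=.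
transitivity (k s * ((c s).1.1 * (\sum_Q \sum_Q' l (Q, Q, a) * l (Q', Q', b))
  + (c s).1.2 * (\sum_Q \sum_Q' l (Q', Q, a) * l (Q, Q', b))
  + (c s).2 * (\sum_Q \sum_Q' l (Q, Q, Q') * l (a, Q', b)))); last by ring.
rewrite -cP //; congr (_ * _); apply: eq_bigr => Q _; apply: eq_bigr => Q' _.
by rewrite /contract4 /permute ![finfun _ _]ffunE.
Qed.

End Shapes.

(** * A bounded coordinate change osculating the identity *)

Section Squash.
Variables (R : realType) (m : nat) (ep : R).
Hypothesis ep0 : 0 < ep.
Local Notation rV := 'rV[R]_m.
Let oT : open [set: rV] := openT.

(** The hyperbolic tangent of t / ep. *)
Definition sigmoid (t : R) : R := 1 - 2 * (expR (2 / ep * t) + 1)^-1.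

Lemma sigmoid0 : sigmoid 0 = 0.
Proof. by rewrite /sigmoid mulr0 expR0 -(natrD _ 1 1) divff ?subrr. Qed.

Lemma expD_neq0 (t : R) : expR t + 1 != 0.
Proof. by rewrite gt_eqF // addr_gt0 ?expR_gt0. Qed.

Lemma sigmoid_inj : injective sigmoid.
Proof.
move=> s t /(addrI 1) /oppr_inj /(mulfI _) H.
have /H /invr_inj /addIr /expR_inj /(mulfI _) : 2 != 0 :> R by [].
by apply; rewrite mulf_neq0 ?invr_eq0 ?gt_eqF.
Qed.

Lemma sigmoid_lt1 t : `|sigmoid t| < 1.
Proof.
have e0 := expR_gt0 (2 / ep * t).
have H : 0 < (expR (2 / ep * t) + 1)^-1 < 1.
  by rewrite invr_gt0 addr_gt0 //= invf_lt1 ?addr_gt0 // ltrDr.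
by rewrite /sigmoid ltr_norml; lra.
Qed.

Lemma coord_smooth k : smooth_on setT (fun z : rV => z 0 k : R^o).
Proof.
apply: (smooth_entry oT 0 k (M := fun z => z)).
by apply: (smooth_lin oT (l := idfun)) => x; exact: cvg_id.
Qed.

Lemma exp_coord_linear c k : linear (fun z : rV => c * z 0 k : R^o).
Proof. by move=> a u v; rewrite !mxE mulrDr scalerAr mulrCA. Qed.

Lemma exp_coord_continuous c k : continuous (fun z : rV => c * z 0 k : R^o).
Proof.
move=> z; apply: differentiable_continuous; apply: differentiableM => //.
exact: differentiable_coord.
Qed.

Lemma derive_exp_coord c k (x v : rV) :
  differentiable (fun z : rV => expR (c * z 0 k) : R^o) x /\
  'D_v (fun z : rV => expR (c * z 0 k) : R^o) x = c * v 0 k * expR (c * x 0 k).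
Proof.
have de (t : R) : differentiable (expR : R^o -> R^o) t by apply/derivable1_diffP; exact: derivable_expR.
split; first exact: (lin_comp_differentiable (exp_coord_linear c k) (@exp_coord_continuous c k) (de _)).
rewrite (lin_comp_derive (exp_coord_linear c k) (@exp_coord_continuous c k) v (de _)).
rewrite deriveE // -[X in 'd _ _ X]mulr1 [X in 'd _ _ X]/(_ *: 1) linearZ /= -deriveE //.
have -> : 'D_1 (expR : R^o -> R^o) (c * x 0 k) = expR (c * x 0 k).
  by case: (is_derive_expR (c * x 0 k)).
by [].
Qed.

Lemma smooth_exp_coord c k : smooth_on setT (fun z : rV => expR (c * z 0 k) : R^o).
Proof.
have dE x v := derive_exp_coord c k x v.
apply/(smooth_onP _) => j; elim: j => [|j IH]; split=> //; try by move=> x _; case: (dE x 0).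
move=> v.
apply: (Ck_eq oT (f := fun z : rV => c * v 0 k * expR (c * z 0 k))).
  by move=> x _; case: (derive_exp_coord c k x v).
by apply: CkM => //; apply: Ck_cst.
Qed.

Definition sig k (z : rV) : R^o := sigmoid (z 0 k).

Lemma smooth_sig k : smooth_on setT (sig k).
Proof.
apply: (smoothB oT) => //; first exact: smooth_cst.
apply: (smoothM oT) => //; first exact: smooth_cst.
apply: (smoothV oT) => [x _|]; first exact: expD_neq0.
by apply: (smoothD oT); [exact: smooth_exp_coord|exact: smooth_cst].
Qed.

(** Obtained by differentiating the product of expR + 1 and 1 - sig, which is
constant. *)
Lemma pd_sig l k z : pd l (sig k) z = (l == k)%:R / ep * (1 - sig k z ^+ 2).
Proof.
have ds := smooth_differentiable (smooth_sig k) (I : setT z).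
have [dE EE] := derive_exp_coord (2 / ep) k z (delta_mx 0 l).
set E := expR (2 / ep * z 0 k) in EE.
have Ep : E + 1 != 0 by exact: expD_neq0.
have H x : (expR (2 / ep * (x : rV) 0 k) + 1) * (1 - sig k x) = 2.
  by rewrite /sig /sigmoid subKr mulrCA divff ?mulr1 // expD_neq0.
have : pd l (fun x => (expR (2 / ep * x 0 k) + 1) * (1 - sig k x) : R^o) z = 0.
  by rewrite /pd (derive_scaler_eq _ _ H) derive_cst.
have d1 : differentiable (fun x : rV => expR (2 / ep * x 0 k) + 1 : R^o) z by apply: differentiableD.
have d2 : differentiable (fun x : rV => 1 - sig k x : R^o) z by apply: differentiableB.
rewrite /pd derive_scalarM // derive_scalarD // EE derive_cst addr0.
have -> : 'D_(delta_mx 0 l) (fun x : rV => 1 - sig k x : R^o) z = - 'D_(delta_mx 0 l) (sig k) z.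
  have dn : differentiable (fun x : rV => - sig k x : R^o) z by apply: differentiableN.
  rewrite derive_scalarD // derive_cst add0r; apply: deriveN.
  exact: diff_derivable.
rewrite mxE eqxx /= [k == l]eq_sym -/E => HH.
have sE : sig k z = 1 - 2 * (E + 1)^-1 by [].
move: HH; rewrite sE => /eqP; rewrite mulrN subr_eq0 => /eqP HH.
apply: (mulfI Ep); rewrite -HH.
have e0 : ep != 0 by rewrite gt_eqF.
by clear -Ep e0; move: ((l == k)%:R : R) => b; field; rewrite e0 Ep.
Qed.

(** With s = tanh (t / ep) this is ep (s + s^3 / 3).  The cubic term is chosen to make
the derivative with respect to t equal to 1 - s^4: the function is injective,
bounded by a multiple of ep, and agrees with t up to order four. *)
Definition squash k z : R^o := ep * (sig k z + 3^-1 * (sig k z * (sig k z * sig k z))).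

Lemma smooth_squash k : smooth_on setT (squash k).
Proof.
have ss := smooth_sig k.
apply: (smoothM oT); first exact: smooth_cst.
apply: (smoothD oT) => //; apply: (smoothM oT); first exact: smooth_cst.
by apply: (smoothM oT) => //; apply: (smoothM oT).
Qed.

Definition squash_slope l (z : rV) : R^o := 1 - sig l z * (sig l z * (sig l z * sig l z)).

Lemma pd_squash l k z : pd l (squash k) z = (l == k)%:R * squash_slope l z.
Proof.
have ds := smooth_differentiable (smooth_sig k) (I : setT z).
have d2 : differentiable (fun z => sig k z * sig k z : R^o) z by apply: differentiableM.
have d3 : differentiable (fun z => sig k z * (sig k z * sig k z) : R^o) z by apply: differentiableM.
have d4 : differentiable (fun z => 3^-1 * (sig k z * (sig k z * sig k z)) : R^o) z by apply: differentiableM.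
have d5 : differentiable (fun z => sig k z + 3^-1 * (sig k z * (sig k z * sig k z)) : R^o) z by apply: differentiableD.
have sE : 'D_(delta_mx 0 l) (sig k) z = _ := pd_sig l k z.
rewrite /pd /squash derive_scalarM // derive_scalarD // !derive_scalarM // !derive_cst !mul0r !add0r sE /squash_slope.
have e0 : ep != 0 by rewrite gt_eqF.
have [->|_] := eqVneq l k; last by rewrite !mul0r; ring.
by field; rewrite e0.
Qed.

Lemma squash_inj (z z' : rV) : (forall k, squash k z = squash k z') -> z = z'.
Proof.
move=> H; apply/rowP => k; have {H} := H k.
have e0 : ep != 0 by rewrite gt_eqF.
move=> /(mulfI e0) H; apply: sigmoid_inj; rewrite -/(sig k z) -/(sig k z').
move: H; move: (sig k z : R) (sig k z' : R) => s t H.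
have [//|/eqP st] := eqVneq s t; exfalso.
have : (s - t) * (1 + 3^-1 * (s * s + s * t + t * t)) = 0.
  transitivity ((s + 3^-1 * (s * (s * s))) - (t + 3^-1 * (t * (t * t)))); first by field.
  by rewrite H subrr.
move/eqP; rewrite mulf_eq0 subr_eq0 => /orP [/eqP //|]; apply/negP; rewrite gt_eqF //.
by have := sqr_ge0 (s + t); have := sqr_ge0 s; have := sqr_ge0 t; rewrite !expr2; nra.
Qed.

Lemma squash_lt k z : `|squash k z| < 2 * ep.
Proof.
rewrite /squash normrM gtr0_norm // mulrC ltr_pM2r //.
have := sigmoid_lt1 (z 0 k); rewrite -/(sig k z); move: (sig k z : R) => s s1.
apply: le_lt_trans (ler_normD _ _) _; rewrite !normrM.
have n0 := normr_ge0 s; rewrite (ger0_norm (x := 3^-1)) ?invr_ge0 //.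
have : `|s| * (`|s| * `|s|) <= 1.
  by have s1' := ltW s1; rewrite mulr_ile1 ?mulr_ge0 ?mulr_ile1.
by move: (_ * _ : R) => X X1; lra.
Qed.

Lemma squash0 k : squash k 0 = 0.
Proof. by rewrite /squash /sig mxE sigmoid0 !mul0r mulr0 addr0 mulr0. Qed.

Lemma smooth_slope l : smooth_on setT (squash_slope l).
Proof.
have ss := smooth_sig l.
apply: (smoothB oT); first exact: smooth_cst.
by do 3 (apply: (smoothM oT) => //).
Qed.

Lemma slope_gt0 l z : 0 < squash_slope l z.
Proof.
rewrite /squash_slope; have := sigmoid_lt1 (z 0 l); rewrite -/(sig l z); move: (sig l z : R) => s s1.
have n0 := normr_ge0 s.
rewrite subr_gt0; apply: le_lt_trans (ler_norm _) _; rewrite !normrM.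
have : `|s| * (`|s| * `|s|) <= 1.
  by have s1' := ltW s1; rewrite mulr_ile1 ?mulr_ge0 ?mulr_ile1.
by nra.
Qed.

Lemma pd_slope k l : exists2 u : rV -> R^o, smooth_on setT u &
  pd k (squash_slope l) =1 (fun z => sig l z * (sig l z * u z)).
Proof.
have ss := smooth_sig l.
exists (fun z => - 4 * ((k == l)%:R / ep) * sig l z * (1 - sig l z * sig l z)).
  apply: (smoothM oT); first by apply: (smoothM oT) => //; exact: smooth_cst.
  by apply: (smoothB oT); [exact: smooth_cst|apply: (smoothM oT)].
move=> z; have ds := smooth_differentiable ss (I : setT z).
have d2 : differentiable (fun z => sig l z * sig l z : R^o) z by apply: differentiableM.
have d3 : differentiable (fun z => sig l z * (sig l z * sig l z) : R^o) z by apply: differentiableM.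
have d4 : differentiable (fun z => sig l z * (sig l z * (sig l z * sig l z)) : R^o) z by apply: differentiableM.
have d5 : differentiable (fun z => - (sig l z * (sig l z * (sig l z * sig l z))) : R^o) z by apply: differentiableN.
have sE : 'D_(delta_mx 0 k) (sig l) z = _ := pd_sig k l z.
rewrite /pd /squash_slope derive_scalarD // derive_cst add0r.
have -> : 'D_(delta_mx 0 k) (fun z => - (sig l z * (sig l z * (sig l z * sig l z))) : R^o) z
  = - 'D_(delta_mx 0 k) (fun z => (sig l z * (sig l z * (sig l z * sig l z))) : R^o) z.
  by apply: deriveN; exact: diff_derivable.
by rewrite !derive_scalarM // sE; ring.
Qed.

Lemma sig0 l : sig l 0 = 0. Proof. by rewrite /sig mxE sigmoid0. Qed.

Lemma slope0 l : squash_slope l 0 = 1. Proof. by rewrite /squash_slope sig0 mul0r subr0. Qed.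

Lemma pd_slope0 k l : pd k (squash_slope l) 0 = 0.
Proof. by have [u _ ->] := pd_slope k l; rewrite sig0 mul0r. Qed.

Lemma pd2_slope0 j k l : pd j (pd k (squash_slope l)) 0 = 0.
Proof.
have [u su uE] := pd_slope k l.
have ds := smooth_differentiable (smooth_sig l) (I : setT (0 : rV)).
have du := smooth_differentiable su (I : setT (0 : rV)).
have d2 : differentiable (fun z => sig l z * u z : R^o) 0 by apply: differentiableM.
transitivity (pd j (fun z => sig l z * (sig l z * u z) : R^o) 0).
  by apply: derive_scaler_eq.
by rewrite /pd !derive_scalarM // sig0 !mul0r mulr0 !addr0.
Qed.

End Squash.

(** * Charts with prescribed jets *)

Section Poly3.
Variables (R : realType) (m : nat).
Local Notation rV := 'rV[R]_m.
Let oT : open [set: rV] := openT.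

(** A polynomial map of degree three with the 3-jet (c, a, b, d) at the origin, if b
and d are symmetric.  In nested form its partial derivatives are of the same form. *)
Definition poly3 (c : R) (a : 'I_m -> R) (b : 'I_m -> 'I_m -> R) (d : 'I_m -> 'I_m -> 'I_m -> R) (x : rV) : R^o :=
  c + \sum_k x 0 k * (a k + \sum_l x 0 l * (2^-1 * b k l + \sum_j x 0 j * (6^-1 * d k l j))).

Lemma poly3_0 c a b d : poly3 c a b d 0 = c.
Proof. by rewrite /poly3 big1 ?addr0 // => k _; rewrite mxE mul0r. Qed.

Lemma smooth_poly3 c a b d : smooth_on setT (poly3 c a b d).
Proof.
apply: (smoothD oT); first exact: smooth_cst.
apply: (smooth_sum oT) => k; apply: (smoothM oT); first exact: coord_smooth.
apply: (smoothD oT); first exact: smooth_cst.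
apply: (smooth_sum oT) => l; apply: (smoothM oT); first exact: coord_smooth.
apply: (smoothD oT); first exact: smooth_cst.
apply: (smooth_sum oT) => j; apply: (smoothM oT); first exact: coord_smooth.
exact: smooth_cst.
Qed.

Lemma derive_horner (c : R) (G : 'I_m -> rV -> R^o) k x : (forall l, differentiable (G l) x) ->
  pd k (fun x => c + \sum_l x 0 l * G l x : R^o) x = G k x + \sum_l x 0 l * pd k (G l) x.
Proof.
move=> dG; have dk a : differentiable (fun x : rV => x 0 a : R^o) x by exact: differentiable_coord.
have dd a : differentiable (fun x : rV => x 0 a * G a x : R^o) x by apply: differentiableM.
rewrite /pd derive_scalarD //; last by apply: differentiable_bigsum.
rewrite derive_cst add0r derive_sumM // big_split; congr (_ + _) => /=.
rewrite (bigD1 k) //= [X in X * _](pd_coord k k x) eqxx mul1r big1 ?addr0 // => l lk.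
by rewrite [X in X * _](pd_coord k l x) eq_sym (negPf lk) mul0r.
Qed.

Lemma pd_poly3 c a b d k x :
  (forall k l, b k l = b l k) -> (forall k l j, d k l j = d l k j) -> (forall k l j, d k l j = d k j l) ->
  pd k (poly3 c a b d) x = poly3 (a k) (b k) (d k) (fun _ _ _ => 0) x.
Proof.
move=> sb sd1 sd2.
pose G2 k l (x : rV) : R^o := 2^-1 * b k l + \sum_j x 0 j * (6^-1 * d k l j).
pose G1 k (x : rV) : R^o := a k + \sum_l x 0 l * G2 k l x.
have dG2 k' l : differentiable (G2 k' l) x.
  apply: differentiableD => //; apply: differentiable_bigsum => j; apply: differentiableM => //.
  exact: differentiable_coord.
have dG1 k' : differentiable (G1 k') x.
  apply: differentiableD => //; apply: differentiable_bigsum => j; apply: differentiableM => //.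
  exact: differentiable_coord.
have E2 k' l : pd k (G2 k' l) x = 6^-1 * d k' l k.
  rewrite derive_horner // big1 ?addr0 // => j _.
  by rewrite /pd derive_cst mulr0.
have E1 k' : pd k (G1 k') x = G2 k' k x + \sum_l x 0 l * (6^-1 * d k' l k).
  by rewrite derive_horner //; congr (_ + _); apply: eq_bigr => l _; rewrite E2.
transitivity (G1 k x + \sum_l x 0 l * pd k (G1 l) x); first exact: derive_horner.
under eq_bigr do rewrite E1.
rewrite /G1 /poly3 -addrA; congr (_ + _); rewrite -big_split; apply: eq_bigr => l _ /=.
rewrite -mulrDr; congr (_ * _); rewrite /G2 (sb l k).
transitivity (b k l + (\sum_j x 0 j * (6^-1 * d k l j) + \sum_j x 0 j * (6^-1 * d l k j) + \sum_j x 0 j * (6^-1 * d l j k))).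
  by field.
congr (_ + _); rewrite -!big_split; apply: eq_bigr => j _ /=.
rewrite big1 => [|i _]; last by rewrite !mulr0.
by rewrite (sd1 l k j) (sd2 l j k) (sd1 l k j); field.
Qed.

End Poly3.

Section Hadamard.
Variables (R : realType) (m : nat).
Local Notation rV := 'rV[R]_m.
Local Notation rV2 := ('rV[R]_m * 'rV[R]_m)%type.
Let oT : open [set: rV] := openT.
Let oT2 : open [set: rV2] := openT.

(** Factorization of differences with smooth coefficients, as in the Hadamard lemma.
It is stable under sums and products, and it yields local injectivity from linear
algebra. *)
Definition hadamard (G : rV -> R^o) := smooth_on setT G /\ exists2 N : 'I_m -> rV2 -> R^o,
  (forall k, smooth_on setT (N k)) &
  forall x x', G x - G x' = \sum_k (x 0 k - x' 0 k) * N k (x, x').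

Lemma smooth_fst (G : rV -> R^o) : smooth_on setT G -> smooth_on [set: rV2] (fun z => G z.1 : R^o).
Proof. by move=> sG; apply: (lin_comp_smooth (l := fst)) sG => // x; exact: cvg_fst. Qed.

Lemma smooth_snd (G : rV -> R^o) : smooth_on setT G -> smooth_on [set: rV2] (fun z => G z.2 : R^o).
Proof. by move=> sG; apply: (lin_comp_smooth (l := snd)) sG => // x; exact: cvg_snd. Qed.

Lemma hadamard_cst c : hadamard (fun _ => c).
Proof.
split; first exact: smooth_cst.
exists (fun _ _ => 0) => [k|x x']; first exact: smooth_cst.
by rewrite subrr big1 // => k _; rewrite mulr0.
Qed.

Lemma hadamard_coord k : hadamard (fun x => x 0 k).
Proof.
split; first exact: coord_smooth.
exists (fun l _ => (l == k)%:R) => [l|x x']; first exact: smooth_cst.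
rewrite (bigD1 k) //= eqxx mulr1 big1 ?addr0 // => l /negPf ->; exact: mulr0.
Qed.

Lemma hadamardD G H : hadamard G -> hadamard H -> hadamard (fun x => G x + H x).
Proof.
move=> [sG [N sN NE]] [sH [M sM ME]]; split; first exact: (smoothD oT).
exists (fun k z => N k z + M k z) => [k|x x']; first exact: (smoothD oT2).
rewrite opprD addrACA NE ME -big_split; apply: eq_bigr => k _ /=; by rewrite mulrDr.
Qed.

Lemma hadamardM G H : hadamard G -> hadamard H -> hadamard (fun x => G x * H x).
Proof.
move=> [sG [N sN NE]] [sH [M sM ME]]; split; first exact: (smoothM oT).
exists (fun k z => N k z * H z.1 + G z.2 * M k z) => [k|x x'].
  by apply: (smoothD oT2); apply: (smoothM oT2) => //; [exact: smooth_fst|exact: smooth_snd].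
transitivity ((G x - G x') * H x + G x' * (H x - H x')); first by rewrite mulrBl mulrBr addrA subrK.
rewrite NE ME mulr_suml mulr_sumr -big_split; apply: eq_bigr => k _ /=; ring.
Qed.

Lemma hadamard_sum (T : finType) (G : T -> rV -> R^o) :
  (forall t, hadamard (G t)) -> hadamard (fun x => \sum_t G t x).
Proof.
move=> HG; split; first by apply: (smooth_sum oT) => t; case: (HG t).
have /choice [N NP] t : exists N : 'I_m -> rV2 -> R^o, (forall k, smooth_on setT (N k)) /\
  forall x x', G t x - G t x' = \sum_k (x 0 k - x' 0 k) * N k (x, x').
  by case: (HG t) => _ [N sN NE]; exists N.
exists (fun k z => \sum_t N t k z) => [k|x x'].
  by apply: (smooth_sum oT2) => t; case: (NP t).
rewrite -sumrB; under [RHS]eq_bigr do rewrite mulr_sumr.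
by rewrite exchange_big; apply: eq_bigr => t _ /=; case: (NP t) => _ ->.
Qed.

Lemma hadamard_poly3 c a b d : hadamard (poly3 c a b d).
Proof.
apply: hadamardD; first exact: hadamard_cst.
apply: hadamard_sum => k; apply: hadamardM; first exact: hadamard_coord.
apply: hadamardD; first exact: hadamard_cst.
apply: hadamard_sum => l; apply: hadamardM; first exact: hadamard_coord.
apply: hadamardD; first exact: hadamard_cst.
apply: hadamard_sum => j; apply: hadamardM; first exact: hadamard_coord.
exact: hadamard_cst.
Qed.

Lemma hadamard_pd (G : rV -> R^o) (N : 'I_m -> rV2 -> R^o) k : (forall k, smooth_on setT (N k)) ->
  (forall x x' : rV, G x - G x' = \sum_k (x 0 k - x' 0 k) * N k (x, x')) -> N k (0, 0) = pd k G 0.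
Proof.
move=> sN NE.
have dN l : differentiable (fun x : rV => N l (x, 0) : R^o) 0.
  have dp : differentiable (fun x : rV => (x, 0 : rV)) 0 by apply: differentiable_pair.
  exact: (differentiable_comp dp (smooth_differentiable (sN l) I)).
rewrite -[RHS](derive_scaler_eq (V := rV) (f := fun x : rV => G 0 + \sum_l x 0 l * N l (x, 0) : R^o)).
  rewrite -/(pd _ _ _) derive_horner // big1 ?addr0 // => l _; by rewrite mxE mul0r.
by move=> x; have := NE x 0; under eq_bigr do rewrite mxE subr0; move=> <-; rewrite addrC subrK.
Qed.

(** The differences of the values of F are obtained from those of the arguments by a
matrix that depends continuously on both points and is the identity at the origin. *)
Lemma local_injective (F : 'I_m -> rV -> R^o) : (forall i, hadamard (F i)) ->
  (forall k i, pd k (F i) 0 = (k == i)%:R) ->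
  \forall z \near (0 : rV2), (forall i, F i z.1 = F i z.2) -> z.1 = z.2.
Proof.
move=> HF F0.
have /choice [N NP] i : exists N : 'I_m -> rV2 -> R^o, (forall k, smooth_on setT (N k)) /\
  forall x x', F i x - F i x' = \sum_k (x 0 k - x' 0 k) * N k (x, x').
  by case: (HF i) => _ [N sN NE]; exists N.
pose M (z : rV2) := \matrix_(k, i) N i k z.
have sM : smooth_on setT M.
  by apply: (smooth_mx oT2) => k i; apply: (smooth_eq oT2) (_ : smooth_on _ (N i k)) => [x _|]; rewrite ?mxE //; case: (NP i).
have M0 : M 0 = 1%:M.
  apply/matrixP => k i; rewrite !mxE; case: (NP i) => sN NE.
  by rewrite -[0 : rV2]/(0, 0) (hadamard_pd k sN NE) F0.
have cdet : {for (0 : rV2), continuous (fun z => \det (M z) : R^o)}.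
  apply: differentiable_continuous; exact: (smooth_differentiable (smooth_det oT2 sM) I).
have near1 : \forall z \near (0 : rV2), \det (M z) != 0.
  have E : \det (M 0) != 0 by rewrite M0 det1 oner_neq0.
  exact: (cvgr_neq0 _ cdet E).
near=> z => Fz.
have : (z.1 - z.2) *m M z = 0.
  apply/rowP => i; rewrite !mxE; case: (NP i) => _ NE.
  transitivity (F i z.1 - F i z.2); last by rewrite Fz subrr.
  by rewrite NE; apply: eq_bigr => k _; rewrite !mxE -surjective_pairing.
have uM : M z \in unitmx by rewrite unitmxE unitfE; near: z.
move/(congr1 (mulmx^~ (invmx (M z)))); rewrite mulmxK // mul0mx => /eqP.
by rewrite subr_eq0 => /eqP.
Unshelve. all: by end_near. Qed.

End Hadamard.

Section Chart.
Variables (R : realType) (m : nat) (ep : R).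
Hypothesis ep0 : 0 < ep.
Local Notation rV := 'rV[R]_m.
Let oT : open [set: rV] := openT.

Definition squash_map (z : rV) : rV := \row_k squash ep k z.

Lemma smooth_squash_map : smooth_on setT squash_map.
Proof.
apply: (smooth_mx oT) => i k; apply: (smooth_eq oT (f := squash ep k)) (smooth_squash ep k) => x _.
by rewrite mxE.
Qed.

Let dmap z : differentiable squash_map z := smooth_differentiable smooth_squash_map I.

Lemma squash_map0 : squash_map 0 = 0.
Proof. by apply/rowP => k; rewrite !mxE squash0. Qed.

Lemma jacobian_squash z l k : 'J squash_map z l k = (l == k)%:R * squash_slope ep l z.
Proof.
rewrite (jacobianE l k (dmap z)) -(pd_squash ep0).
have -> : pd l (squash ep k) z = pd l (fun y => squash_map y 0 k : R^o) z; last by [].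
by apply: derive_scaler_eq => y; rewrite mxE.
Qed.

Lemma jacobian_squash_unit z : 'J squash_map z \in unitmx.
Proof.
have -> : 'J squash_map z = diag_mx (\row_l squash_slope ep l z).
  apply/matrixP => l k; rewrite jacobian_squash !mxE mulrC mulr_natr.
  by case: eqP => // ->.
rewrite unitmxE det_diag unitfE; apply/prodf_neq0 => l _.
by rewrite mxE gt_eqF // slope_gt0.
Qed.

(** The coordinate change is diagonal, so the chain rule has a single term; its factor
is 1 up to order three, and derivatives at the origin up to order three are not
affected. *)
Lemma pd_comp_squash (g : rV -> R^o) l z : smooth_on setT g ->
  pd l (fun z => g (squash_map z) : R^o) z = squash_slope ep l z * pd l g (squash_map z).
Proof.
move=> sg; rewrite (pd_comp (g := g) l (dmap z) (smooth_differentiable sg I)).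
rewrite (bigD1 l) //= jacobian_squash eqxx mul1r big1 ?addr0 // => k kl.
by rewrite jacobian_squash eq_sym (negPf kl) !mul0r.
Qed.

Lemma pd0_comp_squash (g : rV -> R^o) l : smooth_on setT g ->
  pd l (fun z => g (squash_map z) : R^o) 0 = pd l g 0.
Proof. by move=> sg; rewrite pd_comp_squash // slope0 mul1r squash_map0. Qed.

Lemma smooth_comp_squash (g : rV -> R^o) : smooth_on setT g -> smooth_on setT (fun z => g (squash_map z) : R^o).
Proof. by move=> sg; apply: (smooth_comp oT oT) sg => //; exact: smooth_squash_map. Qed.

Lemma pd2_comp_squash (g : rV -> R^o) k l : smooth_on setT g ->
  pd k (pd l (fun z => g (squash_map z) : R^o)) 0 = pd k (pd l g) 0.
Proof.
move=> sg; have sl := smooth_slope (m := m) ep l.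
have sgl := smooth_pd l sg.
transitivity (pd k (fun z => squash_slope ep l z * pd l g (squash_map z) : R^o) 0).
  by apply: derive_scaler_eq => z; exact: pd_comp_squash.
rewrite /pd derive_scalarM; [|exact: smooth_differentiable sl I|exact: smooth_differentiable (smooth_comp_squash sgl) I].
rewrite slope0 mul1r [X in X * _](pd_slope0 ep0 k l) mul0r add0r.
exact: (pd0_comp_squash k sgl).
Qed.

Lemma pd3_comp_squash (g : rV -> R^o) j k l : smooth_on setT g ->
  pd j (pd k (pd l (fun z => g (squash_map z) : R^o))) 0 = pd j (pd k (pd l g)) 0.
Proof.
move=> sg; have sl := smooth_slope (m := m) ep l.
have sgl := smooth_pd l sg; have dl z := smooth_differentiable sl (I : setT z).
have dgl z := smooth_differentiable (smooth_comp_squash sgl) (I : setT z).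
have dkl := smooth_differentiable (smooth_pd k sl) (I : setT (0 : rV)).
have dkg := smooth_differentiable (smooth_pd k (smooth_comp_squash sgl)) (I : setT (0 : rV)).
transitivity (pd j (fun z => pd k (squash_slope ep l) z * pd l g (squash_map z)
    + squash_slope ep l z * pd k (fun z => pd l g (squash_map z) : R^o) z : R^o) 0).
  apply: derive_scaler_eq => z.
  transitivity (pd k (fun z => squash_slope ep l z * pd l g (squash_map z) : R^o) z).
    by apply: derive_scaler_eq => z'; exact: pd_comp_squash.
  by rewrite /pd derive_scalarM.
rewrite /pd derive_scalarD; [|exact: differentiableM|exact: differentiableM].
have e1 : 'D_(delta_mx 0 j) ('D_(delta_mx 0 k) (squash_slope ep l)) 0 = 0 := pd2_slope0 ep0 j k l.
have e2 : 'D_(delta_mx 0 k) (squash_slope ep l) 0 = 0 := pd_slope0 ep0 k l.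
have e3 : 'D_(delta_mx 0 j) (squash_slope ep l) 0 = 0 := pd_slope0 ep0 j l.
rewrite [X in X + _]derive_scalarM // [X in _ + X]derive_scalarM //.
have alg (a b c d e f p h s : R) : a = 0 -> c = 0 -> e = 0 -> p = 1 -> h = s ->
  a * b + c * d + (e * f + p * h) = s.
  by move=> -> -> -> -> ->; rewrite !mul0r !add0r mul1r.
exact: (alg _ _ _ _ _ _ _ _ _ e1 e2 e3 (slope0 ep l) (pd2_comp_squash j k sgl)).
Qed.

End Chart.

(** Near the origin the polynomial map with the given 3-jet is injective and
nondegenerate, and precomposing it with a squash map confines it to this
neighbourhood without changing the 3-jet. *)
Theorem normal_chart (R : realType) (m n : nat) (D : set 'rV[R]_m) (x0 : 'rV[R]_m)
  (J2 : 'I_m -> 'I_m -> 'I_m -> R) (J3 : 'I_m -> 'I_m -> 'I_m -> 'I_m -> R)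
  (A1 : 'I_n -> 'I_n -> 'I_m -> R) (A2 : 'I_n -> 'I_n -> 'I_m -> 'I_m -> R) :
  open D -> D x0 ->
  (forall i k l, J2 i k l = J2 i l k) ->
  (forall i k l j, J3 i k l j = J3 i l k j) -> (forall i k l j, J3 i k l j = J3 i k j l) ->
  (forall p i k l, A2 p i k l = A2 p i l k) ->
  exists (f : 'rV[R]_m -> 'rV[R]_m) (A : 'rV[R]_m -> 'M[R]_n),
  [/\ [/\ smooth_on setT f, injective f, forall z, D (f z) & forall z, 'J f z \in unitmx],
      smooth_on setT A /\ (forall z, A z \in unitmx),
      f 0 = x0 /\ A 0 = 1%:M,
      [/\ forall i l, pd l (fun z => f z 0 i : R^o) 0 = (l == i)%:R,
          forall i k l, pd k (pd l (fun z => f z 0 i : R^o)) 0 = J2 i k l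
        & forall i j k l, pd j (pd k (pd l (fun z => f z 0 i : R^o))) 0 = J3 i j k l]
    & (forall p i l, pd l (fun z => A z p i : R^o) 0 = A1 p i l) /\
      (forall p i k l, pd k (pd l (fun z => A z p i : R^o)) 0 = A2 p i k l)].
Proof.
move=> oD Dx0 sJ2 sJ3 sJ3' sA2.
have oT : open [set: 'rV[R]_m] := openT.
pose F i := poly3 (x0 0 i) (fun k => (k == i)%:R) (J2 i) (J3 i).
pose B p i := poly3 (p == i)%:R (A1 p i) (A2 p i) (fun _ _ _ => 0).
pose Fv x : 'rV[R]_m := \row_i F i x.
pose Bv x : 'M[R]_n := \matrix_(p, i) B p i x.
have sF i : smooth_on setT (F i) by exact: smooth_poly3.
have sB p i : smooth_on setT (B p i) by exact: smooth_poly3.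
have sFv : smooth_on setT Fv.
  by apply: (smooth_mx oT) => o i; apply: (smooth_eq oT _ (sF i)) => x _; rewrite mxE.
have sBv : smooth_on setT Bv.
  by apply: (smooth_mx oT) => p i; apply: (smooth_eq oT _ (sB p i)) => x _; rewrite mxE.
have dFv x : differentiable Fv x := smooth_differentiable sFv I.
have F1 i l x : pd l (F i) x = poly3 (l == i)%:R (J2 i l) (J3 i l) (fun _ _ _ => 0) x by exact: pd_poly3.
have F2 i k l x : pd k (pd l (F i)) x = poly3 (J2 i l k) (J3 i l k) (fun _ _ => 0) (fun _ _ _ => 0) x.
  transitivity (pd k (poly3 (l == i)%:R (J2 i l) (J3 i l) (fun _ _ _ => 0)) x); last exact: pd_poly3.
  by apply: derive_scaler_eq => z; exact: F1.
have F3 i j k l x : pd j (pd k (pd l (F i))) x = poly3 (J3 i l k j) (fun _ => 0) (fun _ _ => 0) (fun _ _ _ => 0) x.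
  transitivity (pd j (poly3 (J2 i l k) (J3 i l k) (fun _ _ => 0) (fun _ _ _ => 0)) x); last exact: pd_poly3.
  by apply: derive_scaler_eq => z; exact: F2.
have B1 p i l x : pd l (B p i) x = poly3 (A1 p i l) (A2 p i l) (fun _ _ => 0) (fun _ _ _ => 0) x.
  by exact: pd_poly3.
have B2 p i k l x : pd k (pd l (B p i)) x = poly3 (A2 p i l k) (fun _ => 0) (fun _ _ => 0) (fun _ _ _ => 0) x.
  transitivity (pd k (poly3 (A1 p i l) (A2 p i l) (fun _ _ => 0) (fun _ _ _ => 0)) x); last exact: pd_poly3.
  by apply: derive_scaler_eq => z; exact: B1.
have Fv0 : Fv 0 = x0 by apply/rowP => i; rewrite mxE; exact: poly3_0.
have Bv0 : Bv 0 = 1%:M by apply/matrixP => p i; rewrite mxE [RHS]mxE; exact: poly3_0.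
have JF0 : 'J Fv 0 = 1%:M.
  apply/matrixP => l i; rewrite (jacobianE l i (dFv 0)) [RHS]mxE.
  transitivity (pd l (F i) 0); first by apply: derive_scaler_eq => y; rewrite mxE.
  by apply: etrans (F1 i l 0) _; exact: poly3_0.
have near1 : \forall x \near (0 : 'rV[R]_m), D (Fv x).
  have : nbhs (Fv 0) D by rewrite Fv0; exact: open_nbhs_nbhs.
  exact: (differentiable_continuous (dFv 0)).
have nearunit k (M : 'rV[R]_m -> 'M[R]_k) : smooth_on setT M -> M 0 = 1%:M ->
    \forall x \near (0 : 'rV[R]_m), M x \in unitmx.
  move=> sM M0.
  have cd : {for 0, continuous (fun z => \det (M z) : R^o)}.
    apply: differentiable_continuous; exact: (smooth_differentiable (smooth_det oT sM) I).
  have E : \det (M 0) != 0 by rewrite M0 det1 oner_neq0.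
  by near=> x; rewrite unitmxE unitfE; near: x; exact: (cvgr_neq0 _ cd E).
have near2 := nearunit _ _ (smooth_jacobian oT sFv) JF0.
have near3 := nearunit _ _ sBv Bv0.
have near4 : \forall z \near (0 : 'rV[R]_m * 'rV[R]_m), (forall i, F i z.1 = F i z.2) -> z.1 = z.2.
  by apply: local_injective => [i|k i]; [exact: hadamard_poly3|rewrite F1 poly3_0].
have near123 : \forall x \near (0 : 'rV[R]_m), [/\ D (Fv x), 'J Fv x \in unitmx & Bv x \in unitmx].
  by near=> x; split; near: x.
have /nbhs_ballP [r1 /= r10 r1P] := near123; have /nbhs_ballP [r2 /= r20 r2P] := near4.
(* the squash map takes values below 2 ep *)
pose ep := 2^-1 * Num.min r1 r2.
have ep0 : 0 < ep by rewrite mulr_gt0 ?invr_gt0 // lt_min r10.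
pose psi := @squash_map R m ep.
have psiE z k : psi z 0 k = squash ep k z by rewrite mxE.
have psi_ball r z : Num.min r1 r2 <= r -> ball (0 : 'rV[R]_m) r (psi z).
  move=> mr; split; first by apply: lt_le_trans mr; rewrite lt_min r10.
  move=> o k; rewrite ord1 psiE mxE; rewrite /ball /= sub0r normrN.
  by apply: lt_le_trans (squash_lt ep0 k z) _; rewrite mulrA divff ?mul1r.
have psi1 z : ball (0 : 'rV[R]_m) r1 (psi z) by apply: psi_ball; rewrite ge_min lexx.
have psi2 z : ball (0 : 'rV[R]_m) r2 (psi z) by apply: psi_ball; rewrite ge_min lexx orbT.
have spsi : smooth_on setT psi by exact: smooth_squash_map.
have dpsi z : differentiable psi z := smooth_differentiable spsi I.
have psi0 : psi 0 = 0 by exact: squash_map0.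
exists (fun z => Fv (psi z)), (fun z => Bv (psi z)); split.
- split.
  + apply: (smooth_mx oT) => o i; apply: (smooth_eq oT (f := fun z => F i (psi z))); last exact: smooth_comp_squash.
    by move=> x _; rewrite mxE.
  + move=> z z' fz; apply: (squash_inj ep0) => k; rewrite -!psiE.
    suff -> : psi z = psi z' by [].
    apply: (r2P (psi z, psi z')); first by split; exact: psi2.
    by move=> i /=; have := congr1 (fun v : 'rV_m => v 0 i) fz; rewrite !mxE.
  + by move=> z; have [] := r1P _ (psi1 z).
  + move=> z; have -> : 'J (fun z => Fv (psi z)) z = 'J psi z *m 'J Fv (psi z).
      exact: jacobian_comp.
    rewrite unitmx_mul; apply/andP; split; first exact: jacobian_squash_unit.
    by have [] := r1P _ (psi1 z).
- split; last by move=> z; have [] := r1P _ (psi1 z).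
  apply: (smooth_mx oT) => p i; apply: (smooth_eq oT (f := fun z => B p i (psi z))); last exact: smooth_comp_squash.
  by move=> x _; rewrite mxE.
- by rewrite psi0.
- have fE i : (fun z => Fv (psi z) 0 i : R^o) = (fun z => F i (psi z)).
    by apply/funext => z; rewrite mxE.
  split=> [i l|i k l|i j k l]; rewrite fE.
  + apply: etrans (pd0_comp_squash ep0 l (sF i)) _; rewrite F1; exact: poly3_0.
  + apply: etrans (pd2_comp_squash ep0 k l (sF i)) _; rewrite F2 sJ2; exact: poly3_0.
  + apply: etrans (pd3_comp_squash ep0 j k l (sF i)) _; rewrite F3 sJ3' sJ3 sJ3'; exact: poly3_0.
- have AE p i : (fun z => Bv (psi z) p i : R^o) = (fun z => B p i (psi z)).
    by apply/funext => z; rewrite mxE.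
  split=> [p i l|p i k l]; rewrite AE.
  + apply: etrans (pd0_comp_squash ep0 l (sB p i)) _; rewrite B1; exact: poly3_0.
  + apply: etrans (pd2_comp_squash ep0 k l (sB p i)) _; rewrite B2 sA2; exact: poly3_0.
Unshelve. all: by end_near. Qed.

(** * Normal coordinates adapted to a pair of connections *)

Section JetTransport.
Variables (R : realType) (m k : nat).
Local Notation rV := 'rV[R]_m.
Let oT : open [set: rV] := openT.
Variables (f : rV -> rV) (A : rV -> 'M[R]_k) (D : set rV) (K0 K : lcomp R m k) (x0 : rV).
Hypothesis sf : smooth_on setT f.
Hypothesis sA : smooth_on setT A.
Hypothesis uJ : forall z, 'J f z \in unitmx.

Hypothesis Dx0 : D x0.
Hypothesis sK0 : smooth_comps K0.
Hypothesis sK : forall j i l, smooth_on D (fun x => K x j i l : R^o).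
Hypothesis rel : forall z, lrelated f A K0 K z.
Hypothesis f0 : f 0 = x0.
Hypothesis A0 : A 0 = 1%:M.
Hypothesis f1 : forall i l, pd l (fun z => f z 0 i : R^o) 0 = (l == i)%:R.

Let fc i : rV -> R^o := fun z => f z 0 i.
Let Ac j i : rV -> R^o := fun z => A z j i.

Let sfc i : smooth_on setT (fc i). Proof. exact: (smooth_entry oT). Qed.
Let sAc j i : smooth_on setT (Ac j i). Proof. exact: (smooth_entry oT). Qed.
Let Ac0 j i : Ac j i 0 = (j == i)%:R. Proof. by rewrite /Ac A0 mxE. Qed.

Let law z j i l : \sum_p K0 z j p l * Ac p i z + pd l (Ac j i) z
  = \sum_l' pd l (fc l') z * \sum_q Ac j q z * K (f z) q i l'.
Proof.
rewrite (lrelated_components j i l (smooth_differentiable sA I) (uJ z) (rel z)).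
by apply: eq_bigr => l' _; rewrite (jacobianE l l' (smooth_differentiable sf I)).
Qed.

Lemma transported_value j i l : K0 0 j i l = K x0 j i l - pd l (fun z => A z j i : R^o) 0.
Proof.
have := law 0 j i l.
under eq_bigr do rewrite Ac0; rewrite sum_pickr.
under [X in _ = X -> _]eq_bigr do rewrite [X in X * _]f1.
rewrite sum_pickl; under [X in _ = X -> _]eq_bigr do rewrite Ac0; rewrite sum_pickl f0 => <-.
by rewrite addrK.
Qed.

(** The transformation law of the components, differentiated at the origin. *)
Lemma transported_derivative b j i l :
  pd b (fun x => K0 x j i l) 0 = pd b (fun x => K x j i l) x0
  + \sum_l' pd b (pd l (fun z => f z 0 l' : R^o)) 0 * K x0 j i l'
  + \sum_q pd b (fun z => A z j q : R^o) 0 * K x0 q i l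
  - pd b (pd l (fun z => A z j i : R^o)) 0
  - \sum_p K0 0 j p l * pd b (fun z => A z p i : R^o) 0.
Proof.
have df z : differentiable f z := smooth_differentiable sf I.
have dK0 p : differentiable (fun x => K0 x j p l : R^o) 0 := smooth_differentiable (sK0 j p l) I.
have dA q q' : differentiable (Ac q q') 0 := smooth_differentiable (sAc q q') I.
have dA1 : differentiable (pd l (Ac j i)) 0 := smooth_differentiable (smooth_pd l (sAc j i)) I.
have df1 l' : differentiable (pd l (fc l')) 0 := smooth_differentiable (smooth_pd l (sfc l')) I.
have dK q l' : differentiable (fun x => K x q i l' : R^o) (f 0).
  by rewrite f0; exact: (smooth_differentiable (sK q i l') Dx0).
have dKf q l' : differentiable (fun z => K (f z) q i l' : R^o) 0.
  exact: (differentiable_comp (df 0) (dK q l')).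
have dKA p : differentiable (fun z => K0 z j p l * Ac p i z : R^o) 0 by apply: differentiableM.
have dAK l' q : differentiable (fun z => Ac j q z * K (f z) q i l' : R^o) 0 by apply: differentiableM.
have dS l' : differentiable (fun z => \sum_q Ac j q z * K (f z) q i l' : R^o) 0.
  exact: differentiable_bigsum.
have dKb q l' : pd b (fun z => K (f z) q i l' : R^o) 0 = pd b (fun x => K x q i l') x0.
  apply: etrans (pd_comp b (df 0) (dK q l')) _; rewrite f0.
  transitivity (\sum_c (b == c)%:R * pd c (fun x => K x q i l') x0); last exact: (sum_pickl b (fun c => pd c (fun x => K x q i l') x0)).
  by apply: eq_bigr => c _; rewrite (jacobianE b c (df 0)) f1.
have E : pd b (fun z => \sum_p K0 z j p l * Ac p i z + pd l (Ac j i) z : R^o) 0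
  = pd b (fun z => \sum_l' pd l (fc l') z * \sum_q Ac j q z * K (f z) q i l' : R^o) 0.
  by apply: derive_scaler_eq => z; exact: law.
have LE : pd b (fun z => \sum_p K0 z j p l * Ac p i z + pd l (Ac j i) z : R^o) 0
  = pd b (fun x => K0 x j i l) 0 + \sum_p K0 0 j p l * pd b (Ac p i) 0 + pd b (pd l (Ac j i)) 0.
  apply: etrans (derive_scalarD _ (differentiable_bigsum _ _ dKA) dA1) _; congr (_ + _).
  apply: etrans (derive_sumM _ dK0 (fun p => dA p i)) _.
  rewrite big_split; congr (_ + _) => /=.
  by under eq_bigr do rewrite Ac0; rewrite sum_pickr.
have RE : pd b (fun z => \sum_l' pd l (fc l') z * \sum_q Ac j q z * K (f z) q i l' : R^o) 0
  = \sum_l' pd b (pd l (fc l')) 0 * K x0 j i l'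
    + (\sum_q pd b (Ac j q) 0 * K x0 q i l + pd b (fun x => K x j i l) x0).
  apply: etrans (derive_sumM _ df1 dS) _; rewrite big_split; congr (_ + _) => /=.
    apply: eq_bigr => l' _; congr (_ * _).
    by under eq_bigr do rewrite Ac0; rewrite sum_pickl f0.
  under eq_bigr do rewrite [X in X * _]f1; rewrite sum_pickl.
  apply: etrans (derive_sumM _ (dA j) (fun q => dKf q l)) _; rewrite big_split f0; congr (_ + _) => /=.
  under eq_bigr do rewrite Ac0; rewrite sum_pickl; exact: dKb.
move: E; rewrite LE RE => /(canRL (addrK _)) /(canRL (addrK _)) ->; ring.
Qed.

End JetTransport.

Section Algebra.
Variables (R : realType) (m : nat) (L : lcomp R m m) (D : set 'rV[R]_m) (x : 'rV[R]_m).
Hypothesis sL : forall j i l, smooth_on D (fun x => L x j i l : R^o).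
Hypothesis Dx : D x.

Let dL j i l : differentiable (fun x => L x j i l : R^o) x := smooth_differentiable (sL j i l) Dx.

Lemma symc_sym z j i l : symc L z j i l = symc L z l i j.
Proof. by rewrite /symc addrC. Qed.

Lemma tor_anti z j i l : tor L z j i l = - tor L z l i j.
Proof. by rewrite /tor -mulrN opprB. Qed.

Lemma symc_tor z j i l : L z j i l = symc L z j i l + tor L z j i l.
Proof. by rewrite /symc /tor; field. Qed.

Lemma pd_symc b j i l : pd b (fun x => symc L x j i l) x
  = 2^-1 * (pd b (fun x => L x j i l) x + pd b (fun x => L x l i j) x).
Proof.
have dS : differentiable (fun x => L x j i l + L x l i j : R^o) x by apply: differentiableD.
by apply: etrans (derive_scalarM _ (differentiable_cst _ _) dS) _; rewrite derive_cst mul0r add0r derive_scalarD.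
Qed.

Lemma pd_tor b j i l : pd b (fun x => tor L x j i l) x
  = 2^-1 * (pd b (fun x => L x j i l) x - pd b (fun x => L x l i j) x).
Proof.
have dN : differentiable (fun x => - L x l i j : R^o) x by apply: differentiableN.
have dS : differentiable (fun x => L x j i l - L x l i j : R^o) x by apply: differentiableD.
apply: etrans (derive_scalarM _ (differentiable_cst _ _) dS) _; rewrite derive_cst mul0r add0r; congr (_ * _).
apply: etrans (derive_scalarD _ (dL j i l) dN) _; congr (_ + _).
by apply: deriveN; exact: diff_derivable.
Qed.

Lemma pd_symc_sym b j i l : pd b (fun x => symc L x j i l) x = pd b (fun x => symc L x l i j) x.
Proof. by apply: derive_scaler_eq => z; exact: symc_sym. Qed.

Lemma nabla_tor_anti j i l b : nabla_tor L x j i l b = - nabla_tor L x l i j b.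
Proof.
rewrite /nabla_tor.
have -> : pd b (fun x => tor L x j i l) x = - pd b (fun x => tor L x l i j) x.
  by rewrite !pd_tor -mulrN opprB.
have e (F : 'I_m -> R) (G H : 'I_m -> R) : (forall s, G s = - H s) ->
  \sum_s F s * G s = - \sum_s F s * H s.
  by move=> GH; rewrite -sumrN; apply: eq_bigr => s _; rewrite GH mulrN.
rewrite (e (fun s => symc L x s i b) _ (fun s => tor L x l s j)) => [|s]; last exact: tor_anti.
rewrite (e (fun s => symc L x j s b) _ (fun s => tor L x l i s)) => [|s]; last exact: tor_anti.
rewrite (e (fun s => symc L x l s b) _ (fun s => tor L x s i j)) => [|s]; last exact: tor_anti.
ring.
Qed.

Lemma curv_anti k (C : lcomp R m k) z j i b c : curv C z j i b c = - curv C z j i c b.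
Proof. by rewrite /curv opprK opprB. Qed.

Lemma curv_symcE j i b c : curv (symc L) x j i b c =
  - (pd b (fun x => symc L x j i c) x + \sum_p symc L x j p b * symc L x p i c
     - (pd c (fun x => symc L x j i b) x + \sum_p symc L x j p c * symc L x p i b)).
Proof. by []. Qed.

(** First Bianchi identity; it holds in coordinates because the connection is
symmetric. *)
Lemma bianchi j i c b :
  curv (symc L) x j i c b + curv (symc L) x c i b j + curv (symc L) x b i j c = 0.
Proof.

rewrite !curv_symcE (pd_symc_sym c j) (pd_symc_sym b j) (pd_symc_sym j b).
have E u v w : \sum_p symc L x u p v * symc L x p i w = \sum_p symc L x v p u * symc L x p i w.
  by apply: eq_bigr => p _; rewrite symc_sym.
rewrite (E j c) (E j b) (E c b); ring.
Qed.

End Algebra.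

Section NormalForm.
Variables (R : realType) (m n : nat) (Gam : rule R m n).
Hypothesis natG : commutes_with_local_isos Gam.
Variables (E : vbundle R m n) (a : cidx E) (L : classical_connection E) (K : linear_connection E).
Variable x0 : 'rV[R]_m.
Hypothesis Dx0 : cimg (atlas a) x0.
Local Notation E0 := (flat R m n).
Local Notation S := (symc (L a) x0).
Local Notation T := (tor (L a) x0).
Local Notation Kx := (K a x0).

(** Second derivatives of the frame.  The symmetric part of the derivative of the
pulled back K is cancelled, the antisymmetric part, a multiple of the curvature,
cannot be; the last sum compensates the second derivatives of the chart. *)
Definition frame2 j i k l : R :=
  2^-1 * (\sum_q Kx j q k * Kx q i l + \sum_q Kx j q l * Kx q i k
          + pd k (fun x => K a x j i l) x0 + pd l (fun x => K a x j i k) x0)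
  + \sum_l' S l l' k * Kx j i l'.

(** Third derivatives of the chart that would make the derivative of the pulled back
symmetric part vanish in the direction k.  They are not symmetric in k, l, j; the
cyclic mean is used, which leaves curvature terms. *)
Definition christoffel1 i k l j : R := pd k (fun x => symc (L a) x j i l) x0
  + \sum_p S j p k * S p i l + \sum_p S l p k * S j i p.

(** First derivatives of the frame equal to K and second derivatives of the chart
equal to the symmetric part of L annihilate K and this symmetric part at the
origin. *)
Theorem normal_form : exists (f : 'rV[R]_m -> 'rV[R]_m) (A : 'rV[R]_m -> 'M[R]_n)
    (L0 : classical_connection E0) (K0 : linear_connection E0),
  [/\ [/\ smooth_on setT f, smooth_on setT A & forall z, 'J f z \in unitmx],
      f 0 = x0 /\ A 0 = 1%:M,
      [/\ forall i l, pd l (fun z => f z 0 i : R^o) 0 = (l == i)%:R,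
          forall i k l, pd k (pd l (fun z => f z 0 i : R^o)) 0 = S k i l,
          forall p i l, pd l (fun z => A z p i : R^o) 0 = Kx p i l
        & forall p i k l, pd k (pd l (fun z => A z p i : R^o)) 0 = frame2 p i k l],
      forall w, jrelated f A (@Gam E0 L0 K0 tt) (@Gam E L K a) w
    & [/\ forall j i l, K0 tt 0 j i l = 0,
          forall b j i l, pd b (fun x => K0 tt x j i l) 0 = - 2^-1 * curv (K a) x0 j i b l,
          forall j i l, L0 tt 0 j i l = T j i l
        & forall b j i l, pd b (fun x => L0 tt x j i l) 0 = nabla_tor (L a) x0 j i l b
            - 3^-1 * (curv (symc (L a)) x0 j i b l + curv (symc (L a)) x0 l i b j)]].
Proof.
have oT : open [set: 'rV[R]_m] := openT.
have oD : open (cimg (atlas a)) := @open_cimg _ _ _ _ a.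
have sL j i l : smooth_on (cimg (atlas a)) (fun x => L a x j i l : R^o) by exact: cc_smooth.
have sK j i l : smooth_on (cimg (atlas a)) (fun x => K a x j i l : R^o) by exact: lc_smooth.
have Ssym j i l : S j i l = S l i j by exact: symc_sym.
pose Q := christoffel1.
have Qsym i k l j : Q i k l j = Q i k j l.
  rewrite /Q /christoffel1 (pd_symc_sym (L a)) -!addrA; congr (_ + _).
  by rewrite addrC; congr (_ + _); apply: eq_bigr => p _; rewrite mulrC Ssym mulrC; congr (_ * _).
(* cyclic mean: symmetric in all lower indices, as third derivatives have to be *)
pose J3 i k l j := 3^-1 * (Q i k l j + Q i l j k + Q i j k l).
have [f [A [[sf injf fD uJ] [sA uA] [f0 A0] [f1 f2 ftriple] [A1 A2]]]] :=
  normal_chart (J2 := fun i k l => S k i l) (J3 := J3) (A2 := frame2) Kx oD Dx0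
   (fun i k l => Ssym k i l)
   (fun i k l j => ltac:(by rewrite /J3 (Qsym i k j) (Qsym i j l) (Qsym i l k); ring))
   (fun i k l j => ltac:(by rewrite /J3 (Qsym i k j) (Qsym i j l) (Qsym i l k); ring))
   (fun p i k l => ltac:(by rewrite /frame2 (eq_bigr (fun l' => S k l' l * Kx p i l')) => [|l' _]; [ring|rewrite Ssym])).
have [L0 [K0 [HK HL HG]]] := transport sf injf fD uJ sA uA L K natG.
have sL0 : smooth_comps (L0 tt) by move=> j i b; have := @cc_smooth _ _ _ _ L0 tt j i b; rewrite flat_img.
have sK0 : smooth_comps (K0 tt) by move=> j i b; have := @lc_smooth _ _ _ _ K0 tt j i b; rewrite flat_img.
have K00 j i l : K0 tt 0 j i l = 0.
  by rewrite (transported_value sf sA uJ HK f0 A0 f1) A1 subrr.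
have JE j l : (fun z => 'J f z j l : R^o) = pd j (fun z => f z 0 l : R^o).
  by apply/funext => z; exact: jacobianE (smooth_differentiable sf I).
have sJ := smooth_jacobian oT sf.
have J0 : 'J f 0 = 1%:M.
  by apply/matrixP => j l; rewrite [RHS]mxE -(f1 l j) -JE.
have L00 j i l : L0 tt 0 j i l = T j i l.
  rewrite (transported_value sf sJ uJ HL f0 J0 f1) JE f2.
  by rewrite [X in X - _]symc_tor (Ssym l i j) addrAC subrr add0r.
exists f, A, L0, K0; split=> //; split=> // [b j i l|b j i l].
  rewrite (transported_derivative sf sA uJ Dx0 sK0 sK HK f0 A0 f1) A2.
  rewrite [X in _ - X]big1 => [|p _]; last by rewrite K00 mul0r.
  under [X in _ + X + _ - _ - _]eq_bigr do rewrite f2.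
  under [X in _ + X - _ - _]eq_bigr do rewrite A1.
  rewrite /frame2 /curv (eq_bigr (fun l' => S l l' b * Kx j i l')) => [|l' _]; last by rewrite Ssym.
  by field.
rewrite (transported_derivative sf sJ uJ Dx0 sL0 sL HL f0 J0 f1) JE ftriple.
pose P u v w := \sum_p S u p v * S p i w.
have Psym u v w : P u v w = P v u w by apply: eq_bigr => p _; rewrite Ssym.
have PE u v w : \sum_p S u p v * S w i p = P u v w by apply: eq_bigr => p _; rewrite (Ssym w).
have QE k u v : Q i k u v = pd k (fun x => symc (L a) x v i u) x0 + P v k u + P u k v.
  by rewrite /Q /christoffel1 PE.
have cE k u v : curv (symc (L a)) x0 v i k u = - (pd k (fun x => symc (L a) x v i u) x0 + P v k u
    - (pd u (fun x => symc (L a) x v i k) x0 + P v u k)) by [].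
have e1 : \sum_l' pd b (pd l (fun z => f z 0 l' : R^o)) 0 * L a x0 j i l'
  = P l b j + \sum_p S l p b * T j i p.
  rewrite -PE -big_split; apply: eq_bigr => p _; rewrite f2 [L a x0 j i p]symc_tor mulrDr.
  by rewrite (Ssym b p l).
have e2 : \sum_q pd b (fun z => 'J f z j q : R^o) 0 * L a x0 q i l = P j b l + \sum_p S j p b * T p i l.
  rewrite -big_split; apply: eq_bigr => p _; rewrite JE f2 [L a x0 p i l]symc_tor mulrDr.
  by rewrite (Ssym b p j).
have e3 : \sum_p L0 tt 0 j p l * pd b (fun z => 'J f z p i : R^o) 0 = \sum_p S p i b * T j p l.
  by apply: eq_bigr => p _; rewrite JE f2 L00 mulrC (Ssym b).
have e4 : pd b (fun x => L a x j i l) x0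
  = pd b (fun x => symc (L a) x j i l) x0 + pd b (fun x => tor (L a) x j i l) x0.
  by rewrite (pd_symc sL Dx0) (pd_tor sL Dx0); field.
rewrite e1 e2 e3 e4 /J3 !QE !cE /nabla_tor.
rewrite (pd_symc_sym (L a) x0 l b i j) (pd_symc_sym (L a) x0 b l i j).
rewrite (Psym b l j) (Psym b j l) (Psym l j b).
by field.
Qed.

End NormalForm.

(** * The rule at the origin of normal coordinates *)

Section OriginLaw.
Variables (R : realType) (m n s r : nat) (Gam : rule R m n).
Hypothesis ordG : of_order s r Gam.
Hypothesis natG : commutes_with_local_isos Gam.
Local Notation E0 := (flat R m n).

(** In normal coordinates the values fed into the polynomial form are the torsion, its
covariant derivative corrected by the curvature, and the curvature of K; each
invariant coefficient contributes its list of contractions. *)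
Theorem origin_value_form (i0 : 'I_n) : exists c : 'I_14 -> R,
  forall (L0 : classical_connection E0) (K0 : linear_connection E0) (y : 'rV[R]_n) (v : 'M[R]_(m, n))
    (T : 'I_m -> 'I_m -> 'I_m -> R) (N Rm : 'I_m -> 'I_m -> 'I_m -> 'I_m -> R) (Rk : 'I_n -> 'I_n -> 'I_m -> 'I_m -> R),
  (forall j i l, K0 tt 0 j i l = 0) ->
  (forall b j i l, pd b (fun x => K0 tt x j i l) 0 = - 2^-1 * Rk j i b l) ->
  (forall j i l, L0 tt 0 j i l = T j i l) ->
  (forall b j i l, pd b (fun x => L0 tt x j i l) 0 = N j i l b - 3^-1 * (Rm j i b l + Rm l i b j)) ->
  (forall j i l, T j i l = - T l i j) ->
  (forall j i l b, N j i l b = - N l i j b) ->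
  (forall j i b l, Rm j i b l = - Rm j i l b) ->
  (forall j i b l, Rm j i b l + Rm b i l j + Rm l i j b = 0) ->
  (forall j i b l, Rk j i b l = - Rk j i l b) ->
  (forall a i b, Gam0 Gam L0 K0 y v (inl a) i b =
     (c (inord 0) * (\sum_q v b i * T q q a) + c (inord 1) * (\sum_q v a i * T q q b)
        + c (inord 2) * (\sum_q v q i * T a q b))
     + y 0 i * (c (inord 3) * (\sum_p \sum_q T p p a * T q q b)
        + c (inord 4) * (\sum_p \sum_q T q p a * T p q b)
        + c (inord 5) * (\sum_p \sum_q T p p q * T a q b)
        + c (inord 6) * (\sum_q N q q a b) + c (inord 7) * (\sum_q N q q b a) + c (inord 8) * (\sum_q N a q b q)
        + c (inord 9) * (\sum_q Rm q q a b) + c (inord 10) * (\sum_q Rm a q q b)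
        + c (inord 11) * (\sum_q Rk q q a b))
     + c (inord 12) * (\sum_p Rk p i a b * y 0 p)) /\
  (forall q i b, Gam0 Gam L0 K0 y v (inr q) i b = (q == i)%:R * (c (inord 13) * \sum_p T p p b)).
Proof.
have [C CP] := poly_arrays ordG natG.
have eqv := poly_equivariance natG CP.
have [kal alP] := v_part eqv i0; have [kbe beP] := LL_part eqv i0.
have [kga gaP] := dL_part eqv i0; have [e1 [e2 deP]] := dK_part eqv.
have [ket etP] := vert_part eqv i0.
have [a1 [a2 [a3 sal]]] := torsion_derivative_contractions m kal.
have [b1 [b2 [b3 sbe]]] := torsion_square_contractions m kbe.
have [c1 [c2 [c3 sga]]] := torsion_derivative_contractions m kga; have [d1 [d2 sgd]] := curvature_contractions m kga.
have [h set] := two_index_contractions m ket.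
exists (fun i : 'I_14 => nth 0 [:: a1; a2; a3; b1; b2; b3; c1; c2; c3; - 3^-1 * d1; - 3^-1 * d2; - 2^-1 * e1; - 2^-1 * e2; h] i).
move=> L0 K0 y v T N Rm Rk K00 K01 L00 L01 aT aN aR bR aK; rewrite !inordK //=.
have [Gh Gv] := CP L0 K0 y v K00.
pose l (t : 'I_m * 'I_m * 'I_m) := T t.1.1 t.1.2 t.2.
have lE : val0 (L0 tt) = l by apply/funext => t; exact: L00.
split=> [a i b|q i b]; last first.
  rewrite Gv lE etP set // => j i' b'; exact: aT.
pose X c (t : 'I_m * 'I_m * 'I_m) := N t.1.1 t.1.2 t.2 c.
pose Y c (t : 'I_m * 'I_m * 'I_m) := Rm t.1.1 t.1.2 c t.2 + Rm t.2 t.1.2 c t.1.1.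
pose k1 c (t : 'I_n * 'I_n * 'I_m) := - 2^-1 * Rk t.1.1 t.1.2 c t.2.
have l1E : val1 (L0 tt) = fun c t => X c t - 3^-1 * Y c t.
  by apply/funext => c; apply/funext => -[[j p] b']; exact: L01.
have k1E : val1 (K0 tt) = k1 by apply/funext => c; apply/funext => -[[j p] b']; exact: K01.
rewrite Gh lE l1E k1E /hor_poly.
have -> : \sum_q v q.1 q.2 * \sum_t l t * coef_v C a i b q t = _ := alP v l a i b.
rewrite sal => [|c0 j i' b']; last by rewrite [l _]aT mulrN.
have sum3 (F A B H : 'I_n -> R) : \sum_p F p * (A p + B p + H p)
    = \sum_p F p * A p + \sum_p F p * B p + \sum_p F p * H p.
  by rewrite -!big_split; apply: eq_bigr => p _ /=; rewrite !mulrDr.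
rewrite sum3 /= (gaP (fun p => y 0 p)) (beP (fun p => y 0 p)) (deP (fun p => y 0 p)) => [|c0 q c0']; last first.
  by rewrite /k1 aK mulrN.
rewrite sbe => [|j i' b']; last exact: aT.
have -> : \sum_s kga s * \sum_Q contract3 (fun c t => X c t - 3^-1 * Y c t) Q (permute s (mk3 a b Q))
  = \sum_s kga s * \sum_Q contract3 X Q (permute s (mk3 a b Q))
    - 3^-1 * \sum_s kga s * \sum_Q contract3 Y Q (permute s (mk3 a b Q)).
  rewrite mulr_sumr -sumrB; apply: eq_bigr => s' _; rewrite mulrCA -mulrBr; congr (_ * _).
  by rewrite mulr_sumr -sumrB.
rewrite sga => [|c0 j i' b']; last exact: aN.
rewrite (sgd Rm) // /k1 /X /l /=.
have -> : \sum_j - 2^-1 * Rk j j a b = - 2^-1 * \sum_q Rk q q a b by rewrite mulr_sumr.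
have -> : \sum_p y 0 p * (- 2^-1 * Rk p i a b) = - 2^-1 * \sum_p Rk p i a b * y 0 p.
  by rewrite mulr_sumr; apply: eq_bigr => p _; rewrite mulrCA [y 0 p * _]mulrC.
ring.
Qed.

End OriginLaw.

(** * Reduction to normal coordinates *)

Section Formula.
Variables (R : realType) (m n : nat) (Gam : rule R m n).
Hypothesis natG : commutes_with_local_isos Gam.
Variables (E : vbundle R m n) (a : cidx E) (L : classical_connection E) (K : linear_connection E).
Variables (x : 'rV[R]_m) (y : 'rV[R]_n) (u : 'M[R]_(m, n)).
Hypothesis Dx : cimg (atlas a) x.
Local Notation E0 := (flat R m n).
Local Notation T := (tor (L a) x).
Local Notation Kx := (K a x).
Local Notation w := (x, y, u).

Let v : 'M[R]_(m, n) := \matrix_(l, i) (u l i - \sum_j Kx j i l * y 0 j).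

(** The law of transport in normal coordinates.  The terms with derivatives of the
chart and of the frame reassemble into chi (DLK L K), up to curvature and torsion
terms. *)
Theorem reduction_to_origin : exists (L0 : classical_connection E0) (K0 : linear_connection E0),
  [/\ forall j i l, K0 tt 0 j i l = 0,
      forall b j i l, pd b (fun x => K0 tt x j i l) 0 = - 2^-1 * curv (K a) x j i b l,
      forall j i l, L0 tt 0 j i l = T j i l
    & forall b j i l, pd b (fun x => L0 tt x j i l) 0 = nabla_tor (L a) x j i l b
            - 3^-1 * (curv (symc (L a)) x j i b l + curv (symc (L a)) x l i b j)] /\
  (forall q i l, @Gam E L K a w (inr q) i l = Gam0 Gam L0 K0 y v (inr q) i l + chi (DLK (L a) (K a)) w (inr q) i l) /\
  (forall b i l, @Gam E L K a w (inl b) i l = Gam0 Gam L0 K0 y v (inl b) i l + chi (DLK (L a) (K a)) w (inl b) i l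
     - theta_hK (K a) (tor (L a)) w (inl b) i l - 2^-1 * curv_liouville (K a) w (inl b) i l
     - \sum_j (\sum_p Kx p j b * y 0 p) * Gam0 Gam L0 K0 y v (inr j) i l).
Proof.
have [f [A [L0 [K0 [[sf sA uJ] [f0 A0] [f1 f2 A1 A2] HG H0]]]]] := normal_form natG L K Dx.
exists L0, K0; split=> //.
have uv l i : u l i = v l i + \sum_p y 0 p * pd l (fun z => A z p i : R^o) 0.
  by rewrite mxE; under [X in _ + X]eq_bigr do rewrite A1 mulrC; rewrite subrK.
pose G' := @Gam E L K a w; pose G0 := Gam0 Gam L0 K0 y v.
have Gv q i l : G' (inr q) i l = G0 (inr q) i l + Kx q i l.
  by have := origin_law_v sf sA uJ f0 A0 f1 uv (HG (0, y, v)) q i l; rewrite A1.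
have chiv q i l : chi (DLK (L a) (K a)) w (inr q) i l = Kx q i l.
  rewrite /chi /= big1 => [|j _]; last by rewrite mul0r.
  rewrite add0r [X in _ - X]big1 => [|c _]; first by rewrite subr0.
  by rewrite addr0 mulr0.
split=> [q i l|b i l]; first by rewrite chiv -/(G' _ _ _) Gv.
have Gh : G' (inl b) i l = G0 (inl b) i l + \sum_p v l p * Kx p i b + \sum_p y 0 p * frame2 a L K x p i b l
    - \sum_c symc (L a) x b c l * u c i - \sum_j (\sum_p Kx p j b * y 0 p) * (G0 (inr j) i l + Kx j i l).
  rewrite [LHS](origin_law_h sf sA uJ f0 A0 f1 uv (HG (0, y, v)) b i l).
  congr (_ + _ + _ - _ - _); apply: eq_bigr => p _; rewrite ?A1 ?A2 ?f2 //.
  by rewrite -/(G' _ _ _) Gv; congr (_ * _); apply: eq_bigr => q _; rewrite A1 mulrC.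
pose U := \sum_j Kx j i b * u l j.
pose W c d := \sum_p (\sum_q Kx p q c * Kx q i d) * y 0 p.
pose P c d := \sum_p pd c (fun x => K a x p i d) x * y 0 p.
pose Z (F : 'I_m -> 'I_m -> 'I_m -> R) := \sum_p (\sum_c Kx p i c * F b c l) * y 0 p.
pose V (F : 'I_m -> 'I_m -> 'I_m -> R) := \sum_c u c i * F b c l.
have sE : \sum_p v l p * Kx p i b = U - W l b.
  under eq_bigr do rewrite mxE mulrBl.
  rewrite sumrB; congr (_ - _); first by apply: eq_bigr => p _; rewrite mulrC.
  under eq_bigr do rewrite mulr_suml.
  rewrite exchange_big; apply: eq_bigr => p _; rewrite mulr_suml; apply: eq_bigr => q _.
  by rewrite mulrAC.
have fE : \sum_p y 0 p * frame2 a L K x p i b l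
    = 2^-1 * (W b l + W l b + P b l + P l b) + Z (symc (L a) x).
  rewrite /W /P /Z -!big_split mulr_sumr -big_split; apply: eq_bigr => p _ /=.
  rewrite /frame2 (eq_bigr (fun c => Kx p i c * symc (L a) x b c l)) => [|c _]; last first.
    by rewrite mulrC symc_sym.
  by ring.
have yE : \sum_j (\sum_p Kx p j b * y 0 p) * (G0 (inr j) i l + Kx j i l)
    = \sum_j (\sum_p Kx p j b * y 0 p) * G0 (inr j) i l + W b l.
  under eq_bigr do rewrite mulrDr; rewrite big_split; congr (_ + _).
  under eq_bigr do rewrite mulr_suml.
  rewrite exchange_big; apply: eq_bigr => p _; rewrite mulr_suml; apply: eq_bigr => q _.
  by rewrite mulrAC.
have cE : chi (DLK (L a) (K a)) w (inl b) i l
    = U + P l b - W b l + (Z (symc (L a) x) + Z T) - (V (symc (L a) x) + V T).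
  rewrite /chi /= -!addrA; congr (_ + _); rewrite !addrA; congr (_ - _).
    rewrite /P /W /Z -sumrB -!big_split; apply: eq_bigr => p _ /=.
    rewrite -mulrBl -!mulrDl; congr (_ * _); rewrite -[RHS]addrA; congr (_ - _ + _); first by apply: eq_bigr => q _; rewrite mulrC.
    by rewrite -big_split; apply: eq_bigr => c _ /=; rewrite -mulrDr -symc_tor.
  rewrite /V -big_split; apply: eq_bigr => c _ /=; rewrite big1 => [|j _]; last by rewrite mul0r.
  by rewrite add0r -mulrDr -symc_tor.
have tE : theta_hK (K a) (tor (L a)) w (inl b) i l = Z T - V T.
  rewrite /theta_hK /=; under eq_bigr do rewrite mulrBr; rewrite sumrB; congr (_ - _).
    under eq_bigr do rewrite mulr_sumr.
    rewrite exchange_big; apply: eq_bigr => p _; rewrite mulr_suml; apply: eq_bigr => c _.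
    by rewrite mulrA [_ * Kx _ _ _]mulrC.
  by apply: eq_bigr => c _; rewrite mulrC.
have rE : curv_liouville (K a) w (inl b) i l = - (P b l + W b l - (P l b + W l b)).
  rewrite /curv_liouville /P /W -!big_split -sumrB -sumrN; apply: eq_bigr => p _ /=.
  by rewrite -!mulrDl -mulrBl -mulNr.
have vE : \sum_c symc (L a) x b c l * u c i = V (symc (L a) x).
  by apply: eq_bigr => c _; rewrite mulrC.
rewrite -/(G' _ _ _) -/(G0 _ _ _) Gh sE fE yE cE tE rE vE -/G0.
move: (\sum_j _) => YG; move: (G0 _ _ _) (U) (W b l) (W l b) (P b l) (P l b) => g1 g2 g3 g4 g5 g6.
move: (Z _) (Z _) (V _) (V _) => g7 g8 g9 g10.
by field.
Qed.

End Formula.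

(** * The classification *)

Section Classification.
Variables (R : realType) (m n s r : nat) (Gam : rule R m n).
Hypothesis ordG : of_order s r Gam.
Hypothesis natG : commutes_with_local_isos Gam.

Theorem classification : exists a1 a2 a3 b1 b2 b3 c1 c2 c3 d1 d2 e1 e2 h1 : R,
  forall (E : vbundle R m n) (L : classical_connection E)
    (K : linear_connection E) (a : cidx E)
    (w : jco R m n) (A : 'I_m + 'I_n)
    (i : 'I_n) (mu : 'I_m),
  cimg (atlas a) w.1.1 ->
  @Gam E L K a w A i mu =
    chi (DLK (L a) (K a)) w A i mu
    + theta_hK (K a) (S_tensor (L a) a1 a2 a3) w A i mu
    + liouville_tensor
        (G_tensor (L a) (K a) b1 b2 b3 c1 c2 c3 d1 d2 e1) w A i mu
    + e2 * curv_liouville (K a) w A i mu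
    + h1 * nuK_htor (L a) (K a) w A i mu.
Proof.
(* without fibre directions there are no components *)
have [n0|n0] := posnP n.
  exists 0, 0, 0, 0, 0, 0, 0, 0, 0, 0, 0, 0, 0, 0 => E L K a w A i.
  by exfalso; have := ltn_ord i; rewrite [X in (_ < X)%N]n0 ltn0.
have [c cP] := origin_value_form ordG natG (Ordinal n0).
(* Signs come from v = u - y K, which is minus theta applied to a horizontal lift;
   -1 and -1/2 come from the torsion and curvature terms of the reduction. *)
exists (- c (inord 2) - 1), (- c (inord 1)), (- c (inord 0)), (c (inord 3)), (c (inord 4)), (c (inord 5)),
  (c (inord 6)), (c (inord 7)), (c (inord 8)), (c (inord 9)), (c (inord 10)), (c (inord 11)),
  (c (inord 12) - 2^-1), (c (inord 13)).
move=> E L K a [[x y] u] A i mu; rewrite [(x, y, u).1.1]/= => Dx.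
have sL j p l : smooth_on (cimg (atlas a)) (fun x => L a x j p l : R^o) by exact: cc_smooth.
have [L0 [K0 [[K00 K01 L00 L01] [Gv Gh]]]] := reduction_to_origin natG L K y u Dx.
have [Oh Ov] := cP L0 K0 y (\matrix_(l, i) (u l i - \sum_j K a x j i l * y 0 j)) _ _ _ _ K00 K01 L00 L01
  (tor_anti (L a) x) (nabla_tor_anti sL Dx) (curv_anti (symc (L a)) x)
  (fun j p b l => bianchi (L a) x j p b l) (curv_anti (K a) x).
case: A => [b|q]; last first.
  rewrite Gv Ov /= !addr0 mulr0 addr0 addrC; congr (_ + _).
  by rewrite /htor /delta [i == q]eq_sym mulrCA; congr (_ * _); exact: mulrC.
rewrite Gh Oh.
have pick (I : finType) (F : I -> R) j : \sum_q delta R q j * F q = F j.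
  by rewrite (bigD1 j) //= /delta eqxx mul1r big1 ?addr0 // => q /negPf ->; rewrite mul0r.
have -> : \sum_j (\sum_p K a x p j b * y 0 p) * Gam0 Gam L0 K0 y (\matrix_(l, i) (u l i - \sum_j K a x j i l * y 0 j)) (inr j) i mu
  = - c (inord 13) * nuK_htor (L a) (K a) (x, y, u) (inl b) i mu.
  rewrite (eq_bigr (fun j => delta R j i * (c (inord 13) * htor (L a) x mu * \sum_p K a x p j b * y 0 p))) => [|j _].
    by rewrite pick /= mulrN mulNr opprK mulrA.
  by rewrite Ov /delta mulrCA; congr (_ * _); rewrite mulrC.
pose k c := \sum_j K a x j i c * y 0 j.
have -> : theta_hK (K a) (S_tensor (L a) (- c (inord 2) - 1) (- c (inord 1)) (- c (inord 0))) (x, y, u) (inl b) i mu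
  = (- c (inord 2) - 1) * (\sum_q tor (L a) x b q mu * (k q - u q i))
    + - c (inord 1) * (htor (L a) x mu * (k b - u b i)) + - c (inord 0) * (htor (L a) x b * (k mu - u mu i)).
  rewrite /theta_hK /S_tensor /= -/(k _) -(pick _ (fun q => htor (L a) x mu * (k q - u q i)) b).
  rewrite -(pick _ (fun q => htor (L a) x b * (k q - u q i)) mu) !mulr_sumr -!big_split.
  by apply: eq_bigr => q _ /=; rewrite -/(k q); ring.
have -> : theta_hK (K a) (tor (L a)) (x, y, u) (inl b) i mu = \sum_q tor (L a) x b q mu * (k q - u q i) by [].
set v := \matrix_(l, i) _.
have E1 (t c0 : 'I_m) : \sum_q v c0 i * tor (L a) x q q t = - (htor (L a) x t * (k c0 - u c0 i)).
  by rewrite -mulr_sumr mxE -/(k c0) -/(htor _ _ _); ring.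
have E2 : \sum_q v q i * tor (L a) x b q mu = - \sum_q tor (L a) x b q mu * (k q - u q i).
  by rewrite -sumrN; apply: eq_bigr => q _; rewrite mxE -/(k q); ring.
rewrite !E1 E2 /liouville_tensor /G_tensor /=.
by field.
Qed.

End Classification.

(** * Order one *)

Section Trivialization.
Variables (R : realType) (m n : nat) (Gam : rule R m n).
Hypothesis natG : commutes_with_local_isos Gam.
Variables (E : vbundle R m n) (a : cidx E) (L : classical_connection E) (K : linear_connection E).
Variable x : 'rV[R]_m.
Hypothesis Dx : cimg (atlas a) x.
Local Notation E0 := (flat R m n).

(** A chart that osculates the identity to third order and a frame constant to second
order leave 1-jets unchanged, and the law of transport has no correction terms. *)
Lemma trivialization : exists (L0 : classical_connection E0) (K0 : linear_connection E0),
  [/\ forall t, comp (L0 tt) (K0 tt) t 0 = comp (L a) (K a) t x,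
      forall b t, pd b (comp (L0 tt) (K0 tt) t) 0 = pd b (comp (L a) (K a) t) x
    & forall y v A i l, @Gam E L K a (x, y, v) A i l = Gam0 Gam L0 K0 y v A i l].
Proof.
have oT : open [set: 'rV[R]_m] := openT.
have oD : open (cimg (atlas a)) := @open_cimg _ _ _ _ a.
have sL j i l : smooth_on (cimg (atlas a)) (fun x => L a x j i l : R^o) by exact: cc_smooth.
have sK j i l : smooth_on (cimg (atlas a)) (fun x => K a x j i l : R^o) by exact: lc_smooth.
have [f [A [[sf injf fD uJ] [sA uA] [f0 A0] [f1 f2 ftriple] [A1 A2]]]] :=
  normal_chart (J2 := fun _ _ _ => 0) (J3 := fun _ _ _ _ => 0) (A2 := fun _ _ _ _ => 0)
    (fun (_ _ : 'I_n) _ => 0) oD Dx (fun _ _ _ => erefl) (fun _ _ _ _ => erefl) (fun _ _ _ _ => erefl)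
    (fun _ _ _ _ => erefl).
have [L0 [K0 [HK HL HG]]] := transport sf injf fD uJ sA uA L K natG.
have sL0 : smooth_comps (L0 tt) by move=> j i b; have := @cc_smooth _ _ _ _ L0 tt j i b; rewrite flat_img.
have sK0 : smooth_comps (K0 tt) by move=> j i b; have := @lc_smooth _ _ _ _ K0 tt j i b; rewrite flat_img.
have JE j l : (fun z => 'J f z j l : R^o) = pd j (fun z => f z 0 l : R^o).
  by apply/funext => z; exact: jacobianE (smooth_differentiable sf I).
have sJ := smooth_jacobian oT sf.
have J0 : 'J f 0 = 1%:M.
  by apply/matrixP => j l; rewrite [RHS]mxE -(f1 l j) -JE.
exists L0, K0; split.
- case=> q /=.
    by rewrite (transported_value sf sJ uJ HL f0 J0 f1) JE f2 subr0.
  by rewrite (transported_value sf sA uJ HK f0 A0 f1) A1 subr0.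
- move=> b [q|q] /=.
    rewrite (transported_derivative sf sJ uJ Dx sL0 sL HL f0 J0 f1) JE ftriple subr0.
    rewrite big1 => [|c _]; last by rewrite f2 mul0r.
    rewrite big1 => [|c _]; last by rewrite JE f2 mul0r.
    by rewrite big1 => [|c _]; rewrite ?addr0 ?subr0 // JE f2 mulr0.
  rewrite (transported_derivative sf sA uJ Dx sK0 sK HK f0 A0 f1) A2 subr0.
  rewrite big1 => [|c _]; last by rewrite f2 mul0r.
  rewrite big1 => [|c _]; last by rewrite A1 mul0r.
  by rewrite big1 => [|c _]; rewrite ?addr0 ?subr0 // A1 mulr0.
move=> y v B i l.
have uv c j : v c j = v c j + \sum_p y 0 p * pd c (fun z => A z p j : R^o) 0.
  by rewrite big1 ?addr0 // => p _; rewrite A1 mulr0.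
case: B => [b|q]; last first.
  rewrite [LHS](origin_law_v sf sA uJ f0 A0 f1 uv (HG (0, y, v)) q i l).
  by rewrite A1 addr0.
rewrite [LHS](origin_law_h sf sA uJ f0 A0 f1 uv (HG (0, y, v)) b i l).
rewrite !big1 ?addr0 ?subr0 // => p _; rewrite ?A1 ?A2 ?f2 ?mulr0 ?mul0r //.
by rewrite big1 ?mul0r // => q _; rewrite A1 mulr0.
Qed.

End Trivialization.

Section FirstOrder.
Variables (R : realType) (m n : nat).

Lemma mpd_seq (c : option 'I_m) (f : 'rV[R]_m -> R^o) (ls : seq 'I_m) : uniq ls ->
  foldr (fun l g => iter (Some l == c) (pd l) g) f ls
  = if c is Some b then if b \in ls then pd b f else f else f.
Proof.
elim: ls => [|l ls IH] /=; first by case: c.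
case/andP => lls /IH ->; case: c {IH} => [b|] //.
rewrite in_cons (inj_eq Some_inj) eq_sym; case: eqVneq => [->|] //=.
by rewrite (negPf lls).
Qed.

Definition partial (c : option 'I_m) (f : 'rV[R]_m -> R^o) := if c is Some b then pd b f else f.

(** The 1-jet of a component consists of its value and its first partial derivatives,
in coordinates indexed by None and Some b. *)
Lemma jet1_coord k (c : option 'I_m) (q : 'I_k * 'I_k * 'I_m) : exists t, forall (K : lcomp R m k) x,
  jet 1 K x 0 t = partial c (fun x => K x q.1.1 q.1.2 q.2) x.
Proof.
pose g : {ffun 'I_m -> 'I_2} := [ffun l => inord (Some l == c)].
have gE l : g l = (Some l == c) :> nat by rewrite ffunE inordK //; case: (Some l == c).
have g1 : (\sum_l g l <= 1)%N.
  under eq_bigr do rewrite gE; case: c {g gE} => [b|]; last by rewrite big1.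
  rewrite (bigD1 b) //= big1 => [|l lb]; first by rewrite eqxx.
  by rewrite (inj_eq Some_inj) (negPf lb).
pose al : midx m 1 := exist _ g g1.
exists (enum_rank ((al, q) : jet_idx m k 1)) => K x.
rewrite mxE enum_rankK /= /mpd.
have -> : (fun (l : 'I_m) (h : 'rV[R]_m -> R^o) => iter (val al l) (pd l) h)
  = fun l h => iter (Some l == c) (pd l) h.
  by apply/funext => l; apply/funext => h; rewrite -gE.
by rewrite mpd_seq ?enum_uniq //; case: (c) => // b; rewrite mem_enum.
Qed.

Variables (s r : nat) (Gam : rule R m n).
Hypothesis ordG : of_order s r Gam.
Hypothesis natG : commutes_with_local_isos Gam.
Local Notation Z := (jco R m n * ('rV[R]_#|jet_idx m m 1| * 'rV[R]_#|jet_idx m n 1|))%type.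

Lemma jet1_reading (c : option 'I_m) (t : comp_idx m n) : exists2 C : Z -> R^o, smooth_on setT C &
  forall (L : lcomp R m m) (K : lcomp R m n) w x, C (w, (jet 1 L x, jet 1 K x)) = partial c (comp L K t) x.
Proof.
have oT k : open [set: 'rV[R]_k] := openT.
case: t => q; have [t tE] := jet1_coord c q.
  exists (fun z : Z => z.2.1 0 t : R^o) => [|L K w x]; last exact: tE.
  apply: (lin_comp_smooth (l := fun z : Z => z.2.1) _ _ (oT _) (coord_smooth t)) => // z.
  exact: (cvg_comp _ _ cvg_snd cvg_fst).
exists (fun z : Z => z.2.2 0 t : R^o) => [|L K w x]; last exact: tE.
apply: (lin_comp_smooth (l := fun z : Z => z.2.2) _ _ (oT _) (coord_smooth t)) => // z.
exact: (cvg_comp _ _ cvg_snd cvg_snd).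
Qed.

(** The polynomial form expresses the rule at the origin through values and first
derivatives; a chart osculating the identity carries this formula to any point. *)
Theorem order_one : of_order 1 1 Gam.
Proof.
have oT : open [set: Z] := openT.
move=> E a A i l.
have /choice [C CP] (q : option 'I_m * comp_idx m n) : exists C : Z -> R^o, smooth_on setT C /\
  forall (L : lcomp R m m) (K : lcomp R m n) w x, C (w, (jet 1 L x, jet 1 K x)) = partial q.1 (comp L K q.2) x.
  by have [C sC CE] := jet1_reading q.1 q.2; exists C.
have sC q : smooth_on setT (C q) by case: (CP q).
have CE c t L K w x : C (c, t) (w, (jet 1 L x, jet 1 K x)) = partial c (comp L K t) x by case: (CP (c, t)).
suff [F sF FE] : exists2 F : Z -> R^o, smooth_on setT F &
  forall (L : classical_connection E) (K : linear_connection E) w, cimg (atlas a) w.1.1 ->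
    @Gam E L K a w A i l = F (w, (jet 1 (L a) w.1.1, jet 1 (K a) w.1.1)).
  by exists F; split=> // vs z _; exact: sF.
have sy p : smooth_on setT (fun z : Z => z.1.1.2 0 p : R^o).
  apply: (lin_comp_smooth (l := fun z : Z => z.1.1.2) _ _ openT (coord_smooth p)) => // z.
  exact: (cvg_comp _ _ (cvg_comp _ _ cvg_fst cvg_fst) cvg_snd).
have sv (q : 'I_m * 'I_n) : smooth_on setT (fun z : Z => z.1.2 q.1 q.2 : R^o).
  have se : smooth_on setT (fun M : 'M[R]_(m, n) => M q.1 q.2 : R^o).
    have oM : open [set: 'M[R]_(m, n)] := openT.
    apply: (smooth_entry oM _ _ (M := fun M => M)).
    by apply: (smooth_lin oM (l := idfun)) => M; exact: cvg_id.
  apply: (lin_comp_smooth (l := fun z : Z => z.1.2) _ _ openT se) => // z.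
  exact: (cvg_comp _ _ cvg_fst cvg_snd).
case: A => [k|q].
  have [al [be [ga H]]] := hor_polynomial ordG natG k i l.
  exists (fun z : Z => \sum_p z.1.1.2 0 p * (\sum_b \sum_t C (Some b, t) z * ga p b t
      + \sum_t \sum_u C (None, t) z * C (None, u) z * be p t u)
    + \sum_q z.1.2 q.1 q.2 * \sum_t C (None, t) z * al q t).
    have sc c : smooth_on setT (fun _ : Z => c : R^o) by exact: smooth_cst.
    apply: (smoothD oT); apply: (smooth_sum oT) => p; apply: (smoothM oT) => //.
      apply: (smoothD oT); apply: (smooth_sum oT) => b; apply: (smooth_sum oT) => t; apply: (smoothM oT) => //.
      exact: (smoothM oT).
    by apply: (smooth_sum oT) => t; exact: (smoothM oT).
  move=> L K [[x y] v] /= Dx; have [L0 [K0 [c0 c1 ->]]] := trivialization natG L K Dx.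
  rewrite H; congr (_ + _).
    apply: eq_bigr => p _; congr (_ * (_ + _)); apply: eq_bigr => b _; apply: eq_bigr => t _.
      by rewrite CE c1.
    by rewrite !CE !c0.
  by apply: eq_bigr => b _; congr (_ * _); apply: eq_bigr => t _; rewrite CE c0.
have [d H] := ver_polynomial ordG natG q i l.
exists (fun z : Z => \sum_t C (None, t) z * d t).
  by apply: (smooth_sum oT) => t; apply: (smoothM oT) => //; exact: smooth_cst.
move=> L K [[x y] v] /= Dx; have [L0 [K0 [c0 c1 ->]]] := trivialization natG L K Dx.
by rewrite H; apply: eq_bigr => t _; rewrite CE c0.
Qed.

End FirstOrder.

Theorem theorem3p8 (R : realType) (m n s r : nat) (Gam : rule R m n) :
  (r <= s + 2)%N ->
  natural s r Gam ->
  of_order 1 1 Gam /\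
  exists a1 a2 a3 b1 b2 b3 c1 c2 c3 d1 d2 e1 e2 h1 : R,
  forall (E : vbundle R m n) (L : classical_connection E)
    (K : linear_connection E) (a : cidx E)
    (w : jco R m n) (A : 'I_m + 'I_n)
    (i : 'I_n) (mu : 'I_m),
  cimg (atlas a) w.1.1 ->
  Gam E L K a w A i mu =
    chi (DLK (L a) (K a)) w A i mu
    + theta_hK (K a) (S_tensor (L a) a1 a2 a3) w A i mu
    + liouville_tensor
        (G_tensor (L a) (K a) b1 b2 b3 c1 c2 c3 d1 d2 e1) w A i mu
    + e2 * curv_liouville (K a) w A i mu
    + h1 * nuK_htor (L a) (K a) w A i mu.

Proof.
move=> _ [ordG natG]; split; first exact: order_one ordG natG.
exact: classification ordG natG.
Qed.
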